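(* Suppose that $M(z,x,u)$ and $M_1(z,x)$ are the solutions of the catalytic equation $$P(M(z,x,u),M_1(z,x),z,x,u)=0,$$ where the function $P(x_0,x_1,z,x,u)$ is analytic and $M_1(z,1)$ has a singularity at $z=z_0$ of the form $$M_1(z,1) = y_0+y_2\left(1-\frac{z}{z_0}\right)+y_3\left(1-\frac{z}{z_0}\right)^{3/2}+\cdots,$$ with $y_3\ne 0$, such that for $x_0=M(z_0,1,u_0)$, $x_1=M_1(z_0,1)$, $z=z_0$, $x=1$, and $u=u_0$ we have $$P=0,\quad P_u=0,\quad P_{x_0}=0,\quad P_{x_1}\ne 0,\quad P_{x_0x_0}P_{uu}=P_{x_0u}^2.$$ Furthermore, let $z=\rho(x)$, $u=u_0(x)$, $x_0=x_0(x)$, $x_1=x_1(x)$ for $x$ close to $1$ be defined by $\rho(1)=z_0$, $u_0(1)=u_0$, $x_0(1)=M(z_0,1,u_0)$, $x_1(1)=M_1(z_0,1)$ and by the system $$P=0,\quad P_u=0,\quad P_{x_0}=0,\quad P_{x_0x_0}P_{uu}=P_{x_0u}^2.$$ Then for $x$ close to $1$ the function $M_1(z,x)$ has a local singular representation of the form $$M_1(z,x) = a_0(x)+a_2(x)\left(1-\frac{z}{\rho(x)}\right)+a_3(x)\left(1-\frac{z}{\rho(x)}\right)^{3/2}+\cdots,$$ where the functions $a_j(x)$ are analytic at $x=1$ and satisfy $a_j(1)=y_j$.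
   Context: Subscripts of $P$ denote partial derivatives with respect to the indicated variables of $P(x_0,x_1,z,x,u)$ (so $P_{x_0x_0}=\partial^2P/\partial x_0^2$, etc.). No positivity of the coefficients of $P$ is assumed. The variable $u$ is the catalytic variable and $x$ is an additional parameter ranging over a complex neighbourhood of $1$. The dots in the singular expansions stand for further terms in powers of $(1-z/z_0)^{1/2}$, respectively $(1-z/\rho(x))^{1/2}$; the expansions are convergent and hold locally around $z=z_0$, respectively $z=\rho(x)$.
   Formalization: Two added hypotheses: the system defining ρ, u_0, x_0, x_1 has nonzero Jacobian at x=1; and for x=1, z near z_0 (slit), P_{x_0}=0 has a solution u=U(z) in the domain of M with U(z)→u_0 and M(z,1,U(z))→M(z_0,1,u_0). Without them the claim is false. *)

(* Defs.v *)
From HB Require Import structures.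
From mathcomp Require Import all_boot all_order all_algebra.
From mathcomp Require Import all_classical all_reals all_analysis.
From mathcomp Require Import complex.

Set Implicit Arguments.
Unset Strict Implicit.
Unset Printing Implicit Defensive.
Import Order.TTheory GRing.Theory Num.Theory.
Import numFieldNormedType.Exports.
Local Open Scope classical_set_scope.
Local Open Scope ring_scope.

(* The complex numbers. Keeping the constant folded as a numClosedFieldType
   lets the topology of numFieldNormedType be inferred. In this ordered
   structure 0 < r means that r is a positive real; the norm on 'rV[C R]_n is
   the maximum norm, so that balls are polydiscs. *)
Definition C (R : realType) : numClosedFieldType := R[i].

Definition pt (R : realType) (n : nat) (t : seq (C R)) : 'rV[C R]_n :=
  \row_i t`_i.
Arguments pt {R n} t.

(* Sum of the terms c_alpha h^alpha over the box alpha in {0, ..., N-1}^n. *)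
Definition psum (R : realType) (n : nat) (c : {ffun 'I_n -> nat} -> C R)
    (h : 'rV[C R]_n) (N : nat) : C R :=
  \sum_(alpha : {ffun 'I_n -> 'I_N})
    c [ffun i => nat_of_ord (alpha i)] * \prod_i h 0 i ^+ alpha i.

(* f is the sum of a power series on a polydisc around p. The bound makes the
   series absolutely convergent for `|v - p| < r, so that summing over boxes
   is no restriction. *)
Definition analytic_at (R : realType) (n : nat) (f : 'rV[C R]_n -> C R)
    (p : 'rV[C R]_n) : Prop :=
  exists (c : {ffun 'I_n -> nat} -> C R) (r B : C R),
    [/\ 0 < r,
        forall alpha, `|c alpha| * r ^+ (\sum_i alpha i)%N <= B &
        forall v, `|v - p| < r -> psum c (v - p) @ \oo --> f v].

Definition analytic_on (R : realType) (n : nat) (f : 'rV[C R]_n -> C R)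
    (A : set 'rV[C R]_n) : Prop :=
  forall p, A p -> analytic_at f p.

Definition analytic1_at (R : realType) (f : C R -> C R) (x : C R) : Prop :=
  analytic_at (fun v : 'rV[C R]_1 => f (v 0 0)) (pt [:: x]).

Definition partial (R : realType) (n : nat) (i : 'I_n)
    (f : 'rV[C R]_n -> C R) (p : 'rV[C R]_n) : C R :=
  'D_(delta_mx 0 i) f p.

(* Positions of the variables of P(x0, x1, z, x, u). *)
Definition ix0 : 'I_5 := @Ordinal 5 0 isT.
Definition ix1 : 'I_5 := @Ordinal 5 1 isT.
Definition iz : 'I_5 := @Ordinal 5 2 isT.
Definition iu : 'I_5 := @Ordinal 5 4 isT.

Definition P_x0 (R : realType) (P : 'rV[C R]_5 -> C R) := partial ix0 P.
Definition P_x1 (R : realType) (P : 'rV[C R]_5 -> C R) := partial ix1 P.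
Definition P_u (R : realType) (P : 'rV[C R]_5 -> C R) := partial iu P.
Definition P_x0x0 (R : realType) (P : 'rV[C R]_5 -> C R) := partial ix0 (P_x0 P).
Definition P_x0u (R : realType) (P : 'rV[C R]_5 -> C R) := partial iu (P_x0 P).
Definition P_uu (R : realType) (P : 'rV[C R]_5 -> C R) := partial iu (P_u P).

Definition singular_system (R : realType) (P : 'rV[C R]_5 -> C R)
    (p : 'rV[C R]_5) : Prop :=
  [/\ P p = 0, P_u P p = 0, P_x0 P p = 0 &
      P_x0x0 P p * P_uu P p = P_x0u P p ^+ 2].

(* Jacobian of the four equations of singular_system with respect to the four
   unknowns x0, x1, z, u, with x as parameter. *)
Definition system_jacobian (R : realType) (P : 'rV[C R]_5 -> C R)
    (p : 'rV[C R]_5) : 'M[C R]_4 :=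
  \matrix_(i < 4, j < 4)
    partial (tnth [tuple ix0; ix1; iz; iu] j)
      (tnth [tuple P; P_u P; P_x0 P;
             (fun q => P_x0x0 P q * P_uu P q - P_x0u P q ^+ 2)] i) p.

(* The functions of x implicitly defined near x = 1 by the singular system:
   the system is regular in the unknowns at the base point, where the
   implicit function theorem applies, and the functions form the branch of
   solutions through that point. *)
Record defined_by_system (R : realType) (P : 'rV[C R]_5 -> C R)
    (x0b x1b z0 u0 : C R) (x0 x1 rho u : C R -> C R) : Prop := {
  regular_system :
    \det (system_jacobian P (pt [:: x0b; x1b; z0; 1; u0])) != 0;
  base_values : [/\ x0 1 = x0b, x1 1 = x1b, rho 1 = z0 & u 1 = u0];
  base_continuity :
    [/\ {for (1 : C R), continuous x0}, {for (1 : C R), continuous x1},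
        {for (1 : C R), continuous rho} & {for (1 : C R), continuous u}];
  solves_system :
    \forall x \near (1 : C R),
      singular_system P (pt [:: x0 x; x1 x; rho x; x; u x]) }.

(* M and M1 are analytic functions on open sets of points (z, x, u) and (z, x);
   outside these sets their values carry no information. *)
Record catalytic_solution (R : realType) (P : 'rV[C R]_5 -> C R)
    (W : set 'rV[C R]_5) (M : 'rV[C R]_3 -> C R) (Omega : set 'rV[C R]_3)
    (M1 : 'rV[C R]_2 -> C R) (D : set 'rV[C R]_2) : Prop := {
  open_W : open W;
  open_Omega : open Omega;
  open_D : open D;
  analytic_P : analytic_on P W;
  analytic_M : analytic_on M Omega;
  analytic_M1 : analytic_on M1 D;
  dom_M1 : forall z x u, Omega (pt [:: z; x; u]) -> D (pt [:: z; x]);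
  dom_P : forall z x u, Omega (pt [:: z; x; u]) ->
    W (pt [:: M (pt [:: z; x; u]); M1 (pt [:: z; x]); z; x; u]);
  catalytic_eq : forall z x u, Omega (pt [:: z; x; u]) ->
    P (pt [:: M (pt [:: z; x; u]); M1 (pt [:: z; x]); z; x; u]) = 0 }.

(* The branch of the square root on the plane slit along the nonpositive reals;
   sqrtC is not this branch. *)
Definition principal_sqrt (R : realType) (w s : C R) : Prop :=
  s ^+ 2 = w /\ 0 < 'Re s.

Definition slit_disc (R : realType) (z0 r : C R) : set (C R) :=
  [set z | exists2 s, principal_sqrt (1 - z / z0) s & `|s| < r].

Definition slit_region (R : realType) (rho : C R -> C R) (r : C R) :
    set 'rV[C R]_2 :=
  [set v | exists z x,
     [/\ v = pt [:: z; x], `|x - 1| < r & slit_disc (rho x) r z]].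

(* val = c_0 + c_1 w^(1/2) + c_2 w + c_3 w^(3/2) + ..., as a convergent series. *)
Definition sqrt_expansion (R : realType) (c : nat -> C R) (w val : C R) : Prop :=
  forall s, principal_sqrt w s ->
    series (fun j => c j * s ^+ j) @ \oo --> val.

(* The curve of the kernel method: for x = 1 and z in the slit disc, the
   equation P_x0(M(z,1,u), M1(z,1), z, 1, u) = 0 has a solution u = U(z) in the
   domain of M, and the point (z, 1, U(z)), at which the value of M is
   considered, tends to the base point as z tends to z0. This is what
   M(z0, 1, u0) refers to, since (z0, 1, u0) is in general a boundary point of
   the domain of M. *)
Record kernel_curve (R : realType) (P : 'rV[C R]_5 -> C R)
    (M : 'rV[C R]_3 -> C R) (Omega : set 'rV[C R]_3) (M1 : 'rV[C R]_2 -> C R)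
    (z0 u0 r : C R) (U : C R -> C R) : Prop := {
  curve_dom : forall z, slit_disc z0 r z -> Omega (pt [:: z; 1; U z]);
  curve_eq : forall z, slit_disc z0 r z ->
    P_x0 P (pt [:: M (pt [:: z; 1; U z]); M1 (pt [:: z; 1]);
                      z; 1; U z]) = 0;
  curve_lim_u : U z @[z --> within (slit_disc z0 r) (nbhs z0)] --> u0;
  curve_lim_M : M (pt [:: z; 1; U z])
    @[z --> within (slit_disc z0 r) (nbhs z0)] --> M (pt [:: z0; 1; u0]) }.

(* Main.v *)
(* In the four unknowns x0, x1, z, u, solve P = P_u = P_x0 = 0 together with
   P_x0x0 P_uu - P_x0u^2 = eta, where eta is a new parameter. By Cramer's rule the
   eta-derivatives of z and x1 vanish at eta = 0, so z = rho(x) + eta^2 m(eta, x) with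
   m(0, 1) <> 0: the critical points form a fold. Writing eta = s q(s, x) with
   q^2 m(s q, x) = - rho(x) gives z = rho(x) (1 - s^2) and x1 = G(s, x) with G analytic
   and G_s(0, x) = 0, and every critical point near the base point satisfies
   x1 = G(s, x) or x1 = G(-s, x). For x = 1 the points of the kernel curve are critical
   and power series have no zero divisors, so M1 = G(sg s, 1) for one sign sg; y_3 <> 0
   separates the two branches. Near a point (z, 1) the kernel curve extends to x <> 1 by
   the implicit function theorem, since the Hessian form is nondegenerate there, so
   M1 = G(sg s, x) near (z, 1), and the identity theorem carries this along connected sets. *)

(* At the base point the Hessian of [P] in [(x0, u)] is degenerate, so [P_u = P_x0 = 0] cannot be
   solved for [x0] and [u] by implicit functions, and [M] need not be analytic there. The two
   difficulties are kept apart: near the base point only the critical points of [P] are described,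
   while [M] is differentiated only at points of its domain. Prescribing eta does not change the
   Jacobian in the unknowns, so the regularity in [defined_by_system] is exactly what the implicit
   function theorem asks for. The price is that a critical point determines [s] only up to sign:
   every use of the fold yields an alternative, decided at [x = 1] by comparing power series and for
   [x] near 1 by continuity. The function theory rests on absolutely convergent series with a
   weighted norm. It is stable under substitution, and dividing by a variable divides the weight by
   its radius. Hadamard's lemma in this form replaces Cauchy's integral: it gives derivatives,
   Taylor coefficients and the contraction behind implicit functions. *)
Require Import Defs.
From HB Require Import structures.
From mathcomp Require Import all_boot all_order all_algebra.
From mathcomp Require Import all_classical all_reals all_analysis.
From mathcomp Require Import perm complex.
From mathcomp Require Import ring lra.
Set Implicit Arguments.
Unset Strict Implicit.
Unset Printing Implicit Defensive.
Import Order.TTheory GRing.Theory Num.Theory.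
Import numFieldNormedType.Exports.
Local Open Scope classical_set_scope.
Local Open Scope ring_scope.

(** * The modulus of complex numbers *)

Section ComplexModulus.
Variable R : realType.
Local Notation K := (C R).
Implicit Types (z w : K) (x y : R).

(** The norm of [C R] takes its values in [C R]; a modulus in [R] gives access to monotone
    convergence and linear arithmetic. *)
Definition nm z : R := complex.Re `|z|.
Definition rc x : K := real_complex R x.

Lemma rcD x y : rc (x + y) = rc x + rc y.
Proof. exact: (rmorphD (real_complex R)). Qed.
Lemma rcM x y : rc (x * y) = rc x * rc y.
Proof. exact: (rmorphM (real_complex R)). Qed.
Lemma rc0 : rc 0 = 0. Proof. by []. Qed.
Lemma rc1 : rc 1 = 1. Proof. by []. Qed.
Lemma rc_le x y : (rc x <= rc y) = (x <= y).
Proof. exact: lecR. Qed.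
Lemma rc_lt x y : (rc x < rc y) = (x < y).
Proof. exact: ltcR. Qed.
Lemma nmE z : `|z| = rc (nm z).
Proof. by rewrite /nm /rc [(`|z|)]normc_def. Qed.
Lemma nm_rc x : nm (rc x) = `|x|.
Proof. by rewrite /nm /rc [(`|_|)]normc_def /= expr0n addr0 sqrtr_sqr. Qed.
Lemma nm_ge0 z : 0 <= nm z.
Proof. by rewrite -rc_le -nmE rc0. Qed.
Lemma nm0 : nm 0 = 0.
Proof. by rewrite -rc0 nm_rc normr0. Qed.
Lemma nm1 : nm 1 = 1.
Proof. by rewrite -rc1 nm_rc normr1. Qed.
Lemma rcI : injective rc.
Proof. by move=> x y []. Qed.
Lemma nmM z w : nm (z * w) = nm z * nm w.
Proof. by apply: rcI; rewrite rcM -!nmE normrM. Qed.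
Lemma nmD z w : nm (z + w) <= nm z + nm w.
Proof. by rewrite -rc_le rcD -!nmE ler_normD. Qed.
Lemma nmN z : nm (- z) = nm z.
Proof. by apply: rcI; rewrite -!nmE normrN. Qed.
Lemma nmBC z w : nm (z - w) = nm (w - z).
Proof. by rewrite -nmN opprB. Qed.
Lemma nmB z w : nm (z - w) <= nm z + nm w.
Proof. by rewrite -(nmN w) nmD. Qed.
Lemma nm_eq0 z : nm z = 0 -> z = 0.
Proof. by move=> h; apply/normr0_eq0; rewrite nmE h. Qed.
Lemma nm_gt0 z : z != 0 -> 0 < nm z.
Proof.
by move=> h; rewrite lt_neqAle nm_ge0 andbT eq_sym; apply: contra h => /eqP /nm_eq0 ->.
Qed.
Lemma nmX z n : nm (z ^+ n) = nm z ^+ n.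
Proof. by elim: n => [|n IH]; rewrite ?expr0 ?nm1 // !exprS nmM IH. Qed.
Lemma nm_sum (T : Type) (s : seq T) (P : pred T) (F : T -> K) :
  nm (\sum_(i <- s | P i) F i) <= \sum_(i <- s | P i) nm (F i).
Proof.
elim/big_ind2: _ => [|z x w y h1 h2|//]; first by rewrite nm0.
exact: le_trans (nmD _ _) (lerD h1 h2).
Qed.
Lemma rc_gt0P (e : K) : 0 < e -> exists2 d : R, 0 < d & e = rc d.
Proof.
move=> e0; exists (nm e); first by rewrite nm_gt0 // gt_eqF.
by rewrite -nmE gtr0_norm.
Qed.

Lemma lt_rc_nm z x : (`|z| < rc x) = (nm z < x).
Proof. by rewrite nmE rc_lt. Qed.

Lemma cvg_nmP (T : Type) (F : set_system T) {FF : Filter F} (f : T -> K) (l : K) :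
  f @ F --> l <-> forall e, 0 < e -> \forall t \near F, nm (l - f t) <= e.
Proof.
split.
  move=> /cvgrPdist_le h e e0.
  have e0' : 0 < rc e by rewrite -rc0 rc_lt.
  by apply: filterS (h _ e0') => t; rewrite nmE rc_le.
move=> h; apply/cvgrPdist_le => e /rc_gt0P [d d0 ->].
by apply: filterS (h _ d0) => t; rewrite nmE rc_le.
Qed.

Lemma cvg_nm_le (F : set_system nat) {FF : ProperFilter F} (f : nat -> K) (l : K) x :
  f @ F --> l -> (\forall t \near F, nm (f t) <= x) -> nm l <= x.
Proof.
move=> /cvg_nmP h1 h2; apply/ler_addgt0Pr => e e0.
have [t [h3 h4]] := filter_ex (filterI (h1 _ e0) h2).
rewrite -(subrK (f t) l) addrC; apply: le_trans (nmD _ _) _.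
by apply: lerD.
Qed.

Lemma real_series_cvg (u : nat -> R) (v : nat -> R) B :
  (forall n, `|u n| <= v n) -> (forall N, \sum_(n < N) v n <= B) ->
  cvgn (series u).
Proof.
move=> h1 h2; apply: normed_cvg; apply: (@series_le_cvg _ (fun n => `|u n|) v).
- by move=> n; exact: normr_ge0.
- by move=> n; exact: le_trans (normr_ge0 _) (h1 n).
- by [].
- apply: nondecreasing_is_cvgn.
    apply/nondecreasing_seqP => n; rewrite seriesSr lerDl.
    exact: le_trans (normr_ge0 _) (h1 n).
  by exists B => _ [n _ <-]; rewrite /series /= big_mkord.
Qed.

Lemma nm_Re z : `|complex.Re z| <= nm z.
Proof. by rewrite -rc_le -nmE; exact: normc_ge_Re. Qed.

Lemma nm_Im z : `|complex.Im z| <= nm z.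
Proof.
have -> : nm z = nm (z * complex.Complex 0 1).
  rewrite nmM -[LHS]mulr1; congr (_ * _).
  by rewrite /nm [(`|_|)]normc_def /= expr0n add0r expr1n sqrtr1.
have := nm_Re (z * complex.Complex 0 1).
by case: z => a b /=; rewrite mulr0 mulr1 add0r normrN.
Qed.

Lemma cvg_rc (f : nat -> R) (l : R) : f @ \oo --> l -> (rc \o f) @ \oo --> rc l.
Proof.
move=> /cvgrPdist_le h; apply/cvg_nmP => e e0.
apply: filterS (h _ e0) => n /=.
by rewrite -(nm_rc (l - f n)) rcD [rc (- _)](rmorphN (real_complex R)).
Qed.

(** Real and imaginary parts are dominated by the modulus, so completeness is only needed for real
    series. *)
Lemma absolute_cvg (f : nat -> K) B :
  (forall N, \sum_(n < N) nm (f n) <= B) -> cvgn (series f).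
Proof.
move=> h.
have [hr hi] := (real_series_cvg (fun n => nm_Re (f n)) h,
                 real_series_cvg (fun n => nm_Im (f n)) h).
pose I : K := complex.Complex 0 1.
have -> : series f = (fun n => (rc \o series (fun k => complex.Re (f k))) n +
                      I * (rc \o series (fun k => complex.Im (f k))) n).
  apply/funext => n; rewrite /series /=.
  elim: n => [|n IH]; first by rewrite !big_nil rc0 mulr0 addr0.
  rewrite !big_nat_recr //= IH !rcD mulrDr addrACA; congr (_ + _).
  exact: complexE.
apply: is_cvgD; first by apply/cvg_ex; eexists; apply: cvg_rc hr.
by apply: is_cvgMr; apply/cvg_ex; eexists; apply: cvg_rc hi.
Qed.

Lemma series_split (f : nat -> K) (l : K) n :
  series f @ \oo --> l ->
  series (fun k => f (n + k)%N) @ \oo --> l - \sum_(k < n) f k.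
Proof.
move=> h.
have -> : series (fun k => f (n + k)%N) = (fun N => series f (N + n)%N - \sum_(k < n) f k).
  apply/funext => N; rewrite /series /= !big_mkord addnC big_split_ord /=.
  by rewrite [RHS]addrC addKr.
by apply: cvgB; [rewrite (cvg_shiftn n (series f))|exact: cvg_cst].
Qed.

Lemma series_nm_le (f : nat -> K) (l : K) B :
  (forall N, \sum_(n < N) nm (f n) <= B) -> series f @ \oo --> l -> nm l <= B.
Proof.
move=> h hl; apply: (cvg_nm_le hl); apply: nearW => N.
by apply: le_trans (h N); rewrite /series /= big_mkord nm_sum.
Qed.
End ComplexModulus.

Lemma nonneg_series_ub (R : realType) (b : nat -> R) B :
  (forall n, 0 <= b n) -> (forall N, \sum_(n < N) b n <= B) ->
  exists2 l, (forall N, \sum_(n < N) b n <= l) & series b @ \oo --> l.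
Proof.
move=> b0 h.
have hnd : nondecreasing_seq (series b).
  by apply/nondecreasing_seqP => n; rewrite seriesSr lerDl.
have hc : cvgn (series b).
  apply: nondecreasing_is_cvgn => //.
  by exists B => _ [n _ <-]; rewrite /series /= big_mkord.
exists (limn (series b)) => // N.
by have := nondecreasing_cvgn_le hnd hc N; rewrite /series /= big_mkord.
Qed.

Lemma cvg_finsum (K : numFieldType) (T : Type) (F : set_system T) {FF : Filter F}
    (I : finType) (f : I -> T -> K) (l : I -> K) :
  (forall i, f i @ F --> l i) -> (fun t => \sum_i f i t) @ F --> \sum_i l i.
Proof.
move=> h; rewrite !unlock /=.
elim: (index_enum I) => [|i s IH] /=; first exact: cvg_cst.
exact: (cvgD (h i) IH).
Qed.

(** * Weighted power series *)

Section WeightedPowerSeries.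
Variable R : realType.
Local Notation K := (C R).

Definition disc (I : finType) (r : I -> R) (v : I -> K) : Prop :=
  forall i, nm (v i) <= r i.

(* [An r f b]: on the closed polydisc of radii [r], [f] is the sum of a power
   series with [sum_alpha |c_alpha| r^alpha <= b]. The inductive form makes
   stability under substitution immediate. *)
Inductive An (I : finType) (r : I -> R) : ((I -> K) -> K) -> R -> Prop :=
| An_cst c b : nm c <= b -> An r (fun=> c) b
| An_coord i b : r i <= b -> An r (fun v => v i) b
| An_add f g a b : An r f a -> An r g b -> An r (fun v => f v + g v) (a + b)
| An_mul f g a b : An r f a -> An r g b -> An r (fun v => f v * g v) (a * b)
| An_series (f : nat -> (I -> K) -> K) (b : nat -> R) g B :
    (forall n, An r (f n) (b n)) -> (forall N, \sum_(n < N) b n <= B) ->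
    (forall v, disc r v -> series (f ^~ v) @ \oo --> g v) -> An r g B.

Lemma An_ge0 (I : finType) (r : I -> R) f b :
  (forall i, 0 <= r i) -> An r f b -> 0 <= b.
Proof.
move=> r0; elim=> {f b}.
- by move=> c b; apply: le_trans; exact: nm_ge0.
- by move=> i b; apply: le_trans.
- by move=> *; exact: addr_ge0.
- by move=> *; exact: mulr_ge0.
- move=> f b g B _ IH h _; have := h 0%N; by rewrite big_ord0.
Qed.

Lemma An_nm (I : finType) (r : I -> R) f b v :
  (forall i, 0 <= r i) -> An r f b -> disc r v -> nm (f v) <= b.
Proof.
move=> r0 A dv; elim: A => {f b}.
- by [].
- by move=> i b; apply: le_trans; exact: dv.
- by move=> f g a b _ h1 _ h2; exact: le_trans (nmD _ _) (lerD h1 h2).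
- by move=> f g a b _ h1 _ h2; rewrite nmM ler_pM ?nm_ge0.
- move=> f b g B _ IH h hg.
  apply: (series_nm_le _ (hg _ dv)) => N; apply: le_trans (h N).
  by apply: ler_sum => n _; exact: IH.
Qed.

(** Substitution follows the inductive form: a coordinate of weight [r i] is replaced by a function
    of weighted norm at most [r i]. *)
Lemma An_comp (I I' : finType) (r : I -> R) (r' : I' -> R) f b
    (g : I -> (I' -> K) -> K) :
  (forall i, 0 <= r' i) -> (forall i, An r' (g i) (r i)) -> An r f b ->
  An r' (fun v => f (g ^~ v)) b.
Proof.
move=> r0 hg; elim=> {f b}.
- by move=> c b h; exact: An_cst.
(* The bound has to grow from [r i] to [b] for an arbitrary function; a series with one nonzero term
   achieves this. *)
- move=> i b h; apply: (@An_series _ _ (fun n => if n is 0%N then g i else fun=> 0)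
    (fun n => if n is 0%N then r i else 0)).
  + by case=> // n; apply: An_cst; rewrite nm0.
  + case=> [|N]; first by rewrite big_ord0 (le_trans _ h) // (An_ge0 r0 (hg i)).
    by rewrite big_ord_recl /= big1 ?addr0.
  + move=> v _; rewrite -(cvg_shiftn 1%N).
    rewrite (_ : (fun _ => _) = (fun=> g i v)); first exact: cvg_cst.
    by apply/funext => n; rewrite /series /= addn1 big_nat_recl //= big1 ?addr0.
- by move=> f1 f2 a b _ h1 _ h2; exact: An_add h1 h2.
- by move=> f1 f2 a b _ h1 _ h2; exact: An_mul h1 h2.
- move=> f b h B _ IH hb hh; apply: (An_series IH hb) => v dv.
  by apply: hh => i; exact: An_nm (hg i) dv.
Qed.

(** [An_series] constrains its sum only on the polydisc, so a one-term series may both enlarge the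
    bound and change the function outside. *)
Lemma An_weak (I : finType) (r : I -> R) f g b B : (forall i, 0 <= r i) ->
  An r f b -> b <= B -> (forall v, disc r v -> f v = g v) -> An r g B.
Proof.
move=> r0 h hb e; apply: (@An_series _ _ (fun n => if n is 0%N then f else fun=> 0)
    (fun n => if n is 0%N then b else 0)).
+ by case=> // n; apply: An_cst; rewrite nm0.
+ case=> [|N]; first by rewrite big_ord0 (le_trans _ hb) // (An_ge0 r0 h).
  by rewrite big_ord_recl /= big1 ?addr0.
+ move=> v dv; rewrite -(cvg_shiftn 1%N).
  rewrite (_ : (fun _ => _) = (fun=> g v)); first exact: cvg_cst.
  by apply/funext => n; rewrite /series /= addn1 big_nat_recl //= big1 ?addr0 ?e.
Qed.

Lemma An_le (I : finType) (r : I -> R) f b B : (forall i, 0 <= r i) ->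
  An r f b -> b <= B -> An r f B.
Proof. by move=> r0 h hb; exact: An_weak h hb _. Qed.

Lemma An_radii (I : finType) (r r' : I -> R) f b : (forall i, 0 <= r' i) ->
  (forall i, r' i <= r i) -> An r f b -> An r' f b.
Proof.
move=> r0 h A; apply: (An_comp (g := fun i v => v i) r0 _ A) => i.
exact: An_coord.
Qed.

Lemma An_sum (I J : finType) (r : I -> R) (f : J -> (I -> K) -> K) (b : J -> R)
    (P : pred J) :
  (forall j, P j -> An r (f j) (b j)) ->
  An r (fun v => \sum_(j | P j) f j v) (\sum_(j | P j) b j).
Proof.
move=> h.
have -> : (fun v => \sum_(j | P j) f j v) =
          (\big[(fun f g v => f v + g v)/(fun=> 0)]_(j | P j) f j).
  apply/funext => v; elim/big_rec2: _ => [//|j x y _ <-//].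
elim/big_ind2: _ => [|f1 b1 f2 b2 h1 h2|//]; first by apply: An_cst; rewrite nm0.
exact: An_add.
Qed.

Lemma An_prod (I J : finType) (r : I -> R) (f : J -> (I -> K) -> K) (b : J -> R)
    (P : pred J) :
  (forall j, P j -> An r (f j) (b j)) ->
  An r (fun v => \prod_(j | P j) f j v) (\prod_(j | P j) b j).
Proof.
move=> h.
have -> : (fun v => \prod_(j | P j) f j v) =
          (\big[(fun f g v => f v * g v)/(fun=> 1)]_(j | P j) f j).
  apply/funext => v; elim/big_rec2: _ => [//|j x y _ <-//].
elim/big_ind2: _ => [|f1 b1 f2 b2 h1 h2|//]; first by apply: An_cst; rewrite nm1.
exact: An_mul.
Qed.

Lemma An_exp (I : finType) (r : I -> R) f b n :
  An r f b -> An r (fun v => f v ^+ n) (b ^+ n).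
Proof.
move=> h; elim: n => [|n IH]; first by apply: An_cst; rewrite nm1.
rewrite exprS (_ : (fun _ => _) = (fun v => f v * f v ^+ n)); first exact: An_mul.
by apply/funext => v; rewrite exprS.
Qed.

Definition zap (I : finType) (J : pred I) (v : I -> K) : I -> K :=
  fun i => if J i then 0 else v i.

Lemma disc_zap (I : finType) (J : pred I) (r : I -> R) v :
  (forall i, 0 <= r i) -> disc r v -> disc r (zap J v).
Proof. by move=> r0 h i; rewrite /zap; case: ifP => // _; rewrite nm0. Qed.

Lemma Cvg_unique (u : nat -> K) (l l' : K) : u @ \oo --> l -> u @ \oo --> l' -> l = l'.
Proof. by move=> h h'; exact: (@cvg_unique K (@norm_hausdorff K K) (u @ \oo) _ l l' h h'). Qed.

(** Each monomial containing a variable of [J] is divided by one such variable, which divides its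
    weight by the radius; so the weights of the pieces, multiplied back, add up to at most [b]. This
    sharp inequality makes the induction close: it bounds the series of quotients in the case
    [An_series]. *)
Lemma hadamard (I : finType) (r : I -> R) (J : pred I) f b :
  (forall i, 0 < r i) -> An r f b ->
  exists (B0 : R) (h : I -> (I -> K) -> K) (B : I -> R),
    [/\ An r (fun v => f (zap J v)) B0, forall i, An r (h i) (B i),
        B0 + \sum_i r i * B i <= b,
        forall v, disc r v -> f v = f (zap J v) + \sum_i v i * h i v &
        forall i v, ~~ J i -> h i v = 0].
Proof.
move=> rp; have r0 i : 0 <= r i by exact: ltW.
elim=> {f b}.
- move=> c b hc; exists b, (fun _ _ => 0), (fun=> 0); split.
  + exact: An_cst.
  + by move=> i; apply: An_cst; rewrite nm0.
  + by rewrite big1 ?addr0 // => i _; rewrite mulr0.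
  + by move=> v _; rewrite big1 ?addr0 // => i _; rewrite mulr0.
  + by [].
- move=> i b hi; have [Ji|Ji] := boolP (J i).
  + exists 0, (fun j _ => (j == i)%:R), (fun j => (j == i)%:R); split.
    * by rewrite /zap Ji; apply: An_cst; rewrite nm0.
    * by move=> j; apply: An_cst; case: eqP => _; rewrite ?nm0 ?nm1.
    * rewrite add0r (bigD1 i) //= eqxx mulr1 big1 ?addr0 // => j /negPf ->.
      by rewrite mulr0.
    * move=> v _; rewrite /zap Ji add0r (bigD1 i) //= eqxx mulr1 big1 ?addr0 //.
      by move=> j /negPf ->; rewrite mulr0.
    * by move=> j v; case: eqP => // ->; rewrite Ji.
  + exists b, (fun _ _ => 0), (fun=> 0); split.
    * by rewrite /zap (negPf Ji); exact: An_coord.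
    * by move=> j; apply: An_cst; rewrite nm0.
    * by rewrite big1 ?addr0 // => j _; rewrite mulr0.
    * move=> v _; rewrite /zap (negPf Ji) big1 ?addr0 // => j _; by rewrite mulr0.
    * by [].
- move=> f g a b _ [F0 [h [H [h1 h2 h3 h4 h5]]]] _ [G0 [k [L [k1 k2 k3 k4 k5]]]].
  exists (F0 + G0), (fun i v => h i v + k i v), (fun i => H i + L i); split.
  + exact: An_add.
  + by move=> i; exact: An_add.
  + under eq_bigr do rewrite mulrDr.
    by rewrite big_split addrACA lerD.
  + move=> v dv; under eq_bigr do rewrite mulrDr.
    by rewrite big_split /= addrACA -h4 // -k4.
  + by move=> i v Ji; rewrite h5 // k5 // addr0.
- move=> f g a b Af [F0 [h [H [h1 h2 h3 h4 h5]]]] Ag [G0 [k [L [k1 k2 k3 k4 k5]]]].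
  (* The Leibniz splitting [f g - f0 g0 = (f - f0) g + f0 (g - g0)], where [f0] and [g0] are taken
     after [zap]. *)
  exists (F0 * G0), (fun i v => h i v * g v + f (zap J v) * k i v),
    (fun i => H i * b + F0 * L i); split.
  + exact: An_mul.
  + by move=> i; apply: An_add; apply: An_mul.
  + under eq_bigr do rewrite mulrDr mulrA mulrCA.
    rewrite big_split /= -mulr_suml -mulr_sumr addrCA -mulrDr addrC.
    have F0p := An_ge0 r0 h1; have b0 := An_ge0 r0 Ag.
    apply: le_trans (_ : F0 * b + (\sum_i r i * H i) * b <= _).
      by rewrite lerD2r ler_wpM2l.
    by rewrite -mulrDl ler_wpM2r.
  + move=> v dv; under eq_bigr do rewrite mulrDr mulrA mulrCA.
    rewrite big_split /= -mulr_suml -mulr_sumr.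
    have -> : \sum_i v i * h i v = f v - f (zap J v) by rewrite h4 // addrC addKr.
    have -> : \sum_i v i * k i v = g v - g (zap J v) by rewrite [g v]k4 // addrC addKr.
    by ring.
  + by move=> i v Ji; rewrite h5 // k5 // mul0r mulr0 addr0.
- move=> f b g B Af IH hB hg.
  have /choice [p hp] : forall n, exists p : R * (I -> (I -> K) -> K) * (I -> R),
    [/\ An r (fun v => f n (zap J v)) p.1.1, forall i, An r (p.1.2 i) (p.2 i),
        p.1.1 + \sum_i r i * p.2 i <= b n,
        forall v, disc r v -> f n v = f n (zap J v) + \sum_i v i * p.1.2 i v &
        forall i v, ~~ J i -> p.1.2 i v = 0].
    by move=> n; have [B0 [h [H hh]]] := IH n; exists (B0, h, H).
  have p0 n : 0 <= (p n).1.1 by case: (hp n) => /(An_ge0 r0).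
  have p2 n i : 0 <= (p n).2 i by case: (hp n) => _ /(_ i) /(An_ge0 r0).
  have s0 n i : 0 <= r i * (p n).2 i by rewrite mulr_ge0.
  have q0 N : \sum_(n < N) (p n).1.1 <= B.
    apply: le_trans (hB N); apply: ler_sum => n _; case: (hp n) => _ _ h _ _.
    by apply: le_trans h; rewrite lerDl sumr_ge0.
  have q2 i N : \sum_(n < N) (p n).2 i <= B / r i.
    rewrite ler_pdivlMr // mulrC mulr_sumr; apply: le_trans (hB N).
    apply: ler_sum => n _; case: (hp n) => _ _ h _ _; apply: le_trans h.
    rewrite (bigD1 i) //= addrCA lerDl addr_ge0 // sumr_ge0 //.
  (* The new bounds are the sums of the series of bounds, not the crude [B] and [B / r i]; only then
     does the sharp inequality pass to the limit. *)
  have [l0 l0u l0c] := nonneg_series_ub p0 q0.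
  have /choice [L hL] : forall i, exists L, (forall N, \sum_(n < N) (p n).2 i <= L) /\
     series (fun n => (p n).2 i) @ \oo --> L.
    move=> i.
    by have [l h1 h2] := nonneg_series_ub (fun n => p2 n i) (q2 i); exists l.
  have hcv i v : disc r v -> cvgn (series (fun n => (p n).1.2 i v)).
    move=> dv; apply: (@absolute_cvg _ _ (L i)) => N; case: (hL i) => + _.
    move=> /(_ N); apply: le_trans; apply: ler_sum => n _.
    by case: (hp n) => _ /(_ i) A _ _ _; exact: An_nm A dv.
  exists l0, (fun i v => limn (series (fun n => (p n).1.2 i v))), L; split.
  + apply: (@An_series _ _ (fun n v => f n (zap J v)) (fun n => (p n).1.1)).
    * by move=> n; case: (hp n).
    * exact: l0u.
    * by move=> v dv; apply: hg; exact: disc_zap.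
  + move=> i; apply: (@An_series _ _ (fun n => (p n).1.2 i) (fun n => (p n).2 i)).
    * by move=> n; case: (hp n).
    * by case: (hL i).
    * by move=> v dv; exact: hcv.
  + have hc : (fun N => series (fun n => (p n).1.1) N +
        \sum_i r i * series (fun n => (p n).2 i) N) @ \oo --> l0 + \sum_i r i * L i.
      apply: (cvgD l0c); apply: cvg_finsum => i; apply: cvgMr; exact: (hL i).2.
    have := limr_le (cvgP _ hc); rewrite (cvg_lim _ hc) //; apply.
    apply: nearW => N; apply: le_trans (hB N).
    under [X in _ + X]eq_bigr do rewrite mulr_sumr.
    rewrite exchange_big /= big_mkord /series /= big_mkord -big_split /=.
    by apply: ler_sum => n _; case: (hp n).
  + move=> v dv; apply: Cvg_unique (hg v dv) _.
    have -> : series (f^~ v) = (fun N => series (fun n => f n (zap J v)) N +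
        \sum_i v i * series (fun n => (p n).1.2 i v) N).
      apply/funext => N; rewrite /series /=.
      under [X in _ + X]eq_bigr do rewrite mulr_sumr.
      rewrite exchange_big /= -big_split /=; apply: eq_bigr => n _.
      by case: (hp n) => _ _ _ -> //.
    apply: cvgD; first by apply: hg; exact: disc_zap.
    apply: cvg_finsum => i; apply: cvgMr; exact: hcv.
  + move=> i v Ji; apply: (cvg_lim (@norm_hausdorff _ _)).
    rewrite (_ : series _ = (fun=> 0)); first exact: cvg_cst.
    apply/funext => N; rewrite /series /= big1 // => n _.
    by case: (hp n) => _ _ _ _ ->.
Qed.
End WeightedPowerSeries.

(** * Germs of holomorphic functions *)

Lemma fin_common_radius (R : realType) (I : finType) (Q : I -> R -> Prop) :
  (forall i, exists2 e, 0 < e & forall d, 0 < d -> d <= e -> Q i d) ->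
  exists2 e, 0 < e & forall i d, 0 < d -> d <= e -> Q i d.
Proof.
move=> h.
suff [e e0 he] : exists2 e, 0 < e &
    forall i, i \in enum I -> forall d, 0 < d -> d <= e -> Q i d.
  by exists e => // i; apply: he; rewrite mem_enum.
elim: (enum I) => [|i s [e e0 he]]; first by exists 1.
have [e' e'0 he'] := h i; exists (Num.min e e'); first by rewrite lt_min e0.
move=> j; rewrite inE => /orP [/eqP -> d d0|js d d0]; rewrite le_min => /andP [h1 h2].
  exact: he'.
exact: he.
Qed.

Section Germs.
Variable R : realType.
Local Notation K := (C R).

Definition tr (I : Type) (p v : I -> K) : I -> K := fun i => p i + v i.

Lemma tr0 (I : Type) (p : I -> K) : tr p (fun=> 0) = p.
Proof. by apply/funext => i; rewrite /tr addr0. Qed.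

Lemma trB (I : Type) (p v : I -> K) : tr p (fun i => v i - p i) = v.
Proof. by apply/funext => i; rewrite /tr addrC subrK. Qed.

(** Variables are indexed by arbitrary finite types, so that new ones can be adjoined as [option I]
    or [I + J]; on such functions this filter takes the place of the topology of row vectors. *)
Definition nb (I : finType) (p : I -> K) : set_system (I -> K) :=
  fun Q => exists2 e : R, 0 < e & forall v, (forall i, nm (v i - p i) <= e) -> Q v.

Global Instance nb_filter (I : finType) (p : I -> K) : ProperFilter (nb p).
Proof.
split.
  move=> [e e0 /(_ p)]; apply => i; rewrite subrr nm0; exact: ltW.
split.
- by exists 1.
- move=> P Q [e e0 he] [d d0 hd]; exists (Num.min e d); first by rewrite lt_min e0.
  move=> v hv; split; [apply: he|apply: hd] => i; apply: le_trans (hv i) _.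
    by rewrite ge_min lexx.
  by rewrite ge_min lexx orbT.
- by move=> P Q PQ [e e0 he]; exists e => // v /he /PQ.
Qed.

Lemma nbI (I : finType) (p : I -> K) (P Q : set (I -> K)) :
  nb p P -> nb p Q -> nb p (fun v => P v /\ Q v).
Proof. by move=> h1 h2; exact: filterI. Qed.

Lemma nb_self (I : finType) (p : I -> K) (Q : set (I -> K)) : nb p Q -> Q p.
Proof. by move=> [e e0]; apply => i; rewrite subrr nm0 ltW. Qed.

Lemma nb_cvgP (T : Type) (F : set_system T) {FF : Filter F} (J : finType) (q : J -> K)
    (g : J -> T -> K) :
  (forall j, g j @ F --> q j) -> (fun t => g ^~ t) @ F --> nb q.
Proof.
move=> h Q [e e0 he].
have : \forall t \near F, forall j, nm (g j t - q j) <= e.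
  apply: filter_forall => j; have /cvg_nmP /(_ _ e0) := h j.
  by apply: filterS => t; rewrite nmBC.
by apply: filterS => t; exact: he.
Qed.

Lemma nb_near (I : finType) (p : I -> K) Q :
  (\forall v \near nb p, Q v) -> \forall v \near nb p, \forall w \near nb v, Q w.
Proof.
move=> [e e0 he]; exists (e / 2); first by rewrite divr_gt0.
move=> v hv; exists (e / 2); first by rewrite divr_gt0.
move=> w hw; apply: he => i; rewrite -(subrK (v i) (w i)) -addrA.
by apply: le_trans (nmD _ _) _; rewrite [e]splitr lerD.
Qed.

Definition hol (I : finType) (f : (I -> K) -> K) (p : I -> K) : Prop :=
  exists (e : R) (b : R), 0 < e /\ An (fun=> e) (fun v => f (tr p v)) b.

Lemma holI (I : finType) (f : (I -> K) -> K) (p : I -> K) (g : (I -> K) -> K) (e b : R) :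
  0 < e -> An (fun=> e) g b ->
  (forall v, (forall i, nm (v i) <= e) -> f (tr p v) = g v) -> hol f p.
Proof.
move=> e0 h hfg; exists e, b; split=> //.
by apply: (An_weak _ h (lexx _)) => [i|v hv]; [exact: ltW|rewrite hfg].
Qed.

Lemma hol_radius (I : finType) (f : (I -> K) -> K) (p : I -> K) : hol f p ->
  exists2 e : R, 0 < e & exists b, forall d, 0 < d -> d <= e ->
    An (fun=> d) (fun v => f (tr p v)) b.
Proof.
move=> [e [b [e0 h]]]; exists e => //; exists b => d d0 de.
by apply: (An_radii _ _ h) => i //; exact: ltW.
Qed.

Lemma hol_eq (I : finType) (f g : (I -> K) -> K) (p : I -> K) :
  (\forall v \near nb p, f v = g v) -> hol f p -> hol g p.
Proof.
move=> [d d0 hd] /hol_radius [e e0 [b he]].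
have m0 : 0 < Num.min d e by rewrite lt_min d0.
apply: (holI m0 (he _ m0 _)) => [|v hv]; first by rewrite ge_min lexx orbT.
rewrite hd // => i; rewrite /tr addrC addKr; apply: le_trans (hv i) _.
by rewrite ge_min lexx.
Qed.

(** Expanding at a nearby centre is an affine substitution, so [An_comp] replaces the rearrangement
    of a power series. *)
Lemma hol_nb (I : finType) (f : (I -> K) -> K) (p : I -> K) :
  hol f p -> \forall q \near nb p, hol f q.
Proof.
move=> [e [b [e0 h]]]; have e2 : 0 < e / 2 by rewrite divr_gt0.
exists (e / 2) => // q hq; apply: (holI e2 (g := fun v => f (tr p (fun i => (q i - p i) + v i)))).
  apply: (An_comp (g := fun i v => (q i - p i) + v i) _ _ h) => i; first exact: ltW.
  by rewrite /= [X in An _ _ X]splitr; apply: An_add; [exact: An_cst|exact: An_coord].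
by move=> v _; congr f; apply/funext => i; rewrite /tr addrA [p i + _]addrC subrK.
Qed.

Lemma hol_cst (I : finType) (c : K) (p : I -> K) : hol (fun=> c) p.
Proof. by apply: (holI ltr01 (@An_cst _ _ _ _ _ (lexx (nm c)))). Qed.

Lemma hol_coord (I : finType) (i : I) (p : I -> K) : hol (fun v => v i) p.
Proof.
apply: (holI ltr01 (g := fun v => p i + v i)) => //.
by apply: (An_add (a := nm (p i)) (b := 1)); [exact: An_cst|exact: An_coord].
Qed.

Lemma hol2_radius (I : finType) (f g : (I -> K) -> K) (p : I -> K) :
  hol f p -> hol g p -> exists e b c : R,
  [/\ 0 < e, An (fun=> e) (fun v => f (tr p v)) b & An (fun=> e) (fun v => g (tr p v)) c].
Proof.
move=> /hol_radius [e e0 [b he]] /hol_radius [d d0 [c hd]].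
have m0 : 0 < Num.min d e by rewrite lt_min d0.
exists (Num.min d e), b, c; split=> //; [apply: he|apply: hd] => //.
  by rewrite ge_min lexx orbT.
by rewrite ge_min lexx.
Qed.

Lemma hol_add (I : finType) (f g : (I -> K) -> K) (p : I -> K) :
  hol f p -> hol g p -> hol (fun v => f v + g v) p.
Proof.
move=> hf hg; have [e [b [c [e0 h1 h2]]]] := hol2_radius hf hg.
by apply: (holI e0 (An_add h1 h2)).
Qed.

Lemma hol_mul (I : finType) (f g : (I -> K) -> K) (p : I -> K) :
  hol f p -> hol g p -> hol (fun v => f v * g v) p.
Proof.
move=> hf hg; have [e [b [c [e0 h1 h2]]]] := hol2_radius hf hg.
by apply: (holI e0 (An_mul h1 h2)).
Qed.

Lemma hol_opp (I : finType) (f : (I -> K) -> K) (p : I -> K) :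
  hol f p -> hol (fun v => - f v) p.
Proof.
move=> hf; have := hol_mul (hol_cst (-1) p) hf; apply: hol_eq.
by apply: nearW => v; rewrite mulN1r.
Qed.

Lemma hol_sub (I : finType) (f g : (I -> K) -> K) (p : I -> K) :
  hol f p -> hol g p -> hol (fun v => f v - g v) p.
Proof. by move=> hf hg; apply: hol_add hf (hol_opp hg). Qed.

Lemma hol_exp (I : finType) (f : (I -> K) -> K) (p : I -> K) n :
  hol f p -> hol (fun v => f v ^+ n) p.
Proof.
move=> hf; elim: n => [|n IH]; first exact: hol_cst.
apply: hol_eq (hol_mul hf IH); by apply: nearW => v; rewrite exprS.
Qed.

Lemma hol_sum (I J : finType) (f : J -> (I -> K) -> K) (p : I -> K) :
  (forall j, hol (f j) p) -> hol (fun v => \sum_j f j v) p.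
Proof.
move=> h; rewrite unlock; elim: (index_enum J) => [|j s IH] /=; first exact: hol_cst.
exact: hol_add.
Qed.

(* The coordinates in [J] are replaced by those of [p]. *)
Definition put (I : finType) (J : pred I) (p v : I -> K) : I -> K :=
  fun i => if J i then p i else v i.

Lemma hol_hadamard (I : finType) (J : pred I) (f : (I -> K) -> K) (p : I -> K) :
  hol f p -> exists2 h : I -> (I -> K) -> K, forall i, hol (h i) p &
  \forall v \near nb p, f v = f (put J p v) + \sum_(i | J i) (v i - p i) * h i v.
Proof.
move=> [e [b [e0 h]]].
have [B0 [k [B [k1 k2 k3 k4 k5]]]] := hadamard J (fun _ => e0) h.
exists (fun i v => k i (fun j => v j - p j)).
  move=> i; apply: (holI e0 (k2 i)) => v _; congr (k i).
  by apply/funext => j; rewrite /tr addrC addKr.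
exists e => // v hv; have := k4 _ hv; rewrite trB => ->.
congr (f _ + _).
  apply/funext => i; rewrite /tr /zap /put.
  by case: ifP => _; rewrite ?addr0 // addrC subrK.
rewrite [RHS]big_mkcond; apply: eq_bigr => i _; case: ifP => // /negbT Ji.
by rewrite k5 // mulr0.
Qed.

(** The weighted norm, and not only the modulus, approaches [nm (f p)] as the radius shrinks:
    Hadamard's lemma leaves [nm (f p) + d * S]. Germs can therefore be substituted into each
    other. *)
Lemma hol_small (I : finType) (f : (I -> K) -> K) (p : I -> K) (B : R) :
  hol f p -> nm (f p) < B ->
  exists2 e : R, 0 < e & forall d, 0 < d -> d <= e -> An (fun=> d) (fun v => f (tr p v)) B.
Proof.
move=> [e [b [e0 h]]] hB.
have [B0 [k [L [_ k2 _ k4 _]]]] := hadamard predT (fun _ => e0) h.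
have L0 i : 0 <= L i by apply: An_ge0 (k2 i) => _; exact: ltW.
set S := \sum_i L i.
have S0 : 0 <= S by apply: sumr_ge0.
set t := Num.min e ((B - nm (f p)) / (S + 1)).
have t0 : 0 < t by rewrite lt_min e0 divr_gt0 ?subr_gt0 // ltr_wpDl.
exists t => // d d0 dt.
have d0' := ltW d0.
have de : d <= e by apply: le_trans dt _; rewrite ge_min lexx.
have A : An (fun=> d) (fun v : I -> K => f p + \sum_i v i * k i v) (nm (f p) + \sum_i d * L i).
  apply: An_add; first exact: An_cst.
  apply: (@An_sum _ _ _ _ (fun i v => v i * k i v)) => i _.
  by apply: An_mul; [exact: An_coord|exact: An_radii (k2 i)].
apply: (An_weak _ A) => //.
  rewrite -mulr_sumr -/S -lerBrDl.
  apply: le_trans (_ : (B - nm (f p)) / (S + 1) * S <= _).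
    by rewrite ler_wpM2r // (le_trans dt) // ge_min lexx orbT.
  rewrite -mulrA ger_pMr ?subr_gt0 // mulrC ler_pdivrMr ?ltr_wpDl //.
  by rewrite mul1r lerDl.
move=> v dv; rewrite [RHS]k4; last by move=> i; exact: le_trans (dv i) de.
by congr (f _ + _); apply/funext => i; rewrite /tr /zap addr0.
Qed.

Lemma hol_cvg (I : finType) (f : (I -> K) -> K) (p : I -> K) :
  hol f p -> f @ nb p --> f p.
Proof.
move=> hf; apply/cvg_nmP => d d0.
have [|e e0 h] := @hol_small _ (fun v => f v - f p) p d (hol_sub hf (hol_cst _ _)).
  by rewrite subrr nm0.
exists e => // v hv; rewrite nmBC -[v in f v](trB p).
by apply: (An_nm (r := fun=> e) _ (h e e0 (lexx e)) hv) => _; exact: ltW.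
Qed.

Lemma hol_comp (I J : finType) (f : (J -> K) -> K) (g : J -> (I -> K) -> K)
    (p : I -> K) (q : J -> K) :
  (forall j, hol (g j) p) -> (forall j, g j p = q j) -> hol f q ->
  hol (fun v => f (g ^~ v)) p.
Proof.
move=> hg gq [e [b [e0 h]]].
have [d d0 hd] : exists2 d : R, 0 < d & forall j d', 0 < d' -> d' <= d ->
   An (fun=> d') (fun v => g j (tr p v) - q j) e.
  apply: fin_common_radius => j.
  apply: (hol_small (f := fun v => g j v - q j)); first exact: hol_sub (hol_cst _ _).
  by rewrite gq subrr nm0.
apply: (holI d0 (An_comp _ (fun j => hd j d d0 (lexx _)) h)); first by move=> _; exact: ltW.
by move=> v _; congr f; apply/funext => j; rewrite /tr addrC subrK.
Qed.

Lemma hol_cvg_nb (I J : finType) (g : J -> (I -> K) -> K) (p : I -> K) :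
  (forall j, hol (g j) p) -> (fun v => g ^~ v) @ nb p --> nb (g ^~ p).
Proof. by move=> h; apply: nb_cvgP => j; exact: hol_cvg. Qed.

Lemma hol_neq0 (I : finType) (f : (I -> K) -> K) (p : I -> K) :
  hol f p -> f p != 0 -> \forall v \near nb p, f v != 0.
Proof.
move=> hf h0; have e0 : 0 < nm (f p) / 2 by rewrite divr_gt0 ?nm_gt0.
have /cvg_nmP /(_ _ e0) := hol_cvg hf; apply: filterS => v; apply: contraTN.
move=> /eqP ->; rewrite subr0 -ltNge ltr_pdivrMr // ltr_pMr ?nm_gt0 //.
by rewrite ltr1n.
Qed.
End Germs.

(** * Partial derivatives *)

Lemma near_cvg (T U : Type) (F : set_system T) (G : set_system U) (g : T -> U)
    (Q : set U) : g @ F --> G -> G Q -> \forall t \near F, Q (g t).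
Proof. by move=> h /h. Qed.

Section PartialDerivatives.
Variable R : realType.
Local Notation K := (C R).

Definition step (I : finType) (p : I -> K) (i : I) (t : K) : I -> K :=
  fun k => p k + (if k == i then t else 0).

Definition pd (I : finType) (i : I) (f : (I -> K) -> K) (p : I -> K) : K :=
  lim ((fun t : K => t^-1 * (f (step p i t) - f p)) @ (0 : K)^').

Lemma cvg_cst0 (c : K) : (fun=> c) @ (0 : K) --> c.
Proof. exact: (@cvg_cst K c K (nbhs (0 : K)) (nbhs_filter (0 : K))). Qed.

Lemma cvgD0 (f g : K -> K) (a b : K) :
  f @ (0 : K) --> a -> g @ (0 : K) --> b -> (fun t => f t + g t) @ (0 : K) --> a + b.
Proof. exact: (@cvgD K K K (nbhs (0 : K)) (nbhs_filter (0 : K))). Qed.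

Lemma cvgB0 (f g : K -> K) (a b : K) :
  f @ (0 : K) --> a -> g @ (0 : K) --> b -> (fun t => f t - g t) @ (0 : K) --> a - b.
Proof. exact: (@cvgB K K K (nbhs (0 : K)) (nbhs_filter (0 : K))). Qed.

Lemma cvgM0 (f g : K -> K) (a b : K) :
  f @ (0 : K) --> a -> g @ (0 : K) --> b -> (fun t => f t * g t) @ (0 : K) --> a * b.
Proof. exact: (@cvgM K K (nbhs (0 : K)) (nbhs_filter (0 : K))). Qed.

Lemma near0W (Q : K -> Prop) : (forall t, Q t) -> \forall t \near (0 : K), Q t.
Proof. exact: (@nearW K (nbhs (0 : K)) Q (nbhs_filter (0 : K))). Qed.

Lemma step0 (I : finType) (p : I -> K) i : step p i 0 = p.
Proof. by apply/funext => k; rewrite /step; case: ifP; rewrite addr0. Qed.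

Lemma near0_nm (e : R) : 0 < e -> \forall t \near (0 : K), nm t <= e.
Proof.
move=> e0; have /cvg_nmP /(_ _ e0) := @cvg_id _ (nbhs (0 : K)).
by apply: filterS => t; rewrite sub0r nmN.
Qed.

Lemma step_cvg (I : finType) (p : I -> K) (i : I) : step p i @ (0 : K) --> nb p.
Proof.
move=> Q [e e0 he]; apply: filterS (near0_nm e0) => t te; apply: he => k.
by rewrite /step addrC addKr; case: ifP; rewrite ?nm0 // ltW.
Qed.

(** All derivatives below are computed in this way, by exhibiting the difference quotient as a
    function with a limit. *)
Lemma is_pd (I : finType) (f : (I -> K) -> K) (i : I) (p : I -> K) (h : K -> K) (l : K) :
  (\forall t \near (0 : K), f (step p i t) = f p + t * h t) ->
  h @ (0 : K) --> l -> pd i f p = l.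
Proof.
move=> hf hl; apply: (cvg_lim (@norm_hausdorff _ _)).
apply/cvg_nmP => e e0; have /cvg_nmP /(_ _ e0) hl' := hl.
rewrite /dnbhs /within /=; apply: filterS2 hf hl' => t ht le t0.
by rewrite ht [f p + _]addrC addrK mulKf.
Qed.

Lemma pd_hadamard (I : finType) (f : (I -> K) -> K) (i : I) (p : I -> K)
    (h : I -> (I -> K) -> K) :
  hol (h i) p -> (\forall v \near nb p, f v = f p + \sum_i (v i - p i) * h i v) ->
  pd i f p = h i p.
Proof.
move=> hh hf; apply: (is_pd (h := fun t => h i (step p i t))).
  have := near_cvg (@step_cvg _ p i) hf; apply: filterS => t /= ->; congr (_ + _).
  rewrite (bigD1 i) //= big1 ?addr0 => [|j /negPf ji]; last first.
    by rewrite /step ji addr0 subrr mul0r.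
  by rewrite {1}/step eqxx [p i + _]addrC addrK.
exact: (cvg_comp _ _ (@step_cvg _ p i) (hol_cvg hh)).
Qed.

Lemma hol_taylor1 (I : finType) (f : (I -> K) -> K) (p : I -> K) :
  hol f p -> exists h : I -> (I -> K) -> K,
  [/\ forall i, hol (h i) p, forall i, h i p = pd i f p &
  \forall v \near nb p, f v = f p + \sum_i (v i - p i) * h i v].
Proof.
move=> /(hol_hadamard predT) [h h1 h2].
have h3 : \forall v \near nb p, f v = f p + \sum_i (v i - p i) * h i v.
  by apply: filterS h2 => v ->.
by exists h; split=> // i; rewrite (pd_hadamard _ h3).
Qed.

Lemma pd_line (I : finType) (f : (I -> K) -> K) (i : I) (p : I -> K) : hol f p ->
  exists2 k : K -> K, k @ (0 : K) --> pd i f p &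
    \forall t \near (0 : K), f (step p i t) = f p + t * k t.
Proof.
move=> /hol_taylor1 [h [h1 h2 h3]]; exists (fun t => h i (step p i t)).
  rewrite -h2; exact: (cvg_comp _ _ (@step_cvg _ p i) (hol_cvg (h1 i))).
have := near_cvg (@step_cvg _ p i) h3; apply: filterS => t /= ->; congr (_ + _).
rewrite (bigD1 i) //= big1 ?addr0 => [|j /negPf ji]; last first.
  by rewrite /step ji addr0 subrr mul0r.
by rewrite {1}/step eqxx [p i + _]addrC addrK.
Qed.

Lemma pd_eq (I : finType) (f g : (I -> K) -> K) (i : I) (p : I -> K) :
  hol g p -> (\forall v \near nb p, f v = g v) -> pd i f p = pd i g p.
Proof.
move=> /(pd_line i) [k k1 k2] h; apply: is_pd k1.
have := near_cvg (@step_cvg _ p i) h; apply: filterS2 k2 => t h1 /= ->.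
by rewrite h1 (nb_self h).
Qed.

Lemma pd_cst (I : finType) (c : K) (i : I) (p : I -> K) : pd i (fun=> c) p = 0.
Proof.
apply: (is_pd (h := fun=> 0)); last exact: cvg_cst0.
by apply: near0W => t; rewrite mulr0 addr0.
Qed.

Lemma pd_coord (I : finType) (j i : I) (p : I -> K) :
  pd i (fun v => v j) p = (j == i)%:R.
Proof.
apply: (is_pd (h := fun=> (j == i)%:R)); last exact: cvg_cst0.
by apply: near0W => t; rewrite /step /= [in RHS]mulr_natr; case: eqP.
Qed.

Lemma pd_add (I : finType) (f g : (I -> K) -> K) (i : I) (p : I -> K) :
  hol f p -> hol g p -> pd i (fun v => f v + g v) p = pd i f p + pd i g p.
Proof.
move=> /(pd_line i) [k k1 k2] /(pd_line i) [l l1 l2].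
apply: (is_pd (h := fun t => k t + l t)); last exact: cvgD0.
by apply: filterS2 k2 l2 => t -> ->; ring.
Qed.

Lemma pd_mul (I : finType) (f g : (I -> K) -> K) (i : I) (p : I -> K) :
  hol f p -> hol g p ->
  pd i (fun v => f v * g v) p = pd i f p * g p + f p * pd i g p.
Proof.
move=> /(pd_line i) [k k1 k2] /(pd_line i) [l l1 l2].
apply: (is_pd (h := fun t => k t * g p + f p * l t + t * (k t * l t))).
  by apply: filterS2 k2 l2 => t -> ->; ring.
rewrite -[X in _ --> X]addr0 -[X in _ + X](mul0r (pd i f p * pd i g p)).
apply: cvgD0; first apply: cvgD0.
- exact: (cvgM0 k1 (@cvg_cst0 _)).
- exact: (cvgM0 (@cvg_cst0 _) l1).
- exact: (cvgM0 (@cvg_id _ _) (cvgM0 k1 l1)).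
Qed.

Lemma pd_sub (I : finType) (f g : (I -> K) -> K) (i : I) (p : I -> K) :
  hol f p -> hol g p -> pd i (fun v => f v - g v) p = pd i f p - pd i g p.
Proof.
move=> /(pd_line i) [k k1 k2] /(pd_line i) [l l1 l2].
apply: (is_pd (h := fun t => k t - l t)); last exact: cvgB0.
by apply: filterS2 k2 l2 => t -> ->; ring.
Qed.

Lemma pd_comp (I J : finType) (f : (J -> K) -> K) (g : J -> (I -> K) -> K)
    (i : I) (p : I -> K) (q : J -> K) :
  (forall j, hol (g j) p) -> (forall j, g j p = q j) -> hol f q ->
  pd i (fun v => f (g ^~ v)) p = \sum_j pd j f q * pd i (g j) p.
Proof.
move=> hg gq hf; have [h [h1 h2 h3]] := hol_taylor1 hf.
have /choice [k hk] : forall j, exists k : K -> K, k @ (0 : K) --> pd i (g j) p /\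
    \forall t \near (0 : K), g j (step p i t) = g j p + t * k t.
  by move=> j; have [k] := pd_line i (hg j); exists k.
have gq' : g ^~ p = q by apply/funext.
have gc : (fun t => g ^~ (step p i t)) @ (0 : K) --> nb q.
  rewrite -gq'; exact: (cvg_comp _ _ (@step_cvg _ p i) (hol_cvg_nb hg)).
apply: (is_pd (h := fun t => \sum_j h j (g ^~ (step p i t)) * k j t)).
  have hall : \forall t \near (0 : K), forall j, g j (step p i t) = g j p + t * k j t.
    by apply: (@filter_forall K J _ _ (nbhs_filter (0 : K))) => j; case: (hk j).
  have := near_cvg gc h3; apply: filterS2 hall => t ht /= ->.
  rewrite gq'; congr (_ + _); rewrite mulr_sumr; apply: eq_bigr => j _.
  by rewrite ht gq; ring.
apply: (@cvg_finsum K K (nbhs (0 : K)) (nbhs_filter (0 : K))) => j; apply: cvgM0; last by case: (hk j).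
rewrite -h2; exact: (cvg_comp _ _ gc (hol_cvg (h1 j))).
Qed.

(* Apply Hadamard's lemma to [f (v + t e_i)] in the extra variable [t]. *)
Lemma hol_quotient (I : finType) (f : (I -> K) -> K) (i : I) (p : I -> K) :
  hol f p -> exists2 H : (option I -> K) -> K,
    hol H (oapp p 0) &
    \forall w \near nb (oapp p 0), f (step (w \o Some) i (w None)) =
      f (w \o Some) + w None * H w.
Proof.
move=> hf; pose F (w : option I -> K) := f (step (w \o Some) i (w None)).
have hF : hol F (oapp p 0).
  apply: (hol_comp (g := fun k w => step (w \o Some) i (w None) k) _ _ hf) => k.
    apply: (hol_add (f := fun w => w (Some k)) (g := fun w => if k == i then w None else 0)); first exact: hol_coord.
    by case: (k == i); [exact: hol_coord|exact: hol_cst].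
  by rewrite /step /=; case: ifP; rewrite addr0.
have [h h1 h2] := hol_hadamard (pred1 None) hF.
exists (h None) => //; apply: filterS h2 => w; rewrite /F => ->.
rewrite big_pred1_eq /= subr0; congr (f _ + _).
by apply/funext => k; rewrite /step /put /=; case: ifP; rewrite addr0.
Qed.

Lemma oapp_near (I : finType) (p : I -> K) (Q : set (option I -> K)) :
  nb (oapp p 0) Q -> \forall v \near nb p, Q (oapp v 0).
Proof.
move=> [e e0 he]; exists e => // v hv; apply: he; case=> [k|] //=.
by rewrite subrr nm0 ltW.
Qed.

(** The difference quotient is a germ in [(v, t)], and the derivative is its restriction to [t = 0];
    no series is differentiated termwise. *)
Lemma hol_pd (I : finType) (f : (I -> K) -> K) (i : I) (p : I -> K) :
  hol f p -> hol (pd i f) p.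
Proof.
move=> /(hol_quotient i) [H H1 H2].
apply: (hol_eq (f := fun v => H (oapp v 0))); last first.
  apply: (hol_comp (g := fun k v => oapp v 0 k) _ _ H1) => [[k|]|//] /=.
    exact: hol_coord.
  exact: hol_cst.
have h3 := nbI (nb_near H2) (hol_nb H1).
have h4 : \forall v \near nb p, (\forall w \near nb (oapp v 0),
    f (step (w \o Some) i (w None)) = f (w \o Some) + w None * H w) /\ hol H (oapp v 0).
  exact: oapp_near h3.
apply: filterS h4 => v [h1 h2].
apply/esym.
have hs : step (oapp v 0) None @ (0 : K) --> nb (oapp v 0) by exact: step_cvg.
apply: (is_pd (h := fun t => H (step (oapp v 0) None t))); last first.
  exact: (cvg_comp _ _ hs (hol_cvg h2)).
apply: filterS (near_cvg hs h1) => t.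
have -> : step (oapp v 0) None t \o Some = v.
  by apply/funext => k; rewrite /step /= addr0.
by have -> : step (oapp v 0) None t None = t by rewrite /step /= add0r.
Qed.

(** A point with two coordinates. Around the fold, [false] carries eta or its uniformiser [s], and
    [true] carries [x]. *)
Definition bp (s t : K) : bool -> K := fun b => if b then t else s.

Lemma step_bp_false s t a : step (bp s t) false a = bp (s + a) t.
Proof. by apply/funext; case; rewrite /step /= ?addr0. Qed.

Lemma step_bp_true s t a : step (bp s t) true a = bp s (t + a).
Proof. by apply/funext; case; rewrite /step /= ?addr0. Qed.

(** Dividing [f (p + s e_i + t e_j)] first by [s] and then by [t] leaves the germ [k true], whose
    value at the origin is the mixed derivative in either order. *)
Lemma pd_sym (I : finType) (f : (I -> K) -> K) (i j : I) (p : I -> K) :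
  hol f p -> pd i (pd j f) p = pd j (pd i f) p.
Proof.
move=> hf; pose F (w : bool -> K) := f (step (step p i (w false)) j (w true)).
have hF : hol F (bp 0 0).
  apply: (hol_comp (g := fun k w => step (step p i (w false)) j (w true) k) _ _ hf) => k.
    apply: (hol_add (f := fun w => step p i (w false) k)
                    (g := fun w => if k == j then w true else 0)).
      apply: (hol_add (f := fun w => p k) (g := fun w => if k == i then w false else 0)).
        exact: hol_cst.
      by case: (k == i); [exact: hol_coord|exact: hol_cst].
    by case: (k == j); [exact: hol_coord|exact: hol_cst].
  by rewrite !step0.
have [h h1 h2] := hol_hadamard (pred1 false) hF.
have [k k1 k2] := hol_hadamard (pred1 true) (h1 false).
have E : \forall w \near nb (bp 0 0), F w = F (bp 0 (w true)) + w false * h false w /\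
    h false w = h false (bp (w false) 0) + w true * k true w.
  apply: filterS (nbI h2 k2) => w [e1 e2].
  rewrite big_pred1_eq /= subr0 in e1; rewrite big_pred1_eq /= subr0 in e2.
  split; [rewrite {1}e1|rewrite {1}e2]; congr (_ + _).
  by congr (h false _); apply/funext; case.
have {h2 k2}E : \forall w \near nb (bp 0 0),
    [/\ F w = F (bp 0 (w true)) + w false * h false w,
        h false w = h false (bp (w false) 0) + w true * k true w,
        hol (h false) w & hol (k true) w].
  apply: filterS (nbI E (nbI (hol_nb (h1 false)) (hol_nb (k1 true)))).
  by move=> w [[? ?] []].
have FE s t : F (bp s t) = f (step (step p i s) j t) by [].
have FE' s t : F (bp s t) = f (step (step p j t) i s).
  by rewrite FE; congr f; apply/funext => l; rewrite /step addrAC.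
have cs := @step_cvg _ (bp 0 0) false; have ct := @step_cvg _ (bp 0 0) true.
have [l l1 l2] := pd_line j hf; have [m m1 m2] := pd_line i hf.
transitivity (k true (bp 0 0)).
  apply: (is_pd (h := fun s => k true (step (bp 0 0) false s))); last first.
    exact: (cvg_comp _ _ cs (hol_cvg (k1 true))).
  apply: filterS (near_cvg cs (nb_near E)) => s; rewrite step_bp_false add0r => Es.
  have [_ _ _ ks] := nb_self Es.
  have ct' := @step_cvg _ (bp s 0) true.
  apply: (is_pd (h := fun t => l t + s * k true (step (bp s 0) true t))); last first.
    apply: (cvgD0 l1); apply: cvgM0; first exact: cvg_cst0.
    exact: (cvg_comp _ _ ct' (hol_cvg ks)).
  have [Es0 _ _ _] := nb_self Es; move: Es0; rewrite !FE !step0 /= => Es0.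
  apply: filterS2 l2 (near_cvg ct' Es) => t lt; rewrite step_bp_true add0r /=.
  by move=> [e1 e2 _ _]; rewrite -FE e1 e2 FE step0 lt Es0; ring.
apply/esym; apply: (is_pd (h := fun t => k true (step (bp 0 0) true t))); last first.
  exact: (cvg_comp _ _ ct (hol_cvg (k1 true))).
have hi t : (\forall w \near nb (bp 0 t),
    F w = F (bp 0 (w true)) + w false * h false w) -> hol (h false) (bp 0 t) ->
    pd i f (step p j t) = h false (bp 0 t).
  move=> Et ht; have cs' := @step_cvg _ (bp 0 t) false.
  apply: (is_pd (h := fun s => h false (step (bp 0 t) false s))); last first.
    exact: (cvg_comp _ _ cs' (hol_cvg ht)).
  apply: filterS (near_cvg cs' Et) => s; rewrite step_bp_false add0r /= => e1.
  by rewrite -FE' e1 FE step0.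
have E0 := nb_self E; have [_ _ h0 _] := E0.
have ep : pd i f p = h false (bp 0 0).
  by rewrite -{1}(step0 p j) hi //; apply: filterS E => w [].
apply: filterS (near_cvg ct (nb_near E)) => t; rewrite step_bp_true add0r => Et.
have [_ e2 e3 _] := nb_self Et.
have Et1 : \forall w \near nb (bp 0 t), F w = F (bp 0 (w true)) + w false * h false w.
  by apply: filterS Et => w [].
rewrite ep (hi _ Et1 e3).
exact: e2.
Qed.

End PartialDerivatives.

(** * Implicit functions *)

Section ImplicitFunction.
Variable R : realType.
Local Notation K := (C R).

Definition cmb (I J : Type) (x : I -> K) (y : J -> K) : I + J -> K :=
  fun s => match s with inl i => x i | inr j => y j end.

Lemma cmbE (I J : Type) (v : I + J -> K) : cmb (fun i => v (inl i)) (fun j => v (inr j)) = v.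
Proof. by apply/funext; case. Qed.

Lemma cmb00 (I J : Type) :
  cmb (fun _ : I => 0) (fun _ : J => 0) = (fun=> 0) :> (I + J -> K).
Proof. by apply/funext; case. Qed.

Lemma hol_cmb (I J L : finType) (f : (I + J -> K) -> K) (x : I -> (L -> K) -> K)
    (y : J -> (L -> K) -> K) (p : L -> K) :
  (forall i, hol (x i) p) -> (forall j, hol (y j) p) ->
  hol f (cmb (x ^~ p) (y ^~ p)) -> hol (fun v => f (cmb (x ^~ v) (y ^~ v))) p.
Proof.
move=> hx hy hf.
apply: (hol_comp (g := fun s v => cmb (x ^~ v) (y ^~ v) s) _ _ hf) => //.
by case=> [i|j] /=; [exact: hx|exact: hy].
Qed.

Lemma sum_halves (e : R) N : \sum_(n < N) e / 4 / 2 ^+ n = e / 2 * (1 - 2^-1 ^+ N).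
Proof.
elim: N => [|N IH]; first by rewrite big_ord0 expr0 subrr mulr0.
rewrite big_ord_recr /= IH exprS -exprVn; by field.
Qed.

Lemma hol0_An (I : finType) (f : (I -> K) -> K) (B : R) :
  hol f (fun=> 0) -> nm (f (fun=> 0)) < B ->
  exists2 e : R, 0 < e & forall d, 0 < d -> d <= e -> An (fun=> d) f B.
Proof.
move=> h hB; have [e e0 he] := hol_small h hB; exists e => // d d0 de.
apply: (An_weak _ (he d d0 de)) => // [_|v _]; first exact: ltW.
by congr f; apply/funext => i; rewrite /tr add0r.
Qed.

(** Hadamard's lemma in the increment [w]. At the origin the coefficients are the derivatives
    assumed to vanish, so they have weighted norm at most [c] on a small polydisc. A difference
    formula with analytic coefficients is needed because the iteration is controlled in the weighted
    norm, not pointwise. *)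
Lemma contraction_lipschitz (I J : finType) (f : J -> (I + J -> K) -> K) (c : R) :
  (forall j, hol (f j) (fun=> 0)) ->
  (forall j l, pd (inr l) (f j) (fun=> 0) = 0) -> 0 < c ->
  exists (e : R) (psi : J -> J -> ((I + J) + J -> K) -> K),
  [/\ 0 < e, forall j k, An (fun=> e) (psi j k) c &
     forall x y w, (forall i, nm (x i) <= e) -> (forall j, nm (y j) <= e) ->
       (forall j, nm (w j) <= e) -> forall j,
       f j (cmb x (fun k => y k + w k)) =
       f j (cmb x y) + \sum_k w k * psi j k (cmb (cmb x y) w)].
Proof.
move=> hf df c0.
pose s (w : (I + J) + J -> K) : I + J -> K :=
  cmb (fun i => w (inl (inl i))) (fun j => w (inl (inr j)) + w (inr j)).
have hG j : hol (fun w => f j (s w)) (fun=> 0).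
  apply: (hol_comp (g := fun l w => s w l) _ _ (hf j)).
    case=> [i|k] /=; first exact: hol_coord.
    exact: (hol_add (hol_coord _ _) (hol_coord _ _)).
  by case=> [i|k] //=; rewrite addr0.
pose Jr := (fun l : (I + J) + J => if l is inr _ then true else false).
have /choice [h hh] : forall j, exists h : (I + J) + J -> ((I + J) + J -> K) -> K,
   (forall l, hol (h l) (fun=> 0)) /\
   \forall w \near nb (fun=> 0), f j (s w) = f j (s (put Jr (fun=> 0) w)) +
     \sum_k w (inr k) * h (inr k) w.
  move=> j; have [h h1 h2] := hol_hadamard Jr (hG j); exists h; split=> //.
  apply: filterS h2 => w ->; congr (_ + _).
  rewrite big_sumType /= big_pred0 // add0r.
  by apply: eq_bigr => k _; rewrite subr0.
have h0 j k : h j (inr k) (fun=> 0) = 0.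
  have [h1 h2] := hh j; rewrite -[RHS](df j k); apply/esym.
  have cs := @step_cvg R _ (fun=> 0) (inr k : (I + J) + J).
  apply: (is_pd (h := fun t => h j (inr k) (step (fun=> 0) (inr k) t))); last first.
    exact: (cvg_comp _ _ cs (hol_cvg (h1 (inr k)))).
  apply: filterS (near_cvg cs h2) => t.
  have -> : s (step (fun=> 0) (inr k) t) = step (fun=> 0) (inr k) t.
    by apply/funext; case=> l; rewrite /s /step /= ?addr0 ?add0r.
  have -> : s (put Jr (fun=> 0) (step (fun=> 0) (inr k) t)) = fun=> 0.
    by apply/funext; case=> l; rewrite /s /put /step /= ?addr0.
  move=> ->; congr (_ + _); rewrite (bigD1 k) //= {1}/step eqxx add0r.
  rewrite big1 ?addr0 // => l lk; rewrite /step add0r.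
  by rewrite (_ : (inr l == inr k :> (I + J) + J) = (l == k)) // (negPf lk) mul0r.
have [e1 e10 he1] : exists2 e, 0 < e & forall j e', 0 < e' -> e' <= e -> forall k,
    An (fun=> e') (h j (inr k)) c.
  apply: fin_common_radius => j.
  have [e e0 he] : exists2 e, 0 < e & forall k e', 0 < e' -> e' <= e ->
      An (fun=> e') (h j (inr k)) c.
    apply: fin_common_radius => k; apply: hol0_An; first by case: (hh j).
    by rewrite h0 nm0.
  by exists e => // e' e'0 e'e k; exact: he.
have [e2 e20 he2] : exists2 e, 0 < e & forall j e', 0 < e' -> e' <= e ->
    forall w, (forall l, nm (w l) <= e') ->
    f j (s w) = f j (s (put Jr (fun=> 0) w)) + \sum_k w (inr k) * h j (inr k) w.
  apply: fin_common_radius => j; have [_ [e e0 he]] := hh j.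
  exists e => // e' _ e'e w hw; apply: he => l; rewrite subr0.
  exact: le_trans (hw l) e'e.
have m0 : 0 < Num.min e1 e2 by rewrite lt_min e10.
exists (Num.min e1 e2), (fun j k => h j (inr k)); split => // [j k|x y w hx hy hw j].
  by apply: he1; rewrite ?ge_min ?lexx.
have := he2 j (Num.min e1 e2) m0 _ (cmb (cmb x y) w).
have -> : s (put Jr (fun=> 0) (cmb (cmb x y) w)) = cmb x y.
  by apply/funext; case=> l; rewrite /s /put /= ?addr0.
apply; first by rewrite ge_min lexx orbT.
by case=> [[]|] l /=.
Qed.

Lemma fixed_point0 (I J : finType) (f : J -> (I + J -> K) -> K) :
  (forall j, hol (f j) (fun=> 0)) -> (forall j, f j (fun=> 0) = 0) ->
  (forall j l, pd (inr l) (f j) (fun=> 0) = 0) ->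
  exists y : J -> (I -> K) -> K,
  [/\ forall j, hol (y j) (fun=> 0), forall j, y j (fun=> 0) = 0,
      \forall x \near nb (fun=> 0), forall j, f j (cmb x (y ^~ x)) = y j x &
      \forall v \near nb (fun=> 0), (forall j, f j v = v (inr j)) ->
        forall j, v (inr j) = y j (fun i => v (inl i))].
Proof.
move=> hf f0 df.
(* With this constant the sum over [J] is at most 1/2; the [+ 1] covers an empty [J]. *)
pose c : R := 2^-1 / (#|J|%:R + 1).
have cJ : \sum_(j : J) c <= 2^-1.
  rewrite sumr_const -[c *+ _]mulr_natr (_ : #|xpredT : pred J| = #|J|); last exact: eq_card.
  rewrite /c -mulrA ger_pMr ?invr_gt0 ?ltr0n //.
  by rewrite mulrC ler_pdivrMr ?mul1r ?lerDl // ltr_wpDl.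
have c0 : 0 < c by rewrite divr_gt0 ?invr_gt0 ?ltr0n // ltr_wpDl.
have [e [psi [e0 hpsi hL]]] := contraction_lipschitz hf df c0.
have e40 : 0 < e / 4 by rewrite divr_gt0.
have [d1 d10 hd1] : exists2 d, 0 < d & forall j d', 0 < d' -> d' <= d ->
    An (fun=> d') (fun x : I -> K => f j (cmb x (fun=> 0))) (e / 4).
  apply: fin_common_radius => j; apply: hol0_An.
    apply: (hol_cmb (x := fun i v => v i) (y := fun _ _ => 0)) => [i|_|].
    - exact: hol_coord.
    - exact: hol_cst.
    - by rewrite cmb00.
  by rewrite cmb00 f0 nm0.
pose d := Num.min e d1.
have d0 : 0 < d by rewrite lt_min e0.
have de : d <= e by rewrite ge_min lexx.
have d0' (i : I) : 0 <= d by exact: ltW.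
pose y := fix y n : J -> (I -> K) -> K :=
  if n is n'.+1 then fun j x => f j (cmb x (y n' ^~ x)) else fun _ _ => 0.
pose D n j (x : I -> K) := y n.+1 j x - y n j x.
(* The first increment is at most [e / 4] and each further one is halved. Iterates and increments
   thus stay within the radius [e] of the difference formula. *)
have hyD n : (forall j, An (fun=> d) (y n j) (e / 2 * (1 - 2^-1 ^+ n))) /\
    (forall j, An (fun=> d) (D n j) (e / 4 / 2 ^+ n)).
  elim: n => [|n [IH1 IH2]].
    split=> j; first by apply: An_cst; rewrite nm0 expr0 subrr mulr0.
    rewrite expr0 divr1; apply: (An_weak _ (hd1 j d d0 _)) => //.
      by rewrite ge_min lexx orbT.
    by move=> v _; rewrite /D /= subr0.
  have h2 : 1 - 2^-1 ^+ n <= 1 :> R by rewrite gerBl exprn_ge0.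
  have h3 : e / 2 * (1 - 2^-1 ^+ n) <= e.
    apply: le_trans (ler_wpM2l _ h2) _; first by rewrite divr_ge0 // ltW.
    by rewrite mulr1 ler_pdivrMr // ler_pMr // ler1n.
  have h4 : e / 4 / 2 ^+ n <= e.
    rewrite -mulrA ger_pMr // -invfM invf_le1 ?mulr_gt0 ?exprn_gt0 //.
    by rewrite mulr_ege1 ?exprn_ege1 // ler1n.
  split=> j.
    apply: (An_weak _ (An_add (IH1 j) (IH2 j))) => //.
      by rewrite -!sum_halves big_ord_recr.
    by move=> x _; rewrite /D addrC subrK.
  have hA : An (fun=> d) (fun x => \sum_k D n k x *
      psi j k (cmb (cmb x (y n ^~ x)) (D n ^~ x))) (\sum_(k : J) e / 4 / 2 ^+ n * c).
    apply: (@An_sum _ _ _ _ (fun k x => D n k x *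
      psi j k (cmb (cmb x (y n ^~ x)) (D n ^~ x)))) => k _; apply: An_mul => //.
    apply: (An_comp (g := fun s x => cmb (cmb x (y n ^~ x)) (D n ^~ x) s) _ _ (hpsi j k)) => //.
    case=> [[i|l]|l] /=.
    - exact: An_coord.
    - exact: An_le (IH1 l) h3.
    - exact: An_le (IH2 l) h4.
  apply: (An_weak _ hA) => //.
    rewrite -mulr_sumr exprSr invfM mulrA ler_wpM2l // divr_ge0 ?exprn_ge0 //; exact: ltW.
  move=> x dx; have b1 k := An_nm d0' (IH1 k) dx; have b2 k := An_nm d0' (IH2 k) dx.
  have := hL x (y n ^~ x) (D n ^~ x) (fun i => le_trans (dx i) de)
    (fun k => le_trans (b1 k) h3) (fun k => le_trans (b2 k) h4) j.
  have -> : (fun k => y n k x + D n k x) = y n.+1 ^~ x.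
    by apply/funext => k; rewrite /D addrC subrK.
  move=> hn; rewrite [RHS](_ : _ = f j (cmb x (y n.+1 ^~ x)) - f j (cmb x (y n ^~ x))) //.
  by rewrite hn [RHS]addrC addKr.
have yD j x n : y n j x = series (fun n => D n j x) n.
  rewrite /series /= telescope_sumr // subr0 //.
have eN N : \sum_(n < N) e / 4 / 2 ^+ n <= e / 2.
  by rewrite sum_halves ger_pMr ?divr_gt0 // gerBl exprn_ge0.
have yc j x : disc (fun=> d) x -> (fun n => y n j x) @ \oo --> limn (series (fun n => D n j x)).
  move=> dx; rewrite (_ : (fun n => y n j x) = series (fun n => D n j x)); last first.
    by apply/funext => n; rewrite yD.
  apply: (@absolute_cvg _ _ (e / 2)) => N; apply: le_trans (eN N).
  by apply: ler_sum => n _; case: (hyD n) => _ /(_ j) A; exact: An_nm A dx.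
pose Y j x : K := limn (series (fun n => D n j x)).
have hY j : An (fun=> d) (Y j) (e / 2).
  apply: (@An_series _ _ _ (fun n => D n j) (fun n => e / 4 / 2 ^+ n)).
  - by move=> n; case: (hyD n).
  - exact: eN.
  - move=> x dx; have := yc j x dx.
    by rewrite (_ : (fun n => y n j x) = series (fun n => D n j x)) //;
       apply/funext => n; rewrite yD.
have e2e : e / 2 <= e by rewrite ler_pdivrMr // ler_pMr // ler1n.
(* Both arguments lie within [e / 2], so their difference, used as increment, lies within [e]. *)
have hdiff x u v : disc (fun=> d) x -> (forall j, nm (u j) <= e / 2) ->
    (forall j, nm (v j) <= e / 2) -> forall j,
    nm (f j (cmb x v) - f j (cmb x u)) <= \sum_k nm (v k - u k) * c.
  move=> dx hu hv j.
  have hvu k : nm (v k - u k) <= e.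
    by apply: le_trans (nmB _ _) _; rewrite [e]splitr lerD.
  have hu' k : nm (u k) <= e by exact: le_trans (hu k) e2e.
  have := hL x u (fun k => v k - u k) (fun i => le_trans (dx i) de) hu' hvu j.
  rewrite (_ : (fun k => u k + (v k - u k)) = v); last first.
    by apply/funext => k; rewrite addrC subrK.
  move=> ->; rewrite [f j _ + _]addrC addrK; apply: le_trans (nm_sum _ _ _) _.
  apply: ler_sum => k _; rewrite nmM ler_wpM2l ?nm_ge0 //.
  apply: (An_nm (r := fun=> e) _ (hpsi j k)); first by move=> _; exact: ltW.
  by case=> [[i|l]|l] /=; [exact: le_trans (dx i) de|exact: hu'|exact: hvu].
have yb n j x : disc (fun=> d) x -> nm (y n j x) <= e / 2.
  move=> dx; apply: le_trans (An_nm d0' ((hyD n).1 j) dx) _.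
  by rewrite ger_pMr ?divr_gt0 // gerBl exprn_ge0.
have Yb j x : disc (fun=> d) x -> nm (Y j x) <= e / 2.
  by move=> dx; exact: An_nm d0' (hY j) dx.
have Yfix j x : disc (fun=> d) x -> f j (cmb x (Y ^~ x)) = Y j x.
  move=> dx.
  have h1 : (fun n => y n.+1 j x) @ \oo --> Y j x.
    by have := yc j x dx; rewrite -(cvg_shiftS (fun n => y n j x)).
  apply: Cvg_unique _ h1; apply/cvg_nmP => eps eps0.
  have : \forall n \near \oo, forall k, nm (Y k x - y n k x) <= eps.
    by apply: filter_forall => k; have /cvg_nmP /(_ _ eps0) := yc k x dx.
  apply: filterS => n hn.
  apply: le_trans (hdiff x (y n ^~ x) (Y ^~ x) dx (fun k => yb n k x dx) (fun k => Yb k x dx) j) _.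
  apply: le_trans (_ : \sum_(k : J) eps * c <= _).
    by apply: ler_sum => k _; rewrite ler_wpM2r ?hn // ltW.
  rewrite -mulr_sumr ger_pMr //; apply: le_trans cJ _.
  by rewrite invf_le1 // ler1n.
exists Y; split.
- move=> j; apply: (holI d0 (hY j)) => v _; congr (Y j).
  by apply/funext => i; rewrite /tr add0r.
- move=> j; apply: Cvg_unique (yc j _ _) _ => [i|]; first by rewrite nm0 ltW.
  rewrite (_ : (fun n => y n j (fun=> 0)) = fun=> 0); first exact: cvg_cst.
  apply/funext => n; elim: n j => [//|n IH] j /=.
  rewrite -[RHS](f0 j); congr (f j); apply/funext; case=> //= k; exact: IH.
- by exists d => // x hx j; apply: Yfix => i; have := hx i; rewrite subr0.
- exists (Num.min d (e / 2)); first by rewrite lt_min d0 divr_gt0.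
  move=> v hv fv.
  have hv' l : nm (v l) <= Num.min d (e / 2) by have := hv l; rewrite subr0.
  set x := fun i => v (inl i); set u := fun j => v (inr j).
  have dx : disc (fun=> d) x.
    by move=> i; apply: le_trans (hv' _) _; rewrite ge_min lexx.
  have hu j : nm (u j) <= e / 2.
    by apply: le_trans (hv' _) _; rewrite ge_min lexx orbT.
  suff S0 : \sum_k nm (u k - Y k x) = 0.
    move=> j; apply/eqP; rewrite -subr_eq0; apply/eqP; apply: nm_eq0.
    have := psumr_eq0P (fun k _ => nm_ge0 (u k - Y k x)) S0; exact.
  (* Summed over [j], the contraction estimate bounds the total distance of the two solutions by
     half of itself, so it is zero. *)
  have hS : \sum_k nm (u k - Y k x) <= 2^-1 * \sum_k nm (u k - Y k x).
    apply: le_trans (_ : \sum_(j : J) c * \sum_k nm (u k - Y k x) <= _).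
      apply: ler_sum => j _; rewrite -{1}(Yfix j x dx) {1}/u -fv -{1}(cmbE v) -/x -/u.
      apply: le_trans (hdiff x (Y ^~ x) u dx (fun k => Yb k x dx) hu j) _.
      by rewrite -mulr_suml mulrC.
    by rewrite -mulr_suml ler_wpM2r // sumr_ge0 // => k _; exact: nm_ge0.
  have S0 : 0 <= \sum_k nm (u k - Y k x) by apply: sumr_ge0 => k _; exact: nm_ge0.
  by move: hS S0; set S := \sum_k _; clear; lra.
Qed.

Lemma nb_sub (I : finType) (p : I -> K) (Q : set (I -> K)) :
  nb (fun=> 0) Q -> nb p (fun v => Q (fun i => v i - p i)).
Proof.
by move=> [e e0 he]; exists e => // v hv; apply: he => i; rewrite subr0.
Qed.

Lemma hol_tr (I : finType) (f : (I -> K) -> K) (p : I -> K) :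
  hol f p -> hol (fun v => f (tr p v)) (fun=> 0).
Proof.
move=> [e [b [e0 h]]]; apply: (holI e0 h) => v _; congr f.
by apply/funext => i; rewrite /tr add0r.
Qed.

Lemma hol_untr (I : finType) (f : (I -> K) -> K) (p : I -> K) :
  hol f (fun=> 0) -> hol (fun v => f (fun i => v i - p i)) p.
Proof.
move=> [e [b [e0 h]]]; apply: (holI e0 h) => v _; congr f.
by apply/funext => i; rewrite /tr addrC addKr add0r.
Qed.

Lemma pd_tr (I : finType) (f : (I -> K) -> K) (i : I) (p : I -> K) :
  pd i (fun v => f (tr p v)) (fun=> 0) = pd i f p.
Proof.
rewrite /pd tr0 (_ : (fun t => _) = (fun t => t^-1 * (f (step p i t) - f p))) //.
apply/funext => t; congr (_ * (f _ - _)).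
by apply/funext => k; rewrite /tr /step add0r.
Qed.

(** The simplified Newton map [y - A g] has zero derivatives in [y] at the base point, because [A]
    is a left inverse of the Jacobian. Its fixed points are the zeros of [A g], hence those of [g]
    by injectivity of [A]. *)
Theorem implicit_function (I J : finType) (g : J -> (I + J -> K) -> K)
    (p : I -> K) (q : J -> K) (A : J -> J -> K) :
  (forall j, hol (g j) (cmb p q)) -> (forall j, g j (cmb p q) = 0) ->
  (forall j l, \sum_k A j k * pd (inr l) (g k) (cmb p q) = (j == l)%:R) ->
  (forall c : J -> K, (forall j, \sum_k A j k * c k = 0) -> forall k, c k = 0) ->
  exists y : J -> (I -> K) -> K,
  [/\ forall j, hol (y j) p, forall j, y j p = q j,
      \forall x \near nb p, forall j, g j (cmb x (y ^~ x)) = 0 &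
      \forall v \near nb (cmb p q), (forall j, g j v = 0) ->
        forall j, v (inr j) = y j (fun i => v (inl i))].
Proof.
move=> hg g0 gA Ainj; set c := cmb p q.
pose f j (v : I + J -> K) := v (inr j) - \sum_k A j k * g k (tr c v).
have hgt k : hol (fun v => g k (tr c v)) (fun=> 0) by apply: hol_tr.
have hAg j k : hol (fun v => A j k * g k (tr c v)) (fun=> 0).
  exact: (hol_mul (hol_cst _ _) (hgt k)).
have hS j : hol (fun v => \sum_k A j k * g k (tr c v)) (fun=> 0).
  exact: (@hol_sum _ _ _ (fun k v => A j k * g k (tr c v))).
have pdS j (i : I + J) : pd i (fun v => \sum_k A j k * g k (tr c v)) (fun=> 0) =
    \sum_k A j k * pd i (g k) c.
  rewrite (pd_comp (f := fun w : J -> K => \sum_k A j k * w k)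
     (g := fun k v => g k (tr c v)) i hgt (q := fun=> 0)); first last.
  - apply: (@hol_sum _ _ _ (fun k w => A j k * w k)) => k.
    exact: (hol_mul (hol_cst _ _) (hol_coord _ _)).
  - by move=> k; rewrite tr0.
  apply: eq_bigr => k _; rewrite pd_tr; congr (_ * _).
  apply: (is_pd (h := fun=> A j k)); last exact: cvg_cst0.
  apply: near0W => t; rewrite [X in _ = X + _]big1 ?add0r; last first.
    by move=> l _; rewrite mulr0.
  rewrite (bigD1 k) //= /step eqxx add0r big1 ?addr0 ?[t * _]mulrC //.
  by move=> l /negPf ->; rewrite addr0 mulr0.
have [||| y [y1 y2 y3 y4]] := @fixed_point0 I J f.
- by move=> j; apply: hol_sub (hS j); exact: hol_coord.
- by move=> j; rewrite /f tr0 big1 ?subr0 // => k _; rewrite g0 mulr0.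
- move=> j l; rewrite pd_sub //; last exact: hol_coord.
  by rewrite pd_coord pdS gA subrr.
have fE j v : f j v = v (inr j) -> \sum_k A j k * g k (tr c v) = 0.
  by move=> h; rewrite -[RHS](subrr (v (inr j))) -{2}h /f opprB addrC subrK.
exists (fun j x => q j + y j (fun i => x i - p i)); split.
- by move=> j; apply: hol_add (hol_untr _ (y1 j)); exact: hol_cst.
- move=> j; have -> : (fun i => p i - p i) = fun=> 0 by apply/funext => i; rewrite subrr.
  by rewrite y2 addr0.
- apply: filterS (nb_sub p y3) => x hx; apply: Ainj => j.
  have := fE j _ (hx j); rewrite (_ : tr c _ = cmb x
    (fun j => q j + y j (fun i => x i - p i))) //.
  by apply/funext; case=> l; rewrite /tr /c /= // addrC subrK.
- apply: filterS (nb_sub c y4) => v hv gv j.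
  have := hv _ j; rewrite (_ : (fun i => v (inl i) - c (inl i)) = fun i => v (inl i) - p i) //.
  move=> <-; first by rewrite /c /= addrC subrK.
  move=> k; rewrite /f trB big1 ?subr0 // => l _; by rewrite gv mulr0.
Qed.

Lemma implicit_scalar (I : finType) (g : (I + unit -> K) -> K) (p : I -> K) (q : K) :
  hol g (cmb p (fun=> q)) -> g (cmb p (fun=> q)) = 0 ->
  pd (inr tt) g (cmb p (fun=> q)) != 0 ->
  exists y : (I -> K) -> K,
  [/\ hol y p, y p = q, \forall x \near nb p, g (cmb x (fun=> y x)) = 0 &
      \forall v \near nb (cmb p (fun=> q)), g v = 0 -> v (inr tt) = y (fun i => v (inl i))].
Proof.
move=> hg g0 d0.
have sumU (f : unit -> K) : \sum_(k : unit) f k = f tt.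
  by rewrite (bigD1 tt) //= big1 ?addr0 // => -[].
have [||y [y1 y2 y3 y4]] := @implicit_function _ _ (fun _ => g) p (fun=> q)
    (fun _ _ => (pd (inr tt) g (cmb p (fun=> q)))^-1) (fun=> hg) (fun=> g0).
- by move=> [] []; rewrite sumU mulVf.
- move=> e /(_ tt); rewrite sumU.
  by move=> /eqP; rewrite mulf_eq0 invr_eq0 (negPf d0) => /eqP e0 [].
exists (y tt); split => //.
- apply: filterS y3 => x /(_ tt).
  by rewrite (_ : y ^~ x = fun=> y tt x) //; apply/funext; case.
- by apply: filterS y4 => v hv gv; apply: hv.
Qed.

End ImplicitFunction.

(** * Power series in one variable *)

Section PowerSeries.
Variable R : realType.
Local Notation K := (C R).

Lemma zap_zap (I : finType) (J : pred I) (v : I -> K) : zap J (zap J v) = zap J v.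
Proof. by apply/funext => i; rewrite /zap; case: (J i). Qed.

Lemma zap1_step (I : finType) (i : I) (v : I -> K) t :
  zap (pred1 i) (step (zap (pred1 i) v) i t) = zap (pred1 i) v.
Proof. by apply/funext => j; rewrite /zap /step /=; case: (j == i); rewrite ?addr0. Qed.

Lemma geometric_cvg0 (q B : R) : 0 <= q -> q < 1 -> (fun n => q ^+ n * B) @ \oo --> 0.
Proof.
move=> q0 q1; rewrite -[X in _ --> X](mul0r B); apply: cvgMl.
by apply: cvg_expr; rewrite ger0_norm.
Qed.

(** Hadamard's lemma is iterated in the variable [i]. The remainder after [n] divisions has weight
    at most [b / r i ^+ n], which gives both the coefficient bound and convergence inside the
    radius. *)
Lemma power_series (I : finType) (i : I) (r : I -> R) f b :
  (forall i, 0 < r i) -> An r f b ->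
  exists a : nat -> (I -> K) -> K,
  [/\ forall n, exists B, An r (a n) B,
      forall n v, a n (zap (pred1 i) v) = a n v,
      forall n v, disc r v -> nm (a n v) * r i ^+ n <= b,
      forall v, disc r v -> nm (v i) < r i ->
        series (fun n => a n v * v i ^+ n) @ \oo --> f v &
      forall v, disc r v -> pd i f (zap (pred1 i) v) = a 1%N v].
Proof.
move=> rp Af; have r0 j : 0 <= r j by exact: ltW.
(* The recursion has to carry the weighted bound along, since each division consumes one and
   produces the next. *)
pose T := {p : ((I -> K) -> K) * R | An r p.1 p.2}.
have nxt (p : T) : {q : T * R | [/\ An r (fun v => (sval p).1 (zap (pred1 i) v)) q.2,
    q.2 + r i * (sval q.1).2 <= (sval p).2 &
    forall v, disc r v -> (sval p).1 v =
      (sval p).1 (zap (pred1 i) v) + v i * (sval q.1).1 v]}.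
  apply: cid; case: p => -[g bg] Ag /=.
  have [B0 [h [B [h1 h2 h3 h4 h5]]]] := hadamard (pred1 i) rp Ag.
  exists (exist (fun p => An r p.1 p.2) (h i, B i) (h2 i), B0); split=> //=.
    apply: le_trans h3; rewrite lerD2l (bigD1 i) //= lerDl sumr_ge0 // => j _.
    by rewrite mulr_ge0 // (An_ge0 r0 (h2 j)).
  move=> v dv; rewrite [LHS](h4 v dv); congr (_ + _).
  by rewrite (bigD1 i) //= big1 ?addr0 // => j ji; rewrite h5 ?mulr0 //=.
have nxtP p : [/\ An r (fun v => (sval p).1 (zap (pred1 i) v)) (sval (nxt p)).2,
    (sval (nxt p)).2 + r i * (sval (sval (nxt p)).1).2 <= (sval p).2 &
    forall v, disc r v -> (sval p).1 v =
      (sval p).1 (zap (pred1 i) v) + v i * (sval (sval (nxt p)).1).1 v].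
  by case: (nxt p).
pose F := fix F n : T := if n is n'.+1 then (sval (nxt (F n'))).1
   else exist (fun p => An r p.1 p.2) (f, b) Af.
pose fn n := (sval (F n)).1; pose bn n := (sval (F n)).2.
pose A n := (sval (nxt (F n))).2.
have fA n : An r (fn n) (bn n) by rewrite /fn /bn; case: (F n).
have aA n : An r (fun v => fn n (zap (pred1 i) v)) (A n).
  by case: (nxtP (F n)).
have Ab n : A n + r i * bn n.+1 <= bn n.
  by case: (nxtP (F n)).
have fE n v : disc r v -> fn n v = fn n (zap (pred1 i) v) + v i * fn n.+1 v.
  by case: (nxtP (F n)) => _ _; apply.
have A0 n : 0 <= A n by exact: An_ge0 r0 (aA n).
have bb n : bn n * r i ^+ n <= b.
  elim: n => [|n IH]; first by rewrite expr0 mulr1.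
  apply: le_trans IH; rewrite exprS mulrA; apply: ler_wpM2r; first by rewrite exprn_ge0.
  by apply: le_trans (Ab n); rewrite mulrC lerDr.
have aE n v : nm (fn n (zap (pred1 i) v)) <= bn n \/ ~ disc r v.
  have [dv|] := pselect (disc r v); last by right.
  by left; apply: An_nm (fA n) _; [|exact: disc_zap].
exists (fun n v => fn n (zap (pred1 i) v)); split.
- by move=> n; exists (A n).
- by move=> n v; rewrite zap_zap.
- move=> n v dv; apply: le_trans (bb n); apply: ler_wpM2r; first by rewrite exprn_ge0.
  by case: (aE n v).
- move=> v dv vi.
  (* The finite Taylor formula; its remainder is at most [b] times the [N]-th power of
     [nm (v i) / r i]. *)
  have SE N : f v = series (fun n => fn n (zap (pred1 i) v) * v i ^+ n) N + v i ^+ N * fn N v.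
    rewrite /series /=; elim: N => [|N IH]; first by rewrite big_nil add0r expr0 mul1r.
    by rewrite big_nat_recr //= {1}IH (fE N) // exprS; ring.
  pose q := nm (v i) / r i.
  have q0 : 0 <= q by rewrite divr_ge0 ?nm_ge0.
  have q1 : q < 1 by rewrite ltr_pdivrMr // mul1r.
  apply/cvg_nmP => e e0.
  have /cvgrPdist_le /(_ _ e0) := geometric_cvg0 b q0 q1.
  apply: filterS => N; rewrite sub0r normrN ger0_norm; last first.
    by rewrite mulr_ge0 ?exprn_ge0 // (An_ge0 r0 Af).
  apply: le_trans; rewrite {1}(SE N) [series _ _ + _]addrC addrK nmM nmX.
  rewrite /q expr_div_n -mulrA ler_wpM2l ?exprn_ge0 ?nm_ge0 //.
  rewrite mulrC ler_pdivlMr ?exprn_gt0 //; apply: le_trans (bb N).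
  by apply: ler_wpM2r; [rewrite exprn_ge0|exact: An_nm (fA N) dv].
- move=> v dv; set w := zap (pred1 i) v; have dw : disc r w by exact: disc_zap.
  have wi : w i = 0 by rewrite /w /zap /= eqxx.
  have ds : \forall t \near (0 : K), disc r (step w i t).
    apply: filterS (near0_nm (rp i)) => t ht j; rewrite /step.
    by case: eqP => [->|_]; rewrite ?wi ?add0r ?addr0.
  have zs t : zap (pred1 i) (step w i t) = w by rewrite zap1_step.
  apply: (is_pd (h := fun t => fn 1%N (step w i t))).
    apply: filterS ds => t dt.
    by rewrite [LHS](fE 0%N _ dt) zs {1}/step eqxx wi add0r.
  apply/(@cvg_nmP _ _ _ (nbhs_filter (0 : K))) => e e0.
  have b0 : 0 <= bn 2%N by exact: An_ge0 r0 (fA 2%N).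
  have e1 : 0 < e / (bn 2%N + 1) by rewrite divr_gt0 // ltr_wpDl.
  apply: filterS2 ds (near0_nm e1) => t dt ht.
  rewrite [fn 1%N (step _ _ _)](fE 1%N _ dt) zs opprD addNKr nmN nmM.
  rewrite {1}/step eqxx wi add0r.
  apply: le_trans (_ : e / (bn 2%N + 1) * bn 2%N <= _).
    by apply: ler_pM; rewrite ?nm_ge0 // (An_nm r0 (fA 2%N) dt).
  rewrite -mulrA ger_pMr // mulrC ler_pdivrMr ?ltr_wpDl //.
  by rewrite mul1r lerDl.
Qed.

(** Terms bounded at radius [e] have a geometric majorant at radius [e / 2], whose sum is at most
    [B * 2]. *)
Lemma series_hol (c : nat -> K) (e B : R) : 0 < e ->
  (forall n, nm (c n) * e ^+ n <= B) ->
  exists2 g : (unit -> K) -> K, hol g (fun=> 0) & g (fun=> 0) = c 0%N /\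
    \forall v \near nb (fun=> 0), series (fun n => c n * v tt ^+ n) @ \oo --> g v.
Proof.
move=> e0 hB; have e2 : 0 < e / 2 by rewrite divr_gt0.
have B0 : 0 <= B by apply: le_trans (hB 0%N); rewrite expr0 mulr1 nm_ge0.
have hS N : \sum_(n < N) nm (c n) * (e / 2) ^+ n <= B * 2.
  apply: le_trans (_ : \sum_(n < N) B / 2 ^+ n <= _).
    apply: ler_sum => n _; rewrite expr_div_n mulrA ler_wpM2r ?hB //.
  have -> : \sum_(n < N) B / 2 ^+ n = \sum_(n < N) (B * 4) / 4 / 2 ^+ n.
    by apply: eq_bigr => n _; rewrite mulfK // pnatr_eq0.
  rewrite sum_halves; have -> : B * 4 / 2 = B * 2 by field.
  by rewrite ler_piMr ?mulr_ge0 // gerBl exprn_ge0.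
pose g (v : unit -> K) : K := limn (series (fun n => c n * v tt ^+ n)).
have dc (v : unit -> K) : disc (fun=> e / 2) v ->
    series (fun n => c n * v tt ^+ n) @ \oo --> g v.
  move=> dv; apply: (@absolute_cvg _ _ (B * 2)) => N; apply: le_trans (hS N).
  apply: ler_sum => n _; rewrite nmM nmX ler_wpM2l ?nm_ge0 //.
  by apply: lerXn2r; rewrite ?nnegrE ?nm_ge0 // ltW.
have Ag : An (fun=> e / 2) g (B * 2).
  apply: (@An_series _ _ _ (fun n v => c n * v tt ^+ n) (fun n => nm (c n) * (e / 2) ^+ n)) => //.
  by move=> n; apply: An_mul; [exact: An_cst|apply: An_exp; exact: An_coord].
exists g.
  apply: (holI e2 Ag) => v _; congr g; by apply/funext => i; rewrite /tr add0r.
split; last by exists (e / 2) => // v hv; apply: dc => i; have := hv i; rewrite subr0.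
have := dc (fun=> 0); move=> h; apply: Cvg_unique (h _) _.
  by move=> i; rewrite nm0 ltW.
rewrite -(cvg_shiftn 1%N) (_ : (fun _ => _) = fun=> c 0%N); first exact: cvg_cst.
apply/funext => n; rewrite /series /= addn1 big_nat_recl //= expr0 mulr1.
by rewrite big1 ?addr0 // => k _; rewrite exprS mul0r mulr0.
Qed.

(** After division by [s ^+ m], with [m] the first index of a nonzero coefficient, the sum is
    continuous and nonzero at 0. *)
Lemma power_series_isolated (c : nat -> K) (e B : R) : 0 < e ->
  (forall n, nm (c n) * e ^+ n <= B) ->
  (forall n, c n = 0) \/
  \forall s \near (0 : K), s != 0 -> forall l : K,
    series (fun n => c n * s ^+ n) @ \oo --> l -> l != 0.
Proof.
move=> e0 hB; have [h|] := pselect (forall n, c n = 0); first by left.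
move=> /existsNP [n0 hn0]; right.
have ex : exists n, c n != 0 by exists n0; apply/eqP.
case: (ex_minnP ex) => m cm mmin.
have [|g hg [g0 gs]] := @series_hol (fun k => c (m + k)%N) e (B / e ^+ m) e0.
  by move=> n; rewrite ler_pdivlMr ?exprn_gt0 // -mulrA -exprD addnC.
have gm : g (fun=> 0) != 0 by rewrite g0 addn0.
have cs : (fun s : K => fun _ : unit => s) @ (0 : K) --> nb (fun _ : unit => (0 : K)).
  apply: (@nb_cvgP _ _ _ (nbhs_filter (0 : K)) _ _ (fun _ s => s)) => _.
  exact: cvg_id.
apply: filterS (near_cvg cs (nbI (hol_neq0 hg gm) gs)) => s [gs0 hs] s0 l hl.
have -> : l = s ^+ m * g (fun=> s); last by rewrite mulf_neq0 // expf_neq0.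
have := @series_split _ _ _ m hl; rewrite big1 ?subr0 => [hl'|k _]; last first.
  by have [->|/mmin] := eqVneq (c k) 0; [rewrite mul0r|rewrite leqNgt ltn_ord].
apply: Cvg_unique hl' _.
rewrite (_ : series _ = (fun N => s ^+ m * series (fun n => c (m + n)%N * s ^+ n) N)).
  by apply: cvgMr; exact: hs.
apply/funext => N; rewrite /series /= mulr_sumr; apply: eq_bigr => n _.
by rewrite exprD; ring.
Qed.
End PowerSeries.

(** * Analytic functions of row vectors *)

Section RowVectors.
Variable R : realType.
Local Notation K := (C R).

Definition rowf n (f : 'rV[K]_n -> K) (v : 'I_n -> K) : K := f (\row_i v i).
Definition coords n (p : 'rV[K]_n) : 'I_n -> K := fun i => p 0 i.

Lemma coordsK n (p : 'rV[K]_n) : \row_i coords p i = p.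
Proof. by apply/rowP => i; rewrite mxE. Qed.

Lemma mx_norm_ltP n (u : 'rV[K]_n) (e : R) : 0 < e ->
  (`|u| < rc e) <-> (forall i, nm (u 0 i) < e).
Proof.
move=> e0.
have h : ball (0 : 'rV[K]_n) (rc e) u <-> `|u| < rc e.
  by rewrite -ball_normE /= sub0r normrN.
rewrite -h; split=> [[_ hu] i|hu].
  by have := hu 0 i; rewrite mxE -ball_normE /= sub0r normrN lt_rc_nm.
split; first by rewrite -rc0 rc_lt.
by move=> i j; rewrite mxE -ball_normE /= sub0r normrN lt_rc_nm ord1.
Qed.

Lemma nbhs_nb n (p : 'rV[K]_n) (Q : set 'rV[K]_n) :
  nbhs p Q <-> nb (coords p) (fun v => Q (\row_i v i)).
Proof.
split.
  move=> /nbhs_ballP [e0 /= /rc_gt0P [e epos ->] he].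
  exists (e / 2); first by rewrite divr_gt0.
  move=> v hv; apply: he; rewrite -ball_normE /= mx_norm_ltP // => i.
  rewrite !mxE nmBC; apply: le_lt_trans (hv i) _.
  by rewrite ltr_pdivrMr // ltr_pMr // ltr1n.
move=> [e e0 he]; apply/nbhs_ballP; exists (rc e); first by rewrite /= -rc0 rc_lt.
move=> w; rewrite -ball_normE /= mx_norm_ltP // => hw.
rewrite -(coordsK w); apply: he => i; rewrite /coords nmBC ltW //.
by have := hw i; rewrite !mxE.
Qed.

Lemma partialE n (i : 'I_n) (f : 'rV[K]_n -> K) (p : 'rV[K]_n) :
  partial i f p = pd i (rowf f) (coords p).
Proof.
rewrite /partial /derive /pd (_ : (fun h => _) =
  (fun t : K => t^-1 * (rowf f (step (coords p) i t) - rowf f (coords p)))) //.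
apply/funext => t; rewrite /rowf coordsK; congr (_ * (f _ - f p)).
apply/rowP => k; rewrite !mxE /step /coords /=. rewrite addrC; congr (_ + _).
by case: eqP => _; rewrite ?mulr1 ?mulr0.
Qed.

(** Enlarging the box adds a shell of multi-indices. Box sums thereby become partial sums of an
    ordinary series of shell terms, the form that [An_series] accepts. *)
Lemma box_sum_recr (V : zmodType) n (G : {ffun 'I_n.+1 -> nat} -> V) N :
  \sum_(a : {ffun 'I_n.+1 -> 'I_N.+1}) G [ffun i => nat_of_ord (a i)] =
  \sum_(a : {ffun 'I_n.+1 -> 'I_N}) G [ffun i => nat_of_ord (a i)] +
  \sum_(a : {ffun 'I_n.+1 -> 'I_N.+1} | ~~ [forall i, (a i < N)%N])
     G [ffun i => nat_of_ord (a i)].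
Proof.
rewrite (bigID (fun a : {ffun 'I_n.+1 -> 'I_N.+1} => [forall i, (a i < N)%N])) /=.
congr (_ + _); case: N => [|N].
  rewrite big_pred0 => [|a]; last by apply/negbTE/negP => /forallP /(_ ord0).
  by rewrite big_pred0 // => a; case: (a ord0).
rewrite (reindex_onto (fun b : {ffun 'I_n.+1 -> 'I_N.+1} => [ffun i => widen_ord (leqnSn _) (b i)])
   (fun a => [ffun i => inord (a i)])) /=.
  apply: eq_big => [b|b _].
    apply/andP; split; first by apply/forallP => i; rewrite ffunE /=.
    by apply/eqP/ffunP => i; rewrite !ffunE /= inord_val.
  by congr G; apply/ffunP => i; rewrite !ffunE.
move=> a /forallP ha; apply/ffunP => i; rewrite !ffunE; apply/val_inj => /=.
by rewrite inordK.
Qed.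

(** The box sum factors into [n] geometric sums, each at most 2. *)
Lemma box_sum_half (n N : nat) :
  \sum_(a : {ffun 'I_n -> 'I_N}) 2^-1 ^+ (\sum_i a i)%N <= 2 ^+ n :> R.
Proof.
under eq_bigr do rewrite -prodrXr.
rewrite -(bigA_distr_bigA (fun (i : 'I_n) (k : 'I_N) => 2^-1 ^+ k)) /=.
rewrite prodr_const card_ord; apply: lerXn2r; rewrite ?nnegrE ?ler0n //.
  by apply: sumr_ge0 => k _; rewrite exprn_ge0.
have -> : \sum_(k < N) 2^-1 ^+ k = \sum_(k < N) 4 / 4 / 2 ^+ k :> R.
  by apply: eq_bigr => k _; rewrite mulfV ?pnatr_eq0 // mul1r exprVn.
rewrite sum_halves; have -> : 4 / 2 = 2 :> R by field.
by rewrite ler_piMr // gerBl exprn_ge0.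
Qed.

Lemma analytic_hol n (f : 'rV[K]_n.+1 -> K) (p : 'rV[K]_n.+1) :
  analytic_at f p -> hol (rowf f) (coords p).
Proof.
move=> [c [r0 [B0 [/rc_gt0P [e e0 ->] hB hf]]]].
pose B := nm B0.
have hB' a : nm (c a) * e ^+ (\sum_i a i)%N <= B.
  rewrite -rc_le; apply: le_trans (_ : B0 <= _).
    apply: le_trans (hB a); rewrite nmE rcM le_eqVlt; apply/orP; left; apply/eqP.
    congr (_ * _); elim: (\sum_i a i)%N => [//|k IH]; by rewrite !exprS rcM IH.
  rewrite /B -nmE ger0_norm //; apply: le_trans (hB a).
  by rewrite mulr_ge0 ?exprn_ge0 // -rc0 rc_le ltW.
(* At half the radius the coefficient bound leaves a factor 1/2 per degree, which [box_sum_half]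
   sums. *)
pose d := e / 2; have d0 : 0 < d by rewrite divr_gt0.
have d0' : 0 <= d by exact: ltW.
pose w (a : {ffun 'I_n.+1 -> nat}) : R := nm (c a) * d ^+ (\sum_i a i)%N.
pose T (v : 'I_n.+1 -> K) (a : {ffun 'I_n.+1 -> nat}) : K := c a * \prod_i v i ^+ a i.
pose out N := fun a : {ffun 'I_n.+1 -> 'I_N.+1} => ~~ [forall i, (a i < N)%N].
have Tw a : An (fun=> d) (T ^~ a) (w a).
  apply: An_mul; first exact: An_cst.
  rewrite -prodrXr.
  apply: (@An_prod _ _ _ _ (fun i v => v i ^+ a i)) => i _; apply: An_exp; exact: An_coord.
(* The shells start from an empty box at [N = 0]; a box of size 0 is empty only if there is a
   variable, hence the dimension [n.+1]. *)
have sumw N : \sum_(k < N) \sum_(a | out k a) w [ffun i => nat_of_ord (a i)] =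
    \sum_(a : {ffun 'I_n.+1 -> 'I_N}) w [ffun i => nat_of_ord (a i)].
  elim: N => [|N IH]; last by rewrite big_ord_recr /= IH box_sum_recr.
  by rewrite big_ord0 big_pred0 // => a; case: (a ord0).
have sumT v N : \sum_(k < N) \sum_(a | out k a) T v [ffun i => nat_of_ord (a i)] =
    \sum_(a : {ffun 'I_n.+1 -> 'I_N}) T v [ffun i => nat_of_ord (a i)].
  elim: N => [|N IH]; last by rewrite big_ord_recr /= IH box_sum_recr.
  by rewrite big_ord0 big_pred0 // => a; case: (a ord0).
apply: (holI d0 (g := fun v => rowf f (tr (coords p) v)) (b := B * 2 ^+ n.+1)) => //.
apply: (@An_series _ _ _ (fun N v => \sum_(a | out N a) T v [ffun i => nat_of_ord (a i)])
   (fun N => \sum_(a | out N a) w [ffun i => nat_of_ord (a i)])).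
- move=> N; apply: (@An_sum R _ _ _ (fun (a : {ffun 'I_n.+1 -> 'I_N.+1}) v => T v [ffun i => nat_of_ord (a i)])
    (fun a => w [ffun i => nat_of_ord (a i)]) (@out N)) => a _.
  exact: Tw.
- move=> N; rewrite sumw; apply: le_trans (ler_wpM2l (nm_ge0 _) (box_sum_half n.+1 N)).
  rewrite mulr_sumr; apply: ler_sum => a _; rewrite /w /d expr_div_n.
  under eq_bigr do rewrite ffunE.
  rewrite mulrA exprVn; apply: ler_wpM2r; first by rewrite invr_ge0 exprn_ge0.
  have := hB' [ffun i => nat_of_ord (a i)].
  by under eq_bigr do rewrite ffunE.
- move=> v dv; have hv : `|(\row_i tr (coords p) v i) - p| < rc e.
    apply/mx_norm_ltP => // i; rewrite !mxE /tr /coords addrC addKr.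
    apply: le_lt_trans (dv i) _; by rewrite /d ltr_pdivrMr // ltr_pMr // ltr1n.
  have := hf _ hv; rewrite (_ : psum c _ = series (fun N => \sum_(a | out N a)
    T v [ffun i => nat_of_ord (a i)])) //.
  apply/funext => N; rewrite /series /= big_mkord sumT /psum; apply: eq_bigr => a _.
  rewrite /T; congr (_ * _); apply: eq_bigr => i _.
  by rewrite !mxE /tr /coords addrC addKr ffunE.
Qed.

Lemma hol_analytic1 (a : K -> K) (x : K) :
  hol (fun v : unit -> K => a (v tt)) (fun=> x) -> analytic1_at a x.
Proof.
move=> [e [b [e0 h]]].
have [c [h1 h2 h3 h4 h5]] := power_series tt (fun=> e0) h.
have cE n v : c n v = c n (fun=> 0).
  by rewrite -h2; congr (c n _); apply/funext; case; rewrite /zap eqxx.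
exists (fun al => c (al ord0) (fun=> 0)), (rc e), (rc b); split.
- by rewrite -rc0 rc_lt.
- move=> al; rewrite big_ord1 nmE.
  have := h3 (al ord0) (fun=> 0); rewrite -rc_le => h3'.
  have -> : rc e ^+ al ord0 = rc (e ^+ al ord0).
    by elim: (al ord0) => [//|k IH]; rewrite !exprS rcM IH.
  by rewrite -rcM; apply: h3' => i; rewrite nm0 ltW.
- move=> v hv; have {}hv : nm (v 0 0 - x) < e.
    have /(mx_norm_ltP _ e0) := hv; move=> /(_ 0); by rewrite !mxE.
  have hd : disc (fun=> e) (fun _ : unit => v 0 0 - x) by move=> _; exact: ltW.
  have := h4 _ hd hv; rewrite /tr /= [x + _]addrC subrK.
  rewrite (_ : series _ = psum (fun al : {ffun 'I_1 -> nat} => c (al ord0) (fun=> 0))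
    (v - pt [:: x])) //; apply/funext => N.
  rewrite /series /= big_mkord /psum.
  transitivity (\prod_(i < 1) \sum_(k < N) c k (fun=> 0) * (v 0 0 - x) ^+ k).
    by rewrite big_ord1; apply: eq_bigr => k _; rewrite cE.
  rewrite bigA_distr_bigA; apply: eq_bigr => al _.
  by rewrite !big_ord1 ffunE !mxE.
Qed.

End RowVectors.

(** * The fold of critical points *)

(* Otherwise unification compares partial derivatives by unfolding their limits. *)
Global Opaque pd.

Section FoldChart.
Variable R : realType.
Local Notation K := (C R).
Local Notation ix := (@Ordinal 5 3 isT).

Lemma hol_prod (I J : finType) (f : J -> (I -> K) -> K) (p : I -> K) :
  (forall j, hol (f j) p) -> hol (fun v => \prod_j f j v) p.
Proof.
move=> h; rewrite unlock; elim: (index_enum J) => [|j s IH] /=; first exact: hol_cst.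
exact: hol_mul.
Qed.

Lemma hol_det (I : finType) n (A : (I -> K) -> 'M[K]_n) (p : I -> K) :
  (forall i j, hol (fun v => A v i j) p) -> hol (fun v => \det (A v)) p.
Proof.
move=> h; apply: (@hol_sum _ _ _ (fun (s : 'S_n) v => (-1) ^+ s * \prod_i A v i (s i))) => s.
apply: hol_mul; first exact: hol_cst.
by apply: (@hol_prod _ _ (fun i v => A v i (s i))).
Qed.

Lemma det22 (M : 'M[K]_2) : \det M = M 0 0 * M 1 1 - M 0 1 * M 1 0.
Proof.
rewrite (expand_det_row _ 0) !big_ord_recl big_ord0 addr0 /cofactor !det_mx11 !mxE /=.
rewrite expr0 mul1r expr1 mulN1r mulrN.
by congr (M _ _ * M _ _ - M _ _ * M _ _); exact: val_inj.
Qed.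

Lemma det33 (M : 'M[K]_3) :
  M (@Ordinal 3 0 isT) (@Ordinal 3 0 isT) = 0 -> M (@Ordinal 3 0 isT) (@Ordinal 3 2 isT) = 0 ->
  \det M = - M (@Ordinal 3 0 isT) (@Ordinal 3 1 isT) *
    (M (@Ordinal 3 1 isT) (@Ordinal 3 0 isT) * M (@Ordinal 3 2 isT) (@Ordinal 3 2 isT) -
     M (@Ordinal 3 1 isT) (@Ordinal 3 2 isT) * M (@Ordinal 3 2 isT) (@Ordinal 3 0 isT)).
Proof.
move=> h0 h2; rewrite (expand_det_row _ (@Ordinal 3 0 isT)).
rewrite (bigD1 (@Ordinal 3 1 isT)) //= big1 ?addr0; last first.
  move=> -[[|[|[|j]]] hj] // _.
    by rewrite (_ : Ordinal hj = @Ordinal 3 0 isT) ?h0 ?mul0r //; exact: val_inj.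
  by rewrite (_ : Ordinal hj = @Ordinal 3 2 isT) ?h2 ?mul0r //; exact: val_inj.
rewrite /cofactor det22 !mxE /= expr1 mulN1r mulrN mulNr.
by congr (- (_ * (M _ _ * M _ _ - M _ _ * M _ _))); exact: val_inj.
Qed.

Definition unknown (l : 'I_4) : 'I_5 := tnth [tuple ix0; ix1; iz; iu] l.
(** Where each coordinate of [P] is found among the parameters [bool] and the unknowns ['I_4]. The
    parameter [inl true] is [x]; [inl false], the prescribed value eta of the discriminant, is no
    coordinate of [P]. *)
Definition origin (i : 'I_5) : bool + 'I_4 :=
  tnth [tuple inr (@Ordinal 4 0 isT); inr (@Ordinal 4 1 isT); inr (@Ordinal 4 2 isT);
              inl true; inr (@Ordinal 4 3 isT)] i.

Lemma ord5_ind (Q : 'I_5 -> Prop) : Q ix0 -> Q ix1 -> Q iz -> Q ix -> Q iu -> forall i, Q i.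
Proof.
move=> h0 h1 h2 h3 h4 [[|[|[|[|[|m]]]]] hm] //.
- by rewrite (_ : Ordinal _ = ix0) //; exact: val_inj.
- by rewrite (_ : Ordinal _ = ix1) //; exact: val_inj.
- by rewrite (_ : Ordinal _ = iz) //; exact: val_inj.
- by rewrite (_ : Ordinal _ = ix) //; exact: val_inj.
- by rewrite (_ : Ordinal _ = iu) //; exact: val_inj.
Qed.

Lemma ord4_ind (Q : 'I_4 -> Prop) : Q (@Ordinal 4 0 isT) -> Q (@Ordinal 4 1 isT) ->
  Q (@Ordinal 4 2 isT) -> Q (@Ordinal 4 3 isT) -> forall i, Q i.
Proof.
move=> h0 h1 h2 h3 [[|[|[|[|m]]]] hm] //.
- by rewrite (_ : Ordinal _ = @Ordinal 4 0 isT) //; exact: val_inj.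
- by rewrite (_ : Ordinal _ = @Ordinal 4 1 isT) //; exact: val_inj.
- by rewrite (_ : Ordinal _ = @Ordinal 4 2 isT) //; exact: val_inj.
- by rewrite (_ : Ordinal _ = @Ordinal 4 3 isT) //; exact: val_inj.
Qed.

Lemma origin_unknown l : origin (unknown l) = inr l.
Proof. by move: l; apply: ord4_ind. Qed.

Lemma originP i l : (origin i == inr l) = (i == unknown l).
Proof. by move: i; apply: ord5_ind; move: l; apply: ord4_ind. Qed.

Definition assemble (w : bool + 'I_4 -> K) : 'I_5 -> K := fun i => w (origin i).

Lemma sum_origin (c : 'I_5 -> K) l : \sum_i c i * (origin i == inr l)%:R = c (unknown l).
Proof.
rewrite (bigD1 (unknown l)) //= originP eqxx mulr1 big1 ?addr0 // => i.
by rewrite originP => /negPf ->; rewrite mulr0.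
Qed.

Variable F : ('I_5 -> K) -> K.

Definition disc_form (v : 'I_5 -> K) : K :=
  pd ix0 (pd ix0 F) v * pd iu (pd iu F) v - pd iu (pd ix0 F) v ^+ 2.

Definition fold_eq (k : 'I_4) : ('I_5 -> K) -> K :=
  tnth [tuple F; pd iu F; pd ix0 F; disc_form] k.

Definition fold_jac (v : 'I_5 -> K) : 'M[K]_4 :=
  \matrix_(k, l) pd (unknown l) (fold_eq k) v.

Lemma fold_eq0 : fold_eq (@Ordinal 4 0 isT) = F. Proof. by []. Qed.
Lemma fold_eq1 : fold_eq (@Ordinal 4 1 isT) = pd iu F. Proof. by []. Qed.
Lemma fold_eq2 : fold_eq (@Ordinal 4 2 isT) = pd ix0 F. Proof. by []. Qed.
Lemma fold_eq3 : fold_eq (@Ordinal 4 3 isT) = disc_form. Proof. by []. Qed.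
Lemma unknown0 : unknown (@Ordinal 4 0 isT) = ix0. Proof. by []. Qed.
Lemma unknown1 : unknown (@Ordinal 4 1 isT) = ix1. Proof. by []. Qed.
Lemma unknown3 : unknown (@Ordinal 4 3 isT) = iu. Proof. by []. Qed.

Lemma hol_disc_form p : hol F p -> hol disc_form p.
Proof.
move=> h; apply: hol_sub; first by apply: hol_mul; do 2 apply: hol_pd.
by apply: hol_exp; do 2 apply: hol_pd.
Qed.

Lemma hol_fold_eq k p : hol F p -> hol (fold_eq k) p.
Proof.
move=> h; move: k; apply: ord4_ind => //; rewrite /fold_eq /=.
- exact: hol_pd.
- exact: hol_pd.
- exact: hol_disc_form.
Qed.

Lemma hol_fold_det p : hol F p -> hol (fun v => \det (fold_jac v)) p.
Proof.
move=> h; apply: hol_det => k l.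
apply: (hol_eq (f := pd (unknown l) (fold_eq k))).
  by apply: nearW => v; rewrite mxE.
by apply: hol_pd; exact: hol_fold_eq.
Qed.

(* [e] is the derivative of the solution with respect to the value of the last equation. *)
Lemma fold_cramer v (e : 'I_4 -> K) : hol F v -> pd iu F v = 0 -> pd ix0 F v = 0 ->
  (forall k, \sum_l fold_jac v k l * e l = (k == @Ordinal 4 3 isT)%:R) ->
  \det (fold_jac v) * e (@Ordinal 4 2 isT) = - pd ix1 F v * disc_form v /\
  pd ix1 F v * e (@Ordinal 4 1 isT) + pd iz F v * e (@Ordinal 4 2 isT) = 0.
Proof.
move=> hF hu h0 he.
have J00 : fold_jac v (@Ordinal 4 0 isT) (@Ordinal 4 0 isT) = 0 by rewrite mxE.
have J03 : fold_jac v (@Ordinal 4 0 isT) (@Ordinal 4 3 isT) = 0 by rewrite mxE.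
have J01 : fold_jac v (@Ordinal 4 0 isT) (@Ordinal 4 1 isT) = pd ix1 F v by rewrite mxE.
have J02 : fold_jac v (@Ordinal 4 0 isT) (@Ordinal 4 2 isT) = pd iz F v by rewrite mxE.
split.
  pose E : 'cV[K]_4 := \col_l e l.
  have hE : fold_jac v *m E = \col_k (k == @Ordinal 4 3 isT)%:R.
    by apply/colP => k; rewrite !mxE -he; apply: eq_bigr => l _; rewrite [E _ _]mxE.
  have : (\adj (fold_jac v) *m (fold_jac v *m E)) (@Ordinal 4 2 isT) 0 =
         \det (fold_jac v) * e (@Ordinal 4 2 isT).
    by rewrite mulmxA mul_adj_mx mul_scalar_mx !mxE.
  rewrite hE mxE (bigD1 (@Ordinal 4 3 isT)) //= big1 ?addr0 => [|k /negPf k3]; last first.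
    by rewrite [X in _ * X]mxE k3 mulr0.
  rewrite [X in _ * X]mxE eqxx mulr1 => <-; rewrite mxE /cofactor.
(* The right-hand side leaves a single cofactor, with rows [P, P_u, P_x0] and columns [x0, x1, u].
   At a critical point its first row is [(0, P_x1, 0)], and the remaining minor is minus the
   discriminant. *)
set N := row' _ _.
  have NE i j k l : lift (@Ordinal 4 3 isT) i = k -> lift (@Ordinal 4 2 isT) j = l ->
      N i j = pd (unknown l) (fold_eq k) v by move=> <- <-; rewrite !mxE.
  have N00 : N (@Ordinal 3 0 isT) (@Ordinal 3 0 isT) = 0.
    rewrite (NE _ _ (@Ordinal 4 0 isT) (@Ordinal 4 0 isT)); first (rewrite fold_eq0 unknown0; exact: h0).
      exact: val_inj.
    exact: val_inj.
  have N01 : N (@Ordinal 3 0 isT) (@Ordinal 3 1 isT) = pd ix1 F v.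
    rewrite (NE _ _ (@Ordinal 4 0 isT) (@Ordinal 4 1 isT)); first (rewrite fold_eq0 unknown1; reflexivity).
      exact: val_inj.
    exact: val_inj.
  have N02 : N (@Ordinal 3 0 isT) (@Ordinal 3 2 isT) = 0.
    rewrite (NE _ _ (@Ordinal 4 0 isT) (@Ordinal 4 3 isT)); first (rewrite fold_eq0 unknown3; exact: hu).
      exact: val_inj.
    exact: val_inj.
  have N10 : N (@Ordinal 3 1 isT) (@Ordinal 3 0 isT) = pd iu (pd ix0 F) v.
    rewrite (NE _ _ (@Ordinal 4 1 isT) (@Ordinal 4 0 isT)); first by rewrite fold_eq1 unknown0; exact: pd_sym.
      exact: val_inj.
    exact: val_inj.
  have N12 : N (@Ordinal 3 1 isT) (@Ordinal 3 2 isT) = pd iu (pd iu F) v.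
    rewrite (NE _ _ (@Ordinal 4 1 isT) (@Ordinal 4 3 isT)); first (rewrite fold_eq1 unknown3; reflexivity).
      exact: val_inj.
    exact: val_inj.
  have N20 : N (@Ordinal 3 2 isT) (@Ordinal 3 0 isT) = pd ix0 (pd ix0 F) v.
    rewrite (NE _ _ (@Ordinal 4 2 isT) (@Ordinal 4 0 isT)); first (rewrite fold_eq2 unknown0; reflexivity).
      exact: val_inj.
    exact: val_inj.
  have N22 : N (@Ordinal 3 2 isT) (@Ordinal 3 2 isT) = pd iu (pd ix0 F) v.
    rewrite (NE _ _ (@Ordinal 4 2 isT) (@Ordinal 4 3 isT)); first (rewrite fold_eq2 unknown3; reflexivity).
      exact: val_inj.
    exact: val_inj.
  rewrite (det33 N00 N02).
  rewrite N01 N10 N12 N20 N22.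
  rewrite /disc_form.
  rewrite (_ : (@Ordinal 4 3 isT + @Ordinal 4 2 isT)%N = 5%N); last by [].
  move: (pd ix1 F v) (pd iu (pd ix0 F) v) (pd iu (pd iu F) v) (pd ix0 (pd ix0 F) v).
  by move=> {hF hu h0 he J00 J03 J01 J02 hE N NE N00 N01 N02 N10 N12 N20 N22} a p t q; ring.
have := he (@Ordinal 4 0 isT).
rewrite (bigD1 (@Ordinal 4 1 isT)) // (bigD1 (@Ordinal 4 2 isT)) //= J01 J02 big1 ?addr0 //.
by apply: ord4_ind; rewrite ?eqxx ?J00 ?J03 ?mul0r //= andbF.
Qed.

Lemma sum_unknown (c : 'I_5 -> K) : c ix = 0 -> \sum_i c i = \sum_l c (unknown l).
Proof.
move=> hc; rewrite !big_ord_recl !big_ord0.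
rewrite [X in _ + (_ + (_ + (X + _)))](_ : _ = 0) ?add0r; last first.
  by rewrite -[RHS]hc; congr c; exact: val_inj.
by congr (c _ + (c _ + (c _ + (c _ + _)))); exact: val_inj.
Qed.

Lemma nb_true (x : K) (Q : set (bool -> K)) :
  nb (bp 0 x) Q -> \forall v \near nb (bp 0 x), Q (bp 0 (v true)).
Proof.
move=> [e e0 he]; exists e => // v hv; apply: he; case => /=.
  exact: (hv true).
by rewrite subrr nm0 ltW.
Qed.

Lemma put_false (x : K) v : put (pred1 false) (bp 0 x) v = bp 0 (v true).
Proof. by apply/funext; case. Qed.

Lemma hadamard_false (f h : (bool -> K) -> K) x : hol h (bp 0 x) ->
  (\forall v \near nb (bp 0 x), f v = f (bp 0 (v true)) + v false * h v) ->
  pd false f (bp 0 x) = h (bp 0 x).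
Proof.
move=> hh hf; have cs := @step_cvg _ _ (bp 0 x) false.
apply: (is_pd (h := fun t => h (step (bp 0 x) false t))).
  by apply: filterS (near_cvg cs hf) => t ->; rewrite step_bp_false /= add0r.
exact: (cvg_comp _ _ cs (hol_cvg hh)).
Qed.

Lemma hol_hadamard_false (f : (bool -> K) -> K) x : hol f (bp 0 x) ->
  exists2 h, hol h (bp 0 x) &
    \forall v \near nb (bp 0 x), f v = f (bp 0 (v true)) + v false * h v.
Proof.
move=> /(hol_hadamard (pred1 false)) [h h1 h2]; exists (h false) => //.
by apply: filterS h2 => v; rewrite big_pred1_eq put_false /= subr0.
Qed.

Lemma hol_bp0 (f : (bool -> K) -> K) x : hol f (bp 0 x) ->
  hol (fun v => f (bp 0 (v true))) (bp 0 x).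
Proof.
move=> hf; apply: (hol_comp (g := fun b v => bp 0 (v true) b) _ _ hf) => //.
by case; [exact: hol_coord|exact: hol_cst].
Qed.

Lemma pd_false_bp0 (f : (bool -> K) -> K) v : pd false (fun v => f (bp 0 (v true))) v = 0.
Proof.
apply: (is_pd (h := fun=> 0)); last exact: cvg_cst0.
by apply: near0W => t; rewrite mulr0 addr0 /step /= addr0.
Qed.

(** A chart of all critical points near [b], with eta and [x] as coordinates. It covers degenerate
    and nondegenerate points alike, because a critical point is located by the value of its own
    discriminant. *)
Theorem fold_chart b : hol F b -> F b = 0 -> pd iu F b = 0 -> pd ix0 F b = 0 ->
  pd ix1 F b != 0 -> disc_form b = 0 -> \det (fold_jac b) != 0 ->
  exists (y : 'I_4 -> (bool -> K) -> K) (m : (bool -> K) -> K),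
  [/\ (forall l, hol (y l) (bp 0 (b ix))) /\ hol m (bp 0 (b ix)),
      (forall l, y l (bp 0 (b ix)) = b (unknown l)) /\ m (bp 0 (b ix)) != 0,
      \forall v \near nb (bp 0 (b ix)), y (@Ordinal 4 2 isT) v =
         y (@Ordinal 4 2 isT) (bp 0 (v true)) + v false ^+ 2 * m v,
      \forall v \near nb (bp 0 (b ix)), pd false (y (@Ordinal 4 1 isT)) (bp 0 (v true)) = 0 &
      \forall v \near nb b, F v = 0 -> pd iu F v = 0 -> pd ix0 F v = 0 ->
         forall l, v (unknown l) = y l (bp (disc_form v) (v ix))].
Proof.
move=> hF Fb Fub F0b F1b Hb detb; set p := bp 0 (b ix).
set o1 := @Ordinal 4 1 isT; set o2 := @Ordinal 4 2 isT; set o3 := @Ordinal 4 3 isT.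
pose c : bool + 'I_4 -> K := cmb p (fun l => b (unknown l)).
have cE : assemble c = b by apply/funext; apply: ord5_ind.
(* Eta is subtracted from the fourth equation only, so the Jacobian in the unknowns is
   [fold_jac b]. *)
pose g k (w : bool + 'I_4 -> K) := fold_eq k (assemble w) - (k == o3)%:R * w (inl false).
have hFa k w : hol (fold_eq k) (assemble w) -> hol (fun w => fold_eq k (assemble w)) w.
  by apply: (hol_comp (g := fun i w => w (origin i))) => // i; exact: hol_coord.
have hlin k w : hol (fun w : bool + 'I_4 -> K => (k == o3)%:R * w (inl false)) w.
  by apply: hol_mul; [exact: hol_cst|exact: hol_coord].
have hFeq k : hol (fold_eq k) b by exact: hol_fold_eq.
have hg k : hol (g k) c by apply: hol_sub => //; apply: hFa; rewrite cE.
have g0 k : g k c = 0.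
  rewrite /g cE /= mulr0 subr0; move: k {hg}; apply: ord4_ind.
  - exact: Fb.
  - exact: Fub.
  - exact: F0b.
  - exact: Hb.
have pg k l : pd (inr l) (g k) c = fold_jac b k l.
  rewrite pd_sub //; last by apply: hFa; rewrite cE.
  rewrite (pd_comp (g := fun i w => w (origin i)) _ _ _ (q := b)) //; last 2 first.
  - by move=> i; exact: hol_coord.
  - by move=> i; rewrite -cE.
  under eq_bigr do rewrite pd_coord.
  rewrite sum_origin pd_mul; last 2 first.
  - exact: hol_cst.
  - exact: hol_coord.
  by rewrite pd_cst mul0r add0r pd_coord mulr0 subr0 mxE.
have uJ : fold_jac b \in unitmx by rewrite unitmxE unitfE.
pose A j k := invmx (fold_jac b) j k.
have [||y [y1 y2 y3 y4]] := implicit_function (A := A) hg g0.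
- move=> j l; under eq_bigr do rewrite pg.
  by have := congr1 (fun M : 'M[K]_4 => M j l) (mulVmx uJ); rewrite !mxE.
- move=> d hd k; pose E : 'cV[K]_4 := \col_l d l.
  have : invmx (fold_jac b) *m E = 0.
    by apply/colP => j; rewrite !mxE -[RHS](hd j); apply: eq_bigr => i _; rewrite [E _ _]mxE.
  move=> /(congr1 (fun M : 'cV[K]_4 => fold_jac b *m M)); rewrite mulKVmx // mulmx0.
  by move=> /(congr1 (fun M : 'cV[K]_4 => M k 0)); rewrite !mxE.
pose gam (v : bool -> K) := assemble (cmb v (y ^~ v)).
have gamp : gam p = b.
  rewrite -cE /gam; congr assemble; apply/funext; case=> //= l; exact: y2.
have hgam i v : (forall l, hol (y l) v) -> hol (fun v => gam v i) v.
  move=> hy; rewrite /gam /assemble; case: (origin i) => l /=; first exact: hol_coord.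
  exact: hy.
have near_gam : \forall v \near nb p, [/\ forall l, hol (y l) v, hol F (gam v),
    \det (fold_jac (gam v)) != 0, pd ix1 F (gam v) != 0 &
    forall k, fold_eq k (gam v) = (k == o3)%:R * v false].
  have cg : gam @ nb p --> nb b.
    by rewrite -gamp; apply: (hol_cvg_nb (g := fun i v => gam v i)) => i; exact: hgam.
  have n1 := near_cvg cg (hol_nb hF).
  have n2 := near_cvg cg (hol_neq0 (hol_fold_det hF) detb).
  have n3 := near_cvg cg (hol_neq0 (hol_pd ix1 hF) F1b).
  have n4 : \forall v \near nb p, forall l, hol (y l) v.
    by apply: filter_forall => l; exact: hol_nb.
  apply: filterS (nbI n1 (nbI n2 (nbI n3 (nbI n4 y3)))) => v [h1 [h2 [h3 [h4 h5]]]].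
  by split=> // k; apply/eqP; rewrite -subr_eq0; apply/eqP; exact: h5.
have der v : (\forall v' \near nb v, [/\ forall l, hol (y l) v', hol F (gam v'),
    \det (fold_jac (gam v')) != 0, pd ix1 F (gam v') != 0 &
    forall k, fold_eq k (gam v') = (k == o3)%:R * v' false]) ->
    \det (fold_jac (gam v)) * pd false (y o2) v = - pd ix1 F (gam v) * v false /\
    pd ix1 F (gam v) * pd false (y o1) v + pd iz F (gam v) * pd false (y o2) v = 0.
  move=> hv; have [hy hFv _ _ heq] := nb_self hv.
  have hyp k : \sum_l fold_jac (gam v) k l * pd false (y l) v = (k == o3)%:R.
    have : pd false (fun v => fold_eq k (gam v)) v =
           pd false (fun v : bool -> K => (k == o3)%:R * v false) v.
      apply: pd_eq; first by apply: hol_mul; [exact: hol_cst|exact: hol_coord].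
      by apply: filterS hv => v' [].
    rewrite pd_mul; [|exact: hol_cst|exact: hol_coord].
    rewrite pd_cst pd_coord mul0r add0r mulr1 => <-.
    rewrite (pd_comp (g := fun i v => gam v i) _ _ _ (q := gam v)) //; last 2 first.
    - by move=> i; exact: hgam.
    - exact: hol_fold_eq.
    rewrite [RHS]sum_unknown.
      apply: eq_bigr => l _; rewrite mxE; congr (_ * _).
      by rewrite /gam /assemble origin_unknown.
    rewrite [X in _ * X](_ : _ = pd false (fun v : bool -> K => v true) v) //.
    by rewrite pd_coord mulr0.
  have e0 := heq (@Ordinal 4 0 isT); have e1 := heq o1; have e2 := heq o2; have e3 := heq o3.
  rewrite fold_eq1 mul0r in e1; rewrite fold_eq2 mul0r in e2.
  rewrite fold_eq3 eqxx mul1r in e3.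
  by have := fold_cramer hFv e1 e2 hyp; rewrite e3.
have nder : \forall v \near nb p,
    \det (fold_jac (gam v)) * pd false (y o2) v = - pd ix1 F (gam v) * v false /\
    (v false = 0 -> pd false (y o2) v = 0 /\ pd false (y o1) v = 0).
  apply: filterS (nb_near near_gam) => v hv; have [d1 d2] := der v hv.
  have [_ _ h3 h4 _] := nb_self hv; split=> // v0.
  have z2 : pd false (y o2) v = 0.
    by move/eqP: d1; rewrite v0 mulr0 mulf_eq0 (negPf h3) => /eqP.
  split=> //; move/eqP: d2; rewrite z2 mulr0 addr0 mulf_eq0 (negPf h4) => /eqP //.
(* Two divisions by eta: [z = z(0, x) + eta h] and [h = h(0, x) + eta m], where [h(0, x)] is the
   eta-derivative of [z] at [eta = 0] and vanishes by [nder]. *)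
have [h hh hE] := hol_hadamard_false (y1 o2).
have [m hm mE] := hol_hadamard_false hh.
have nh : \forall v \near nb p, h (bp 0 (v true)) = 0.
  apply: filterS (nb_true (nbI nder (nb_near (nbI hE (hol_nb hh))))) => v [[_ d] hv].
  have [d0 _] := d erefl; rewrite -[RHS]d0; apply/esym; apply: hadamard_false.
    by case: (nb_self hv).
  by apply: filterS hv => w [].
have mE' : \forall v \near nb p, h v = v false * m v.
  by apply: filterS (nbI mE nh) => v [-> ->]; rewrite add0r.
exists y, m; split => //; first split=> //.
(* Differentiating [det J z_eta = - P_x1 eta] at [eta = 0], where [z_eta = 0], gives
   [2 m det J = - P_x1] at the base point, which is nonzero. *)
- have D1 : pd false (pd false (y o2)) p = m p *+ 2.
    have e2 : \forall v \near nb p, pd false (y o2) v = h v + v false * pd false h v.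
      apply: filterS (nbI (nb_near hE) (nbI (hol_nb hh) (hol_nb (hol_bp0 (y1 o2))))) => v [E1 [E2 E3]].
      have hfh : hol (fun v => v false * h v) v by apply: hol_mul; [exact: hol_coord|].
      rewrite (pd_eq (g := fun v => y o2 (bp 0 (v true)) + v false * h v) false) //.
        rewrite pd_add // pd_false_bp0 add0r pd_mul //; last exact: hol_coord.
        by rewrite pd_coord mul1r.
      exact: hol_add.
    have hpd : hol (pd false h) p by exact: hol_pd.
    have hfp : hol (fun v => v false * pd false h v) p.
      by apply: hol_mul; [exact: hol_coord|].
    rewrite (pd_eq (g := fun v => h v + v false * pd false h v) false) //; last exact: hol_add.
    rewrite pd_add // pd_mul //; last exact: hol_coord.
    by rewrite pd_coord mul1r mul0r addr0 (hadamard_false hm mE) mulr2n.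
  have hd : hol (fun v => \det (fold_jac (gam v))) p.
    apply: (hol_comp (g := fun i v => gam v i) _ _ (hol_fold_det hF)) => i.
      exact: hgam.
    by rewrite -gamp.
  have ha : hol (fun v => - pd ix1 F (gam v)) p.
    apply: hol_opp; apply: (hol_comp (g := fun i v => gam v i) _ _ (hol_pd ix1 hF)) => i.
      exact: hgam.
    by rewrite -gamp.
  have e1 : pd false (fun v => \det (fold_jac (gam v)) * pd false (y o2) v) p =
            pd false (fun v => - pd ix1 F (gam v) * v false) p.
    apply: pd_eq; first by apply: hol_mul => //; exact: hol_coord.
    by apply: filterS nder => v [].
  have [_ /(_ erefl) [z2 _]] := nb_self nder.
  have hpy : hol (pd false (y o2)) p by exact: hol_pd.
  have hc : hol (fun v : bool -> K => v false) p by exact: hol_coord.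
  move: e1; rewrite !pd_mul // z2 mulr0 add0r pd_coord mulr1 gamp D1 /= mulr0 add0r.
  move=> e1; apply/eqP => m0; move: e1; rewrite m0 mul0rn mulr0 => /esym/eqP.
  by rewrite oppr_eq0 (negPf F1b).
- apply: filterS (nbI hE mE') => v [-> ->]; by rewrite expr2 mulrA.
- apply: filterS (nb_true nder) => v [_ /(_ erefl)]; by case.
(* Any critical point [v] solves the extended system with eta equal to [disc_form v]; this value is
   small near [b], so local uniqueness applies. *)
- have cw : (fun v => cmb (bp (disc_form v) (v ix)) (fun l => v (unknown l))) @ nb b --> nb c.
    apply: nb_cvgP => -[[]|l].
    + exact: (hol_cvg (hol_coord _ _)).
    + by rewrite /= -Hb; apply: hol_cvg; exact: hol_disc_form.
    + exact: (hol_cvg (hol_coord _ _)).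
  apply: filterS (near_cvg cw y4) => v hv F0 Fu F00 l.
  have := hv _ l => /= -> //; last first.
  move=> k; rewrite /g (_ : assemble _ = v); last by apply/funext; apply: ord5_ind.
  move: k; apply: ord4_ind => /=; rewrite ?mul0r ?subr0 //.
  by rewrite mul1r fold_eq3 subrr.
Qed.
End FoldChart.

(** * Resolution of the fold *)

Section FoldResolution.
Variable R : realType.
Local Notation K := (C R).
Local Notation ix := (@Ordinal 5 3 isT).

Lemma hol_near_ge (I : finType) (f : (I -> K) -> K) (p : I -> K) :
  hol f p -> f p != 0 -> \forall v \near nb p, nm (f p) / 2 <= nm (f v).
Proof.
move=> hf f0; have e0 : 0 < nm (f p) / 2 by rewrite divr_gt0 ?nm_gt0.
have /cvg_nmP /(_ _ e0) := hol_cvg hf; apply: filterS => v hv.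
have h : nm (f p) <= nm (f p - f v) + nm (f v).
  by rewrite -{1}(subrK (f v) (f p)) nmD.
by move: (nm (f p)) (nm (f v)) (nm (f p - f v)) hv h => a c d; lra.
Qed.

Lemma hol_near_small (I : finType) (f : (I -> K) -> K) (p : I -> K) (e : R) :
  hol f p -> f p = 0 -> 0 < e -> \forall v \near nb p, nm (f v) <= e.
Proof.
move=> hf f0 e0; have /cvg_nmP /(_ _ e0) := hol_cvg hf.
by apply: filterS => v; rewrite f0 sub0r nmN.
Qed.

Lemma cvg_bp (T : Type) (F : set_system T) {FF : Filter F} (f g : T -> K) (s t : K) :
  f @ F --> s -> g @ F --> t -> (fun w => bp (f w) (g w)) @ F --> nb (bp s t).
Proof. by move=> h1 h2; apply: nb_cvgP => -[]; [exact: h2|exact: h1]. Qed.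

(* Choose [q] with [q ^ 2 * m (s q, x) = - Z x]: then [eta = s q] turns
   [z = Z x + eta ^ 2 * m (eta, x)] into [z = Z x * (1 - s ^ 2)]. *)
Lemma fold_square_root (m : (bool -> K) -> K) (Z : K -> K) (x0 : K) :
  hol m (bp 0 x0) -> m (bp 0 x0) != 0 -> hol (fun v : bool -> K => Z (v true)) (bp 0 x0) ->
  Z x0 != 0 ->
  exists2 q : (bool -> K) -> K, hol q (bp 0 x0) &
  exists q0 : K, q0 ^+ 2 * m (bp 0 x0) = - Z x0 /\
  \forall w \near nb (cmb (bp 0 x0) (fun _ : unit => q0)),
    w (inr tt) ^+ 2 * m (bp (w (inl false) * w (inr tt)) (w (inl true))) = - Z (w (inl true)) ->
    w (inr tt) = q (fun i => w (inl i)).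
Proof.
move=> hm m0 hZ Z0; pose q0 := sqrtC (- Z x0 / m (bp 0 x0)).
have q0E : q0 ^+ 2 * m (bp 0 x0) = - Z x0 by rewrite sqrtCK mulfVK.
have q00 : q0 != 0.
  apply: contraNneq Z0 => q00; move: q0E; rewrite q00 expr0n mul0r => /esym/eqP.
  by rewrite oppr_eq0.
set c := cmb (bp 0 x0) (fun _ : unit => q0).
pose arg (b : bool) (w : bool + unit -> K) :=
  bp (w (inl false) * w (inr tt)) (w (inl true)) b.
pose g (w : bool + unit -> K) :=
  w (inr tt) * w (inr tt) * m (arg ^~ w) + Z (w (inl true)).
have harg b : hol (arg b) c.
  case: b; rewrite /arg /bp /=; first exact: hol_coord.
  by apply: hol_mul; exact: hol_coord.
have argc b : arg b c = bp 0 x0 b by case: b; rewrite /arg /c //= mul0r.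
have hma : hol (fun w => m (arg ^~ w)) c by apply: (hol_comp harg argc).
have hZa : hol (fun w : bool + unit -> K => Z (w (inl true))) c.
  by apply: (hol_comp (g := fun b w => w (inl b)) _ _ hZ) => // b; exact: hol_coord.
have hqq : hol (fun w : bool + unit -> K => w (inr tt) * w (inr tt)) c.
  by apply: hol_mul; exact: hol_coord.
have hqm : hol (fun w => w (inr tt) * w (inr tt) * m (arg ^~ w)) c by exact: hol_mul.
have hg : hol g c by exact: hol_add.
have argE : arg ^~ c = bp 0 x0 by apply/funext.
have g0 : g c = 0 by rewrite /g argE /c /= -expr2 q0E addNr.
(* At [s = 0] the argument [s q] of [m] does not vary with [q], so only the square contributes. *)
have pg : pd (inr tt) g c = q0 * m (bp 0 x0) *+ 2.
  rewrite pd_add // pd_mul // pd_mul; [|exact: hol_coord|exact: hol_coord].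
  have -> : pd (inr tt) (fun w : bool + unit -> K => Z (w (inl true))) c = 0.
    apply: (is_pd (h := fun=> 0)); last exact: cvg_cst0.
    by apply: near0W => t; rewrite mulr0 addr0 /step /= addr0.
  have -> : pd (inr tt) (fun w => m (arg ^~ w)) c = 0.
    rewrite (pd_comp _ harg argc hm) big_bool /= /arg /bp /= !pd_coord mulr0 add0r.
    rewrite pd_mul; [|exact: hol_coord|exact: hol_coord].
    by rewrite !pd_coord /c /= mul0r mul0r addr0 mulr0.
  by rewrite !pd_coord argE /c /=; ring.
have D0 : pd (inr tt) g c != 0 by rewrite pg mulrn_eq0 /= mulf_neq0.
have [q [q1 _ _ q4]] := implicit_scalar hg g0 D0.
exists q => //; exists q0; split=> //; apply: filterS q4 => w hw e; apply: hw.
by rewrite /g -expr2 [X in X + _]e addNr.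
Qed.

(** Inserting [eta = s q(s, x)] into the chart straightens [z]. That [G] has no linear term in [s]
    is inherited through the chain rule from [x1] having none in eta. The alternative is unavoidable
    here, since [z] determines [s] only through [s ^+ 2]. *)
Theorem fold_resolved (F : ('I_5 -> K) -> K) (b : 'I_5 -> K) : hol F b -> F b = 0 ->
  pd iu F b = 0 -> pd ix0 F b = 0 -> pd ix1 F b != 0 -> disc_form F b = 0 ->
  \det (fold_jac F b) != 0 -> b iz != 0 ->
  exists (Z : K -> K) (G : (bool -> K) -> K),
  [/\ hol (fun v : bool -> K => Z (v true)) (bp 0 (b ix)) /\ Z (b ix) = b iz,
      hol G (bp 0 (b ix)),
      \forall v \near nb (bp 0 (b ix)), pd false G (bp 0 (v true)) = 0,
      \forall v \near nb b, F v = 0 -> pd iu F v = 0 -> pd ix0 F v = 0 ->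
        forall s, s != 0 -> v iz = Z (v ix) * (1 - s ^+ 2) ->
        disc_form F v != 0 /\
        (v ix1 = G (bp s (v ix)) \/ v ix1 = G (bp (- s) (v ix))) &
      \forall v \near nb b, F v = 0 -> pd iu F v = 0 -> pd ix0 F v = 0 ->
        disc_form F v = 0 -> v iz = Z (v ix)].
Proof.
move=> hF Fb Fub F0b F1b Hb detb bz; set p := bp 0 (b ix).
set o1 := @Ordinal 4 1 isT; set o2 := @Ordinal 4 2 isT.
have [y [m [[hy hm] [yp mp] zE yx1 yu]]] := fold_chart hF Fb Fub F0b F1b Hb detb.
pose Z x := y o2 (bp 0 x).
have hZ : hol (fun v : bool -> K => Z (v true)) p by exact: hol_bp0.
have Zb : Z (b ix) = b iz by exact: yp.
have Z0 : Z (b ix) != 0 by rewrite Zb.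
have [q hq [q0 [q0E quniq]]] := fold_square_root hm mp hZ Z0.
pose G v := y o1 (bp (v false * q v) (v true)).
pose arg (i : bool) (v : bool -> K) := bp (v false * q v) (v true) i.
have harg i v : hol q v -> hol (arg i) v.
  move=> hqv; case: i; first exact: hol_coord.
  by apply: hol_mul => //; exact: hol_coord.
have arg0 x i : arg i (bp 0 x) = bp 0 x i by case: i; rewrite /arg //= mul0r.
pose w1 v := bp (disc_form F v) (v ix).
have cw1 : w1 @ nb b --> nb p.
  rewrite /p -Hb; apply: cvg_bp; first by apply: hol_cvg; exact: hol_disc_form.
  exact: (hol_cvg (hol_coord _ _)).
exists Z, G; split.
- by [].
- by apply: (hol_comp (g := arg) _ _ (hy o1)) => [i|i]; [exact: harg|exact: arg0].
- apply: filterS (nbI (nb_true (nbI (hol_nb hq) (hol_nb (hy o1)))) yx1) => v [[h1 h2] h3].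
  rewrite (pd_comp (g := arg) _ _ (arg0 _) h2) => [|i]; last exact: harg.
  by rewrite big_bool /= h3 mul0r addr0 /arg /= pd_coord mulr0.
- have [e e0 he] := quniq.
  have e20 : 0 < e ^+ 2 by rewrite exprn_gt0.
  have hcx : hol (fun v : 'I_5 -> K => v ix) b by exact: hol_coord.
  have hZx : hol (fun v : 'I_5 -> K => Z (v ix)) b.
    apply: (hol_comp (f := fun v : bool -> K => Z (v true)) (g := fun i v => bp 0 (v ix) i) _ _ hZ).
      by case; [exact: hol_coord|exact: hol_cst].
    by [].
  have hmw : hol (fun v => m (w1 v)) b.
    apply: (hol_comp (g := fun i v => w1 v i) _ _ hm).
      by case; [exact: hol_coord|exact: hol_disc_form].
    by case; rewrite /w1 /= ?Hb.
  have w1b : w1 b = p by rewrite /w1 Hb.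
  have mu0 : 0 < nm (m p) / 2 by rewrite divr_gt0 ?nm_gt0.
  have ze0 : 0 < nm (b iz) / 2 by rewrite divr_gt0 ?nm_gt0.
  have n1 : \forall v \near nb b, nm (m p) / 2 <= nm (m (w1 v)).
    by have := hol_near_ge hmw; rewrite w1b; apply.
  have n2 : \forall v \near nb b, nm (b iz) / 2 <= nm (Z (v ix)).
    by have := hol_near_ge hZx; rewrite Zb; apply.
  (* The quotient [eta / s] is not a germ at the base point, so smallness is prepared by hand: this
     bound will keep [(eta / s) ^+ 2] within [e ^+ 2] of [q0 ^+ 2], and the next one will give
     [nm s <= e]. *)
  have n3 : \forall v \near nb b, nm (Z (v ix) + q0 ^+ 2 * m (w1 v)) <= nm (m p) / 2 * e ^+ 2.
    apply: hol_near_small; last by rewrite mulr_gt0.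
      by apply: hol_add => //; apply: hol_mul => //; exact: hol_cst.
    by rewrite w1b q0E addrN.
  have n4 : \forall v \near nb b, nm (Z (v ix) - v iz) <= nm (b iz) / 2 * e ^+ 2.
    apply: hol_near_small; last by rewrite mulr_gt0.
      by apply: hol_sub => //; exact: hol_coord.
    by rewrite Zb subrr.
  have n5 : \forall v \near nb b, nm (v ix - b ix) <= e.
    by exists e => // v; exact.
  apply: filterS (nbI yu (nbI (near_cvg cw1 zE) (nbI n1 (nbI n2 (nbI n3 (nbI n4 n5)))))).
  move=> v [hyu [hz [h1 [h2 [h3 [h4 h5]]]]]] Fv Fuv F0v s s0 vz.
  have hv := hyu Fv Fuv F0v; set x := v ix in h2 h3 h4 h5 hv hz vz *.
  set eta := disc_form F v in hv *.
  have vz' : v iz = y o2 (w1 v) by have := hv o2.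
  have vx1 : v ix1 = y o1 (w1 v) by have := hv o1.
  have {}hz : Z x * s ^+ 2 = - (eta ^+ 2 * m (w1 v)).
    have : Z x * (1 - s ^+ 2) = Z x + eta ^+ 2 * m (w1 v) by rewrite -vz vz' hz.
    by rewrite mulrBr mulr1 => /addrI h; rewrite -h opprK.
  have Zx0 : Z x != 0.
    by apply: contraTneq h2 => ->; rewrite nm0 -ltNge.
  have eta0 : eta != 0.
    apply: contraNneq s0 => e00; move/eqP: hz; rewrite e00 expr0n mul0r oppr0.
    by rewrite mulf_eq0 (negPf Zx0) expf_eq0.
  split=> //; pose q' := eta / s.
  have sq : s * q' = eta by rewrite mulrC divfK.
  have q'E : q' ^+ 2 * m (w1 v) = - Z x.
    apply: (mulfI (expf_neq0 2 s0)).
    by rewrite mulrA -exprMn sq mulrN [_ * Z x]mulrC hz opprK.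
  have se : nm s <= e.
    rewrite -(@ler_pXn2r _ 2) ?nnegrE ?nm_ge0 ?(ltW e0) // -nmX.
    rewrite -(ler_pM2l ze0); apply: le_trans h4.
    apply: le_trans (_ : nm (Z x) * nm (s ^+ 2) <= _); first by rewrite ler_wpM2r ?nm_ge0.
    by rewrite -nmM vz mulrBr mulr1 opprB addrC subrK.
  have qe : nm (q' - q0) * nm (q' + q0) <= e ^+ 2.
    rewrite -(ler_pM2l mu0); apply: le_trans h3.
    apply: le_trans (_ : nm (m (w1 v)) * (nm (q' - q0) * nm (q' + q0)) <= _).
      by rewrite ler_wpM2r ?mulr_ge0 ?nm_ge0.
    rewrite -!nmM -subr_sqr -nmN mulrC mulrBl q'E.
    by rewrite opprB opprK addrC.
  (* The distances of [q'] to [q0] and [- q0] have product at most [e ^+ 2], so one of them is at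
     most [e]. The second case is the first one for [- s] and [- q'], which belong to the same
     eta. *)
  have [qe1|qe1] : nm (q' - q0) <= e \/ nm (q' + q0) <= e.
    have [|h6] := leP (nm (q' - q0)) e; first by left.
    right; rewrite leNgt; apply/negP => h7; have := lt_le_trans (ltr_pM (ltW e0) (ltW e0) h6 h7) qe.
    by rewrite expr2 ltxx.
  + left; have hw : q' = q (bp s x).
      have := he (cmb (bp s x) (fun=> q')) => /=.
      rewrite (_ : (fun i => bp s x i) = bp s x) //; apply.
        by case=> [[]|[]] /=; rewrite ?subr0.
      by rewrite sq.
    by rewrite /G /= -hw sq vx1.
  + right; have hw : - q' = q (bp (- s) x).
      have := he (cmb (bp (- s) x) (fun=> - q')) => /=.
      rewrite (_ : (fun i => bp (- s) x i) = bp (- s) x) //; apply.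
        case=> [[]|[]] /=; rewrite ?subr0 ?nmN //.
        by rewrite -nmN opprB addrC opprK.
      by rewrite mulrNN sq sqrrN.
    by rewrite /G /= -hw mulrNN sq vx1.
- apply: filterS yu => v hv Fv Fuv F0v Hv.
  by have := hv Fv Fuv F0v o2; rewrite Hv.
Qed.
End FoldResolution.

(** * The kernel method *)

Section KernelMethod.
Variable R : realType.
Local Notation K := (C R).
Local Notation ix := (@Ordinal 5 3 isT).
Local Notation oz := (@Ordinal 3 0 isT).
Local Notation ox := (@Ordinal 3 1 isT).
Local Notation ou := (@Ordinal 3 2 isT).

Lemma ord3_ind (Q : 'I_3 -> Prop) : Q oz -> Q ox -> Q ou -> forall i, Q i.
Proof.
move=> h0 h1 h2 [[|[|[|m]]] hm] //.
- by rewrite (_ : Ordinal _ = oz) //; exact: val_inj.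
- by rewrite (_ : Ordinal _ = ox) //; exact: val_inj.
- by rewrite (_ : Ordinal _ = ou) //; exact: val_inj.
Qed.

Lemma ord2_ind (Q : 'I_2 -> Prop) :
  Q (@Ordinal 2 0 isT) -> Q (@Ordinal 2 1 isT) -> forall i, Q i.
Proof.
move=> h0 h1 [[|[|m]] hm] //.
- by rewrite (_ : Ordinal _ = @Ordinal 2 0 isT) //; exact: val_inj.
- by rewrite (_ : Ordinal _ = @Ordinal 2 1 isT) //; exact: val_inj.
Qed.

Lemma row3E (t : 'I_3 -> K) : \row_i t i = pt [:: t oz; t ox; t ou].
Proof. by apply/rowP; apply: ord3_ind; rewrite !mxE. Qed.

Lemma row2E (w : 'I_2 -> K) :
  \row_i w i = pt [:: w (@Ordinal 2 0 isT); w (@Ordinal 2 1 isT)].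
Proof. by apply/rowP; apply: ord2_ind; rewrite !mxE. Qed.

Variables (P : 'rV[K]_5 -> K) (W : set 'rV[K]_5) (M : 'rV[K]_3 -> K)
  (Omega : set 'rV[K]_3) (M1 : 'rV[K]_2 -> K) (D : set 'rV[K]_2).
Hypothesis hsol : catalytic_solution P W M Omega M1 D.

Definition graph_point (t : 'I_3 -> K) : 'I_5 -> K := coords
  (pt [:: M (pt [:: t oz; t ox; t ou]); M1 (pt [:: t oz; t ox]); t oz; t ox; t ou]).

Local Notation F := (rowf P).
Local Notation in_dom := (fun t => Omega (pt [:: t oz; t ox; t ou])).

Lemma near_dom t : in_dom t -> \forall t' \near nb t, in_dom t'.
Proof.
move=> ht; have /nbhs_nb := open_nbhs_nbhs (conj (open_Omega hsol) ht).
rewrite -row3E (_ : coords _ = t); last by apply/funext => i; rewrite /coords mxE.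
by apply: filterS => t'; rewrite row3E.
Qed.

Lemma hol_M t : in_dom t -> hol (rowf M) t.
Proof.
move=> ht; have := analytic_hol (analytic_M hsol ht).
by rewrite -row3E (_ : coords _ = t) //; apply/funext => i; rewrite /coords mxE.
Qed.

Lemma hol_M1 w : D (pt [:: w (@Ordinal 2 0 isT); w (@Ordinal 2 1 isT)]) -> hol (rowf M1) w.
Proof.
move=> hw; have := analytic_hol (analytic_M1 hsol hw).
by rewrite -row2E (_ : coords _ = w) //; apply/funext => i; rewrite /coords mxE.
Qed.

Lemma hol_P t : in_dom t -> hol F (graph_point t).
Proof. by move=> ht; apply: analytic_hol; apply: (analytic_P hsol); exact: (dom_P hsol). Qed.

Lemma graph_point0 t : graph_point t ix0 = rowf M t.
Proof. by rewrite /graph_point /coords mxE /= /rowf row3E. Qed.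
Lemma graph_point1 t : graph_point t ix1 = M1 (pt [:: t oz; t ox]).
Proof. by rewrite /graph_point /coords mxE. Qed.
Lemma graph_pointz t : graph_point t iz = t oz.
Proof. by rewrite /graph_point /coords mxE. Qed.
Lemma graph_pointx t : graph_point t ix = t ox.
Proof. by rewrite /graph_point /coords mxE. Qed.
Lemma graph_pointu t : graph_point t iu = t ou.
Proof. by rewrite /graph_point /coords mxE. Qed.

Lemma graph_point_eq t : in_dom t -> F (graph_point t) = 0.
Proof. by move=> ht; rewrite /rowf /graph_point coordsK; exact: (catalytic_eq hsol). Qed.

Lemma hol_graph_point i t : in_dom t -> hol (fun t => graph_point t i) t.
Proof.
move=> ht; move: i; apply: ord5_ind.
- apply: (hol_eq (f := rowf M)); last exact: hol_M.
  by apply: nearW => t'; rewrite graph_point0.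
- apply: (hol_eq (f := fun t => rowf M1 ((fun (j : 'I_2) (t : 'I_3 -> K) =>
      if j == @Ordinal 2 0 isT then t oz else t ox) ^~ t))).
    by apply: nearW => t'; rewrite graph_point1 /rowf row2E.
  apply: (hol_comp (q := fun j => if j == @Ordinal 2 0 isT then t oz else t ox)) => //.
    by apply: ord2_ind; exact: hol_coord.
  by apply: hol_M1; exact: (dom_M1 hsol ht).
- apply: (hol_eq (f := fun t => t oz)); last exact: hol_coord.
  by apply: nearW => t'; rewrite graph_pointz.
- apply: (hol_eq (f := fun t => t ox)); last exact: hol_coord.
  by apply: nearW => t'; rewrite graph_pointx.
- apply: (hol_eq (f := fun t => t ou)); last exact: hol_coord.
  by apply: nearW => t'; rewrite graph_pointu.
Qed.

Lemma pd_u_graph f t : in_dom t -> hol f (graph_point t) ->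
  pd ou (fun t => f (graph_point t)) t =
  pd ix0 f (graph_point t) * pd ou (rowf M) t + pd iu f (graph_point t).
Proof.
move=> ht hf.
rewrite (pd_comp (g := fun i t => graph_point t i) _ _ _ hf) //; last first.
  by move=> i; exact: hol_graph_point.
have pdE i (h : ('I_3 -> K) -> K) : (forall t, graph_point t i = h t) ->
    pd ou (fun t => graph_point t i) t = pd ou h t.
  by move=> e; congr (pd ou _ t); apply/funext.
have pd0 (h : ('I_3 -> K) -> K) : (forall t s, h (step t ou s) = h t) -> pd ou h t = 0.
  move=> e; apply: (is_pd (h := fun=> 0)); last exact: cvg_cst0.
  by apply: near0W => s; rewrite mulr0 addr0 e.
rewrite (bigD1 ix0) //= (bigD1 iu) //= big1 ?addr0 => [|i].
  by rewrite (pdE _ _ graph_point0) (pdE _ _ graph_pointu) pd_coord mulr1.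
move: i; apply: ord5_ind => // _.
- by rewrite (pdE _ _ graph_point1) pd0 ?mulr0 // => t' s; rewrite /step /= !addr0.
- by rewrite (pdE _ _ graph_pointz) pd0 ?mulr0 // => t' s; rewrite /step /= !addr0.
- by rewrite (pdE _ _ graph_pointx) pd0 ?mulr0 // => t' s; rewrite /step /= !addr0.
Qed.

Lemma graph_point_u t : in_dom t ->
  pd ix0 F (graph_point t) * pd ou (rowf M) t + pd iu F (graph_point t) = 0.
Proof.
move=> ht; rewrite -pd_u_graph //; last exact: hol_P.
rewrite (pd_eq (g := fun=> 0)); [exact: pd_cst|exact: hol_cst|].
by apply: filterS (near_dom ht) => t'; exact: graph_point_eq.
Qed.

(** The kernel method: the [u]-derivative of the catalytic equation is [P_x0 M_u + P_u = 0], so a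
    zero of [P_x0] on the graph is a critical point. *)
Lemma kernel_Pu t : in_dom t -> pd ix0 F (graph_point t) = 0 -> pd iu F (graph_point t) = 0.
Proof. by move=> ht h0; have := graph_point_u ht; rewrite h0 mul0r add0r. Qed.

(* If it vanished, differentiating twice in [u] would give a double root of the
   Hessian form, i.e. zero discriminant. *)
Lemma kernel_simple t : in_dom t -> pd ix0 F (graph_point t) = 0 ->
  disc_form F (graph_point t) != 0 ->
  pd ou (fun t => pd ix0 F (graph_point t)) t != 0.
Proof.
move=> ht h0; apply: contraNneq => hPhi.
have hF := hol_P ht; set q := graph_point t in h0 hF *.
have hM : hol (rowf M) t by exact: hol_M.
have h1 := pd_u_graph ht (hol_pd ix0 hF); rewrite hPhi -/q in h1.
have hcomp (f : ('I_5 -> K) -> K) : hol f q -> hol (fun t => f (graph_point t)) t.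
  by move=> hf; apply: (hol_comp (g := fun i t => graph_point t i) _ _ hf) => // i; exact: hol_graph_point.
have h2 : pd ou (fun t => pd ix0 F (graph_point t) * pd ou (rowf M) t +
    pd iu F (graph_point t)) t = 0.
  rewrite (pd_eq (g := fun=> 0)); [exact: pd_cst|exact: hol_cst|].
  by apply: filterS (near_dom ht) => t'; exact: graph_point_u.
have hA : hol (fun t => pd ix0 F (graph_point t)) t by apply: hcomp; exact: hol_pd.
have hB : hol (pd ou (rowf M)) t by exact: hol_pd.
have hC : hol (fun t => pd iu F (graph_point t)) t by apply: hcomp; exact: hol_pd.
move: h2; rewrite pd_add //; last exact: hol_mul.
rewrite pd_mul // hPhi mul0r add0r -/q h0 mul0r add0r pd_u_graph //; last exact: hol_pd.
rewrite -/q (pd_sym ix0 iu hF) => h2; rewrite /disc_form.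
move: (pd ix0 (pd ix0 F) q) (pd iu (pd ix0 F) q) (pd iu (pd iu F) q) (pd ou (rowf M) t) h1 h2.
clear; move=> a p c m /esym /eqP; rewrite addrC addr_eq0 => /eqP ->.
by move=> /eqP; rewrite addrC addr_eq0 => /eqP ->; apply/eqP; ring.
Qed.

(** By [kernel_simple] the equation [P_x0 = 0] on the graph can be solved for [u] as a function of
    [(z, x)]. The set [Q] keeps the resulting critical points in the region where the fold is
    understood. *)
Theorem kernel_local t (Q : set ('I_5 -> K)) : in_dom t ->
  pd ix0 F (graph_point t) = 0 -> disc_form F (graph_point t) != 0 ->
  nb (graph_point t) Q ->
  \forall w \near nb (fun i : 'I_2 => if i == @Ordinal 2 0 isT then t oz else t ox),
    exists v, [/\ Q v, F v = 0, pd iu F v = 0, pd ix0 F v = 0 &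
      [/\ v ix1 = rowf M1 w, v iz = w (@Ordinal 2 0 isT) & v ix = w (@Ordinal 2 1 isT)]].
Proof.
move=> ht h0 hd hQ; set p := fun i : 'I_2 => _.
have hF := hol_P ht; set q := graph_point t in h0 hF hd hQ.
pose join (j : 'I_3) (w : 'I_2 + unit -> K) := tnth
  [tuple w (inl (@Ordinal 2 0 isT)); w (inl (@Ordinal 2 1 isT)); w (inr tt)] j.
have hjoin j w : hol (join j) w by move: j; apply: ord3_ind; exact: hol_coord.
pose c := cmb p (fun _ : unit => t ou).
have joinc j : join j c = t j by move: j; apply: ord3_ind.
have hPhi : hol (fun t => pd ix0 F (graph_point t)) t.
  apply: (hol_comp (g := fun i t => graph_point t i) _ _ (hol_pd ix0 hF)) => // i.
  exact: hol_graph_point.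
pose Phi (w : 'I_2 + unit -> K) := pd ix0 F (graph_point (join ^~ w)).
have hP : hol Phi c.
  exact: (hol_comp (fun j => hjoin j c) joinc hPhi).
have Phi0 : Phi c = 0 by rewrite /Phi (_ : join ^~ c = t) //; apply/funext.
pose d := pd ou (fun t => pd ix0 F (graph_point t)) t.
have d0 : d != 0 by exact: kernel_simple.
have pdPhi : pd (inr tt) Phi c != 0.
  rewrite (pd_comp _ (fun j => hjoin j c) joinc hPhi) // (bigD1 ou) //= big1 ?addr0; last first.
    move=> i; move: i; apply: ord3_ind => // _.
      by rewrite (_ : join oz = fun w => w (inl (@Ordinal 2 0 isT))) // pd_coord mulr0.
    by rewrite (_ : join ox = fun w => w (inl (@Ordinal 2 1 isT))) // pd_coord mulr0.
  rewrite (_ : join ou = fun w => w (inr tt)) // pd_coord eqxx mulr1.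
  exact: d0.
have [y [y1 y2 y3 _]] := implicit_scalar hP Phi0 pdPhi.
pose lift3 w := join ^~ (cmb w (fun=> y w)).
have hl j : hol (fun w => lift3 w j) p.
  move: j; apply: ord3_ind; [exact: hol_coord|exact: hol_coord|exact: y1].
have liftp : lift3 p = t.
  by apply/funext; apply: ord3_ind => //; exact: y2.
have cl : lift3 @ nb p --> nb t.
  by rewrite -liftp; exact: (hol_cvg_nb (g := fun j w => lift3 w j)).
have cg : graph_point @ nb t --> nb q.
  apply: (hol_cvg_nb (g := fun i t => graph_point t i)) => i; exact: hol_graph_point.
apply: filterS (nbI (near_cvg cl (nbI (near_dom ht) (near_cvg cg hQ))) y3).
move=> w [[h1 h2] h3]; exists (graph_point (lift3 w)); split.
- exact: h2.
- exact: graph_point_eq.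
- exact: kernel_Pu h1 h3.
- exact: h3.
- by split; rewrite ?graph_point1 ?graph_pointz ?graph_pointx // /rowf row2E.
Qed.

End KernelMethod.

(** * Identity theorem and the principal square root *)

Section Propagation.
Variable R : realType.
Local Notation K := (C R).

Lemma near0_ex (Q : K -> Prop) : (\forall s \near (0 : K), Q s) ->
  exists2 s : R, 0 < s & Q (rc s).
Proof.
move=> /nbhs_ballP [e0 /= /rc_gt0P [e e0' ->] he].
exists (e / 2); first by rewrite divr_gt0.
apply: he; rewrite -ball_normE /= sub0r normrN lt_rc_nm nm_rc.
by rewrite gtr0_norm ?divr_gt0 // ltr_pdivrMr // ltr_pMr // ltr1n.
Qed.

Lemma An_identity (f : (unit -> K) -> K) (r b : R) : 1 < r -> An (fun=> r) f b ->
  (\forall v \near nb (fun=> 0), f v = 0) -> f (fun=> 1) = 0.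
Proof.
move=> r1 Af f0; have r0 : 0 < r by exact: lt_trans r1.
have [a [_ a2 a3 a4 _]] := power_series tt (fun=> r0) Af.
have aE n v : a n v = a n (fun=> 0).
  by rewrite -a2; congr (a n _); apply/funext; case; rewrite /zap eqxx.
have d0 : disc (fun=> r) (fun _ : unit => 0 : K) by move=> _; rewrite nm0 ltW.
have [c0|c0] := power_series_isolated r0 (fun n => a3 n _ d0).
  have d1 : disc (fun=> r) (fun _ : unit => 1 : K) by move=> _; rewrite nm1 ltW.
  have := a4 _ d1; rewrite nm1 => /(_ r1) h.
  apply: Cvg_unique h _; rewrite (_ : series _ = fun=> 0); first exact: cvg_cst.
  by apply/funext => N; rewrite /series /= big1 // => n _; rewrite aE c0 mul0r.
have cs : (fun s : K => fun _ : unit => s) @ (0 : K) --> nb (fun _ : unit => (0 : K)).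
  apply: (@nb_cvgP _ _ _ (nbhs_filter (0 : K)) _ _ (fun _ s => s)) => _.
  exact: cvg_id.
have hr : \forall s \near (0 : K), nm s <= r / 2.
  by apply: near0_nm; rewrite divr_gt0.
have [s s0 [[h1 h2] h3]] := near0_ex (filterI (filterI c0 (near_cvg cs f0)) hr).
have sr : nm (rc s) < r by apply: le_lt_trans h3 _; rewrite ltr_pdivrMr // ltr_pMr // ltr1n.
have s1 : rc s != 0 by apply/eqP => /rcI s1; rewrite s1 ltxx in s0.
have := a4 (fun=> rc s) (fun=> ltW sr) sr; rewrite h2 => h.
have := h1 s1 0; rewrite eqxx => /(_ _)/negP; case => //.
rewrite (_ : series _ = series (fun n => a n (fun=> rc s) * rc s ^+ n)) //.
by congr series; apply/funext => n; rewrite [in RHS]aE.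
Qed.

(** The neighbourhood on which the vanishing is concluded depends on [q] alone, not on [q']. This
    uniformity is what makes the set of vanishing germs relatively closed. *)
Lemma hol_identity (I : finType) (h : (I -> K) -> K) (q : I -> K) : hol h q ->
  \forall q' \near nb q, (\forall v \near nb q', h v = 0) -> \forall v \near nb q, h v = 0.
Proof.
move=> [e [b [e0 Ah]]]; have e4 : 0 < e / 4 by rewrite divr_gt0.
exists (e / 4) => // q' hq' h0; exists (e / 4) => // p hp.
(* The line from [q'] at [t = 0] to [p] at [t = 1]. Both points are within [e / 4] of [q], so the
   disc of radius 3/2, which contains 1 in its interior, is admissible:
   [e / 4 + 3 / 2 * (e / 4 + e / 4) = e]. *)
pose f (t : unit -> K) := h (tr q (fun i => (q' i - q i) + t tt * (p i - q' i))).
have Af : An (fun=> 3 / 2) f b.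
  apply: (An_comp (g := fun i t => (q' i - q i) + t tt * (p i - q' i)) _ _ Ah) => [_|i].
    by rewrite divr_ge0.
  apply: (@An_le _ _ _ _ (e / 4 + 3 / 2 * (e / 4 + e / 4))) => [_||].
  - by rewrite divr_ge0.
  - apply: An_add; first exact: An_cst.
    apply: An_mul; first exact: An_coord.
    apply: An_cst; rewrite (_ : p i - q' i = (p i - q i) - (q' i - q i)); last by ring.
    exact: le_trans (nmB _ _) (lerD (hp i) (hq' i)).
  - by lra.
have -> : h p = f (fun=> 1).
  by congr h; apply/funext => i; rewrite /tr; ring.
apply: (@An_identity f (3 / 2) b) Af _; first by lra.
have ct : (fun (t : unit -> K) i => q' i + t tt * (p i - q' i)) @ nb (fun=> 0) --> nb q'.
  have hg i : hol (fun t : unit -> K => q' i + t tt * (p i - q' i)) (fun=> 0).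
    by apply: hol_add; [exact: hol_cst|apply: hol_mul; [exact: hol_coord|exact: hol_cst]].
  have := hol_cvg_nb hg; rewrite (_ : (fun i => q' i + 0 * _) = q') //.
  by apply/funext => i; rewrite mul0r addr0.
apply: filterS (near_cvg ct h0) => t ht; rewrite -[RHS]ht; congr h.
by apply/funext => i; rewrite /tr; ring.
Qed.

(** The points near which the functions agree form an open set whose trace on [E] is relatively
    closed. The set [E] itself may be thin: analyticity at its points concerns full
    neighbourhoods. *)
Theorem connected_identity n (f g : 'rV[K]_n -> K) (E : set 'rV[K]_n) p0 :
  connected E -> (forall p, E p -> hol (rowf f) (coords p)) ->
  (forall p, E p -> hol (rowf g) (coords p)) -> E p0 ->
  (\forall v \near nb (coords p0), rowf f v = rowf g v) ->
  forall p, E p -> f p = g p.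
Proof.
move=> cE hf hg Ep0 h0.
pose h v := rowf f v - rowf g v.
pose A : set 'rV[K]_n := fun p => \forall v \near nb (coords p), h v = 0.
have oA : open A.
  rewrite openE => p Ap; apply/nbhs_nb; apply: filterS (nb_near Ap) => v.
  by rewrite /A (_ : coords _ = v) //; apply/funext => i; rewrite /coords mxE.
have EA : E `&` A = E.
  apply: cE.
  - exists p0; split=> //; apply: filterS h0 => v; rewrite /h => ->.
    by rewrite subrr.
  - by exists A.
  - exists (closure A); first exact: closed_closure.
    rewrite eqEsubset; split=> p [Ep Ap]; split=> //; first exact: subset_closure.
    have hh : hol h (coords p) by apply: hol_sub; [exact: hf|exact: hg].
    have hn := hol_identity hh.
    have hn' : nbhs p (fun q : 'rV[K]_n => A q -> A p).
      apply/nbhs_nb; apply: filterS hn => v hv hA; apply: hv; move: hA.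
      by rewrite /A (_ : coords _ = v) //; apply/funext => i; rewrite /coords mxE.
    by have [q [Aq Bq]] := Ap _ hn'; exact: Bq.
move=> p Ep; have : (E `&` A) p by rewrite EA.
move=> [_ /nb_self]; rewrite /h /rowf coordsK => /eqP.
by rewrite subr_eq0 => /eqP.
Qed.

(** The inverse is the implicit function of [f v * w = 1]. *)
Lemma hol_inv (I : finType) (f : (I -> K) -> K) (p : I -> K) :
  hol f p -> f p != 0 -> hol (fun v => (f v)^-1) p.
Proof.
move=> hf f0; set c := cmb p (fun _ : unit => (f p)^-1).
have hfl : hol (fun w : I + unit -> K => f (fun i => w (inl i))) c.
  by apply: (hol_comp (g := fun i w => w (inl i)) _ _ hf) => // i; exact: hol_coord.
have hfm : hol (fun w : I + unit -> K => f (fun i => w (inl i)) * w (inr tt)) c.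
  by apply: hol_mul => //; exact: hol_coord.
have [|||y [y1 y2 y3 _]] := @implicit_scalar R I
    (fun w => f (fun i => w (inl i)) * w (inr tt) - 1) p (f p)^-1.
- by apply: hol_sub => //; exact: hol_cst.
- by rewrite /= mulfV // subrr.
- rewrite pd_sub //; last exact: hol_cst.
  rewrite pd_mul //; last exact: hol_coord.
  rewrite pd_cst pd_coord eqxx mulr1 subr0.
  rewrite (_ : pd (inr tt) (fun w : I + unit -> K => f (fun i => w (inl i))) _ = 0).
    by rewrite mul0r add0r.
  apply: (is_pd (h := fun=> 0)); last exact: cvg_cst0.
  apply: near0W => t; rewrite mulr0 addr0; congr f.
  by apply/funext => i; rewrite /step /= addr0.
apply: hol_eq y1; apply: filterS (nbI y3 (hol_neq0 hf f0)) => v [/= e fv].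
by apply: (mulfI fv); rewrite mulfV //; apply/eqP; rewrite -subr_eq0 e.
Qed.

Lemma Re_rc (z : K) : 'Re z = rc (complex.Re z).
Proof. by rewrite numfield.Num.Theory.ReE [RHS]ReJ_add. Qed.

Lemma principal_sqrtP (w s : K) : principal_sqrt w s <-> s ^+ 2 = w /\ 0 < complex.Re s.
Proof. by rewrite /principal_sqrt Re_rc -rc0 rc_lt. Qed.

Lemma principal_sqrt_unique (w s s' : K) :
  principal_sqrt w s -> principal_sqrt w s' -> s = s'.
Proof.
move=> /principal_sqrtP [e h] /principal_sqrtP [e' h'].
have /eqP := e; rewrite -e' eqf_sqr => /orP [/eqP //|/eqP ss].
by move: h; rewrite ss; case: s' h' {e' ss} => a b /= h1; rewrite oppr_gt0 ltNge ltW.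
Qed.

Lemma principal_sqrt_neq0 (w s : K) : principal_sqrt w s -> s != 0.
Proof.
by move=> /principal_sqrtP [_ h]; apply: contraTneq h => ->; rewrite ltxx.
Qed.

(** On the slit, where no root has positive real part, the default value is 0. *)
Definition psq (w : K) : K := xget 0 [set s | principal_sqrt w s].

Lemma psqE (w s : K) : principal_sqrt w s -> psq w = s.
Proof.
move=> h; apply: (@principal_sqrt_unique w) (h).
exact: (@xgetPex _ 0 [set s | principal_sqrt w s] (ex_intro _ s h)).
Qed.

Lemma psq_local (w s : K) : principal_sqrt w s ->
  hol (fun v : unit -> K => psq (v tt)) (fun=> w) /\
  \forall v \near nb (fun _ : unit => w), principal_sqrt (v tt) (psq (v tt)).
Proof.
move=> hs; have [s2 Res] := (principal_sqrtP w s).1 hs.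
set c := cmb (fun _ : unit => w) (fun _ : unit => s).
have hc i : hol (fun v : unit + unit -> K => v i) c by exact: hol_coord.
have hq : hol (fun v : unit + unit -> K => v (inr tt) * v (inr tt)) c by exact: hol_mul.
have [|||y [y1 y2 y3 _]] := @implicit_scalar R unit
    (fun v => v (inr tt) * v (inr tt) - v (inl tt)) (fun=> w) s.
- exact: hol_sub.
- by rewrite /= -expr2 s2 subrr.
- rewrite (pd_sub _ hq (hc _)) (pd_mul _ (hc _) (hc _)) !pd_coord /= subr0 mul1r mulr1.
  by rewrite -mulr2n mulrn_eq0 /=; exact: principal_sqrt_neq0 hs.
(* Within this distance of [s] the real part stays positive, so the implicit root is the principal
   one. *)
have e0 : 0 < complex.Re s / 2 by rewrite divr_gt0.
have /cvg_nmP /(_ _ e0) := hol_cvg y1; rewrite y2 => hy.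
have hps : \forall v \near nb (fun _ : unit => w), principal_sqrt (v tt) (y v).
  apply: filterS (nbI hy y3) => v [h1 h2]; apply/principal_sqrtP.
  split; first by apply/eqP; rewrite expr2 -subr_eq0 h2.
  have := le_trans (nm_Re (s - y v)) h1.
  have -> : complex.Re (s - y v) = complex.Re s - complex.Re (y v).
    by case: (s) => a a'; case: (y v).
  by move=> /ler_normlP [_]; move: Res; move: (complex.Re s) (complex.Re (y v)) => a a'; lra.
split; last by apply: filterS hps => v h; rewrite (psqE h).
by apply: (hol_eq _ y1); apply: filterS hps => v h; rewrite (psqE h).
Qed.

End Propagation.

(** * Expansions at the fold *)

Section Expansions.
Variable R : realType.
Local Notation K := (C R).

Lemma pd_tr_at (I : finType) (f : (I -> K) -> K) (i : I) (p q : I -> K) :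
  pd i (fun v => f (tr p v)) q = pd i f (tr p q).
Proof.
rewrite -[RHS]pd_tr -[LHS]pd_tr; congr (pd i _ _); apply/funext => v; congr f.
by apply/funext => k; rewrite /tr addrA.
Qed.

(** Expansion in [s] alone, with coefficients analytic in [x]. Radius and bound do not depend on
    [x], which later gives one disc of convergence for all [x] near [x0]. *)
Lemma germ_expansion (G : (bool -> K) -> K) (x0 : K) : hol G (bp 0 x0) ->
  (\forall v \near nb (bp 0 x0), pd false G (bp 0 (v true)) = 0) ->
  exists (e B : R) (g : nat -> K -> K),
  [/\ 0 < e, forall n, hol (fun v : unit -> K => g n (v tt)) (fun=> x0),
      forall n x, nm (x - x0) <= e -> nm (g n x) * e ^+ n <= B,
      forall s x, nm (x - x0) <= e -> nm s < e ->
        series (fun n => g n x * s ^+ n) @ \oo --> G (bp s x) &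
      forall x, nm (x - x0) <= e -> g 1%N x = 0].
Proof.
move=> hG hd; have [e [e0 [[b Ab] he]]] : exists e : R, 0 < e /\
   ((exists b, An (fun=> e) (fun v => G (tr (bp 0 x0) v)) b) /\
    forall v, (forall i, nm (v i - bp 0 x0 i) <= e) -> pd false G (bp 0 (v true)) = 0).
  have [e1 e10 [b hb]] := hol_radius hG; have [e2 e20 he2] := hd.
  have m0 : 0 < Num.min e1 e2 by rewrite lt_min e10.
  exists (Num.min e1 e2); split => //; split.
    by exists b; apply: hb; rewrite ?ge_min ?lexx.
  move=> v hv; apply: he2 => i; apply: le_trans (hv i) _.
  by rewrite ge_min lexx orbT.
have [a [a1 a2 a3 a4 a5]] := power_series false (fun=> e0) Ab.
have trE s x : tr (bp 0 x0) (bp s (x - x0)) = bp s x.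
  by apply/funext; case; rewrite /tr /= ?add0r // addrC subrK.
have dE s x : nm (x - x0) <= e -> nm s <= e -> disc (fun=> e) (bp s (x - x0)).
  by move=> h1 h2; case.
have e0' : 0 <= e by exact: ltW.
have zE s x : zap (pred1 false) (bp s x) = bp 0 x by apply/funext; case.
exists e, b, (fun n x => a n (bp 0 (x - x0))); split => //.
- move=> n; have [B hB] := a1 n.
  have ha : hol (a n) (bp 0 0).
    apply: (holI e0 hB) => v _; congr (a n).
    by apply/funext; case; rewrite /tr /= add0r.
  apply: (hol_comp (g := fun i (v : unit -> K) => bp 0 (v tt - x0) i) _ _ ha).
    case; last exact: hol_cst.
    by apply: hol_sub; [exact: hol_coord|exact: hol_cst].
  by case; rewrite /= ?subrr.
- by move=> n x hx; apply: a3; apply: dE => //; rewrite nm0.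
- move=> s x hx hs; have := a4 (bp s (x - x0)) (dE _ _ hx (ltW hs)) hs.
  rewrite trE (_ : (fun n => a n (bp s (x - x0)) * _) =
                   (fun n => a n (bp 0 (x - x0)) * s ^+ n)) //.
  by apply/funext => n; rewrite -(a2 n (bp s _)) zE.
- move=> x hx; have d0 : disc (fun=> e) (bp 0 (x - x0)) by apply: dE; rewrite ?nm0.
  have hx0 i : nm (bp 0 x i - bp 0 x0 i) <= e by case: i => //=; rewrite subrr nm0.
  rewrite -(a5 _ d0) zE -[RHS](he (bp 0 x) hx0) /=.
  by rewrite -(trE 0 x) pd_tr_at.
Qed.

Lemma cvg_terms_bounded (u : nat -> K) (l : K) : series u @ \oo --> l ->
  exists B, forall n, nm (u n) <= B.
Proof.
move=> h; have /cvg_nmP /(_ 1 ltr01) [N _ hN] := h.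
exists (2 + \sum_(k < N) nm (u k)) => n; have [nN|Nn] := ltnP n N.
  rewrite (bigD1 (Ordinal nN)) //= addrCA lerDl addr_ge0 // sumr_ge0 // => k _.
  exact: nm_ge0.
have h1 := hN n Nn; have h2 := hN n.+1 (leqW Nn).
rewrite seriesSr /= in h2.
have -> : u n = (l - series u n) - (l - (series u n + u n)) by ring.
apply: le_trans (nmB _ _) _.
have S0 : 0 <= \sum_(k < N) nm (u k) by apply: sumr_ge0 => k _; exact: nm_ge0.
rewrite -[X in X <= _]addr0; apply: lerD => //.
by rewrite -[2]/(1 + 1); apply: lerD.
Qed.

Lemma nm_sign (b : bool) n : nm (((-1) ^+ b : K) ^+ n) = 1.
Proof. by rewrite !nmX nmN nm1 !expr1n. Qed.

Lemma series_sub (u v : nat -> K) (s l l' : K) :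
  series (fun n => u n * s ^+ n) @ \oo --> l -> series (fun n => v n * s ^+ n) @ \oo --> l' ->
  series (fun n => (u n - v n) * s ^+ n) @ \oo --> l - l'.
Proof.
move=> h1 h2; rewrite (_ : series _ = (fun N => series (fun n => u n * s ^+ n) N -
  series (fun n => v n * s ^+ n) N)); first exact: (cvgB h1 h2).
apply/funext => N; rewrite /series /= -sumrB; apply: eq_bigr => n _.
by rewrite mulrBl.
Qed.

Lemma series_signE (u : nat -> K) (b : bool) (s : K) :
  (fun n => ((-1) ^+ b) ^+ n * u n * s ^+ n) = (fun n => u n * ((-1) ^+ b * s) ^+ n).
Proof. by apply/funext => n; rewrite exprMn; ring. Qed.

Lemma sub_bound (u v : nat -> K) (e A B : R) : 0 <= e ->
  (forall n, nm (u n) * e ^+ n <= A) -> (forall n, nm (v n) * e ^+ n <= B) ->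
  forall n, nm (u n - v n) * e ^+ n <= A + B.
Proof.
move=> e0 hu hv n; apply: le_trans (lerD (hu n) (hv n)).
by rewrite -mulrDl; apply: ler_wpM2r; [rewrite exprn_ge0|exact: nmB].
Qed.

Lemma bound_radius (u : nat -> K) (e d B : R) : 0 <= d -> d <= e ->
  (forall n, nm (u n) * e ^+ n <= B) -> forall n, nm (u n) * d ^+ n <= B.
Proof.
move=> d0 de h n; apply: le_trans (h n); apply: ler_wpM2l; first exact: nm_ge0.
by apply: lerXn2r => //; rewrite nnegrE // (le_trans d0).
Qed.

(* Convergent power series have no zero divisors. *)
Lemma sign_dichotomy (y c : nat -> K) (L : K -> K) (e B : R) : 0 < e ->
  (forall n, nm (y n) * e ^+ n <= B) -> (forall n, nm (c n) * e ^+ n <= B) ->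
  (forall s, nm s < e -> series (fun n => c n * s ^+ n) @ \oo --> L s) ->
  (\forall s \near (0 : K), 0 < complex.Re s -> exists2 Y : K,
     series (fun n => y n * s ^+ n) @ \oo --> Y & Y = L s \/ Y = L (- s)) ->
  exists b : bool, forall n, y n = ((-1) ^+ b) ^+ n * c n.
Proof.
move=> e0 hy hc hL hs; have e0' := ltW e0.
have hcs (b : bool) n : nm (((-1) ^+ b) ^+ n * c n) * e ^+ n <= B.
  by rewrite nmM nm_sign mul1r.
have iso (b : bool) := power_series_isolated e0 (sub_bound e0' hy (hcs b)).
have [h|h1] := iso false.
  by exists false => n; apply/eqP; rewrite -subr_eq0 h.
have [h|h2] := iso true.
  by exists true => n; apply/eqP; rewrite -subr_eq0 h.
have he : \forall s \near (0 : K), nm s <= e / 2.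
  by apply: near0_nm; rewrite divr_gt0.
(* If neither difference series vanishes identically, a small positive real [s] contradicts the
   alternative; it lies in the half plane where [Y] is given. *)
have [s s0 [[[k1 k2] k3] k4]] := near0_ex (filterI (filterI (filterI h1 h2) hs) he).
have sn : rc s != 0 by apply/eqP => /rcI sn; rewrite sn ltxx in s0.
have se (b : bool) : nm ((-1) ^+ b * rc s) < e.
  rewrite nmM nmX nmN nm1 expr1n mul1r.
  by apply: le_lt_trans k4 _; rewrite ltr_pdivrMr // ltr_pMr // ltr1n.
have [Y hY hYL] := k3 s0.
have hLb (b : bool) : series (fun n => ((-1) ^+ b) ^+ n * c n * rc s ^+ n) @ \oo --> L ((-1) ^+ b * rc s).
  by rewrite series_signE; exact: hL (se b).
case: hYL => hYL.
  have := k1 sn _ (series_sub hY (hLb false)).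
  by rewrite expr0 mul1r hYL subrr eqxx.
have := k2 sn _ (series_sub hY (hLb true)).
by rewrite expr1 mulN1r hYL subrr eqxx.
Qed.

End Expansions.

(** * Dictionary between row vectors and coordinate functions *)

Section Translation.
Variable R : realType.
Local Notation K := (C R).

Lemma coords_row n (v : 'I_n -> K) : coords (\row_i v i) = v.
Proof. by apply/funext => i; rewrite /coords mxE. Qed.

Lemma rowf_partial n (i : 'I_n) (f : 'rV[K]_n -> K) : rowf (partial i f) = pd i (rowf f).
Proof. by apply/funext => v; rewrite /rowf partialE coords_row. Qed.

Lemma disc_formE (P : 'rV[K]_5 -> K) (b : 'rV[K]_5) :
  P_x0x0 P b * P_uu P b - P_x0u P b ^+ 2 = disc_form (rowf P) (coords b).
Proof.
have h i j : partial i (partial j P) b = pd i (pd j (rowf P)) (coords b).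
  by rewrite partialE rowf_partial.
exact: (f_equal2 (fun x y : K => x - y)
  (f_equal2 (fun x y : K => x * y) (h ix0 ix0) (h iu iu))
  (f_equal (fun x : K => x ^+ 2) (h iu ix0))).
Qed.

Lemma system_jacobianE (P : 'rV[K]_5 -> K) (b : 'rV[K]_5) :
  system_jacobian P b = fold_jac (rowf P) (coords b).
Proof.
apply/matrixP => k l; rewrite mxE partialE [RHS]mxE; congr (pd _ _ _).
move: k; apply: ord4_ind.
- by [].
- exact: rowf_partial.
- exact: rowf_partial.
- apply/funext => v; exact: etrans (disc_formE P (\row_i v i)) (f_equal _ (coords_row v)).
Qed.

Lemma near_slit (z0 s r : K) : z0 != 0 -> 0 < complex.Re s -> `|s| < r ->
  slit_disc z0 r (z0 * (1 - s ^+ 2)).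
Proof.
move=> hz hs sr; exists s => //; apply/principal_sqrtP; split=> //.
by rewrite [z0 * _]mulrC mulfK // opprB addrC subrK.
Qed.

Lemma slit_point (z0 z s : K) : z0 != 0 -> principal_sqrt (1 - z / z0) s ->
  z = z0 * (1 - s ^+ 2).
Proof. by move=> hz [-> _]; rewrite opprB addrC subrK mulrC divfK. Qed.

Lemma pt2_inj (z x z' x' : K) : pt [:: z; x] = pt [:: z'; x'] :> 'rV[K]_2 -> z = z' /\ x = x'.
Proof.
move=> /rowP h; have := h (@Ordinal 2 0 isT); have := h (@Ordinal 2 1 isT).
by rewrite !mxE /=.
Qed.

Lemma sign_cases (b : bool) (s : K) :
  (s = (-1) ^+ b * s /\ - s = - ((-1) ^+ b * s)) \/
  (s = - ((-1) ^+ b * s) /\ - s = (-1) ^+ b * s).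
Proof.
by case: b; [right|left]; rewrite ?expr1 ?expr0 ?mulN1r ?mul1r ?opprK.
Qed.

End Translation.

(** * The kernel curve *)

Section KernelCurve.
Variable R : realType.
Local Notation K := (C R).

Definition curve_param (z0 : K) (s : K) : K := z0 * (1 - s ^+ 2).
Definition curve_pos (U : K -> K) (z : K) : 'I_3 -> K := tnth [tuple z; 1; U z].

Lemma slit_curve (z0 s : K) (r : R) : z0 != 0 -> 0 < complex.Re s -> nm s < r ->
  slit_disc z0 (rc r) (curve_param z0 s).
Proof. by move=> h0 h1 h2; apply: near_slit => //; rewrite lt_rc_nm. Qed.

Lemma sqrt_curve (z0 s : K) : z0 != 0 -> 0 < complex.Re s ->
  principal_sqrt (1 - curve_param z0 s / z0) s.
Proof.
move=> h0 h; apply/principal_sqrtP; split=> //.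
by rewrite /curve_param [z0 * _]mulrC mulfK // opprB addrC subrK.
Qed.

(** The substitution [z = z0 (1 - s ^ 2)] with [s] in the right half disc parametrises the slit
    disc, so the hypotheses near [z0] become statements about [s] near 0. *)
Theorem curve_limit (P : 'rV[K]_5 -> K) (M : 'rV[K]_3 -> K) (Omega : set 'rV[K]_3)
    (M1 : 'rV[K]_2 -> K) (z0 u0 : K) (r' : R) (y : nat -> K) (U : K -> K)
    (bb : 'I_5 -> K) : z0 != 0 -> 0 < r' ->
  (forall z, slit_disc z0 (rc r') z -> sqrt_expansion y (1 - z / z0) (M1 (pt [:: z; 1]))) ->
  kernel_curve P M Omega M1 z0 u0 (rc r') U ->
  [/\ bb ix0 = M (pt [:: z0; 1; u0]), bb ix1 = y 0%N, bb iz = z0,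
      bb (@Ordinal 5 3 isT) = 1 & bb iu = u0] ->
  [/\ exists B, forall n, nm (y n) * (r' / 2) ^+ n <= B,
      forall s, 0 < complex.Re s -> nm s < r' ->
        series (fun j => y j * s ^+ j) @ \oo --> M1 (pt [:: curve_param z0 s; 1]) &
      forall Q : set ('I_5 -> K), nb bb Q -> \forall s \near (0 : K), 0 < complex.Re s ->
        Q (graph_point M M1 (curve_pos U (curve_param z0 s)))].
Proof.
move=> hz0 r'0 hM1 hU [bb0 bb1 bbz bbx bbu].
pose zs := curve_param z0.
pose q s := graph_point M M1 (curve_pos U (zs s)).
have slit_zs s : 0 < complex.Re s -> nm s < r' -> slit_disc z0 (rc r') (zs s).
  exact: slit_curve.
have r'2 : 0 < r' / 2 by rewrite divr_gt0.
have r'h : r' / 2 < r' by rewrite ltr_pdivrMr // ltr_pMr // ltr1n.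
have near_r : \forall s \near (0 : K), nm s < r'.
  by apply: filterS (near0_nm r'2) => s hs; exact: le_lt_trans hs r'h.
have sqrt_zs s : 0 < complex.Re s -> principal_sqrt (1 - zs s / z0) s.
  exact: sqrt_curve.
have expM1 s : 0 < complex.Re s -> nm s < r' ->
    series (fun j => y j * s ^+ j) @ \oo --> M1 (pt [:: zs s; 1]).
  by move=> h1 h2; apply: hM1 (slit_zs s h1 h2) _ (sqrt_zs s h1).
have [By hBy] : exists By, forall n, nm (y n) * (r' / 2) ^+ n <= By.
  (* Convergence at one real point bounds the terms of the series at that radius. *)
  have h2 : nm (rc (r' / 2)) < r' by rewrite nm_rc gtr0_norm.
  have [By hBy] := cvg_terms_bounded (expM1 (rc (r' / 2)) r'2 h2).
  by exists By => n; have := hBy n; rewrite nmM nmX nm_rc gtr0_norm.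
have czs : zs @ (0 : K) --> z0.
  have := cvgM0 (@cvg_cst0 R z0) (cvgB0 (@cvg_cst0 R 1)
    (cvgM0 (@cvg_id _ (nbhs (0 : K))) (@cvg_id _ (nbhs (0 : K))))).
  rewrite mulr0 subr0 mulr1; exact.
(* The filter of [s] tending to 0 with positive real part, where [s] is the principal root. *)
pose Fw : set_system (K) := within [set s | 0 < complex.Re s] (nbhs (0 : K)).
have FwF : Filter Fw by apply: within_filter; exact: nbhs_filter.
have cw : zs @ Fw --> within (slit_disc z0 (rc r')) (nbhs z0).
  move=> Q hQ; have hQ' : \forall z \near z0, slit_disc z0 (rc r') z -> Q z by exact: hQ.
  change (\forall s \near (0 : K), 0 < complex.Re s -> Q (zs s)).
  apply: filterS2 near_r (near_cvg czs hQ') => s h1 h2 h3.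
  by apply: h2; exact: slit_zs.
split; [by exists By|exact: expM1|move=> Q hQ].
suff cq : q @ Fw --> nb bb by exact: (near_cvg cq hQ).
  apply: (@nb_cvgP R (K) Fw FwF _ bb (fun i s => q s i)).
  have cE i (f : K -> K) : (forall s, q s i = f s) -> f @ Fw --> bb i ->
      (fun s => q s i) @ Fw --> bb i by move=> /funext ->.
  have czF (f : K -> K) (l : K) : f @ (0 : K) --> l -> f @ Fw --> l.
    move=> hf Q' hQ'; change (\forall s \near (0 : K), 0 < complex.Re s -> Q' (f s)).
    by apply: filterS (near_cvg hf hQ') => s hs _.
  apply: ord5_ind.
  - apply: (cE _ (fun s => M (pt [:: zs s; 1; U (zs s)]))) => [s|].
      by rewrite /q /graph_point /coords mxE.
    by rewrite bb0; exact: (cvg_comp _ _ cw (curve_lim_M hU)).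
  - apply: (cE _ (fun s => M1 (pt [:: zs s; 1]))) => [s|].
      by rewrite /q /graph_point /coords mxE.
    (* The limit of [M1] along the curve is the constant term of its expansion, by continuity of the
       sum. *)
    rewrite bb1; have [h hh [h0 hs]] := series_hol r'2 hBy.
    have cs : (fun s : K => fun _ : unit => s) @ (0 : K) --> nb (fun _ : unit => (0 : K)).
      by apply: (@nb_cvgP _ _ _ (nbhs_filter (0 : K)) _ _ (fun _ s => s)) => _; exact: cvg_id.
    have ch := czF _ _ (cvg_comp _ _ cs (hol_cvg hh)); rewrite h0 in ch.
    apply/cvg_nmP => d d0; have /cvg_nmP /(_ _ d0) hd := ch.
    have hs2 : \forall s \near Fw, nm s < r' /\
        series (fun n => y n * s ^+ n) @ \oo --> h (fun=> s).
      by apply: filterS2 near_r (near_cvg cs hs) => s h1 h2 _.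
    have hs3 : \forall s \near Fw, 0 < complex.Re s.
      by apply: (@near0W R) => s; exact.
    apply: filterS3 hd hs2 hs3 => s h1 [h2 h3] h4.
    by rewrite (Cvg_unique (expM1 s h4 h2) h3).
  - apply: (cE _ zs) => [s|]; first by rewrite /q /graph_point /coords mxE.
    by rewrite bbz; exact: czF czs.
  - apply: (cE _ (fun=> 1)) => [s|]; first by rewrite /q /graph_point /coords mxE.
    by rewrite bbx; exact: (czF _ _ (@cvg_cst0 R 1)).
  - apply: (cE _ (fun s => U (zs s))) => [s|]; first by rewrite /q /graph_point /coords mxE.
    by rewrite bbu; exact: (cvg_comp _ _ cw (curve_lim_u hU)).
Qed.

Lemma curve_critical (P : 'rV[K]_5 -> K) (W : set 'rV[K]_5) (M : 'rV[K]_3 -> K)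
    (Omega : set 'rV[K]_3) (M1 : 'rV[K]_2 -> K) (D : set 'rV[K]_2) (z0 u0 r : K) (U : K -> K) :
  catalytic_solution P W M Omega M1 D -> kernel_curve P M Omega M1 z0 u0 r U ->
  forall z, slit_disc z0 r z -> let q := graph_point M M1 (curve_pos U z) in
  [/\ Omega (pt [:: z; 1; U z]), rowf P q = 0, pd iu (rowf P) q = 0 & pd ix0 (rowf P) q = 0].
Proof.
move=> hsol hU z hz q; have hd := curve_dom hU hz.
have h0 : pd ix0 (rowf P) q = 0 := etrans (esym (partialE ix0 P _)) (curve_eq hU hz).
have h1 : pd iu (rowf P) q = 0 := kernel_Pu hsol (t := curve_pos U z) hd h0.
split; [exact: hd|exact: (graph_point_eq hsol (t := curve_pos U z) hd)|exact: h1|exact: h0].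
Qed.

End KernelCurve.

(** * Selection of the branch at x = 1 and its continuation *)

Theorem theorem4 (R : realType)
  (P : 'rV[C R]_5 -> C R) (W : set 'rV[C R]_5)
  (M : 'rV[C R]_3 -> C R) (Omega : set 'rV[C R]_3)
  (M1 : 'rV[C R]_2 -> C R) (D : set 'rV[C R]_2)
  (z0 u0 r : C R) (y : nat -> C R) (U : C R -> C R)
  (x0 x1 rho u : C R -> C R)
  (b : 'rV[C R]_5)
  (hb : b = pt [:: M (pt [:: z0; 1; u0]); M1 (pt [:: z0; 1]); z0; 1; u0])
  (hsol : catalytic_solution P W M Omega M1 D)
  (hz0 : z0 != 0) (hr : 0 < r)
  (hdom : forall z, slit_disc z0 r z -> D (pt [:: z; 1]))
  (hM1 : forall z, slit_disc z0 r z ->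
           sqrt_expansion y (1 - z / z0) (M1 (pt [:: z; 1])))
  (hM1z0 : M1 (pt [:: z0; 1]) = y 0%N)
  (hy1 : y 1%N = 0) (hy3 : y 3%N != 0)
  (hU : kernel_curve P M Omega M1 z0 u0 r U)
  (hW : W b)
  (hP : P b = 0) (hPu : P_u P b = 0) (hPx0 : P_x0 P b = 0)
  (hPx1 : P_x1 P b != 0)
  (hdisc : P_x0x0 P b * P_uu P b = P_x0u P b ^+ 2)
  (hsys : defined_by_system P (M (pt [:: z0; 1; u0])) (M1 (pt [:: z0; 1]))
            z0 u0 x0 x1 rho u) :
  exists (a : nat -> C R -> C R) (delta : C R),
    0 < delta /\
    (forall j, analytic1_at (a j) 1) /\
    (forall j, a j 1 = y j) /\
    (forall x : C R, `|x - 1| < delta -> a 1%N x = 0) /\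
    (* for every x close to 1 the expansion converges on a full disc in
       s = (1 - z / rho x)^(1/2) *)
    (forall x s : C R, `|x - 1| < delta -> `|s| < delta ->
       cvgn (series (fun j => a j x * s ^+ j))) /\
    (* and it represents M1 on each part of the domain of M1 in the slit
       neighbourhood that is connected to x = 1 *)
    (forall E : set 'rV[C R]_2,
       connected E -> E `<=` D `&` slit_region rho delta ->
       (exists z, E (pt [:: z; 1])) ->
       forall z x, E (pt [:: z; x]) ->
         sqrt_expansion (a^~ x) (1 - z / rho x) (M1 (pt [:: z; x]))).
Proof.
pose F := rowf P; pose bb := coords b.
have bbE : bb = coords (pt [:: M (pt [:: z0; 1; u0]); M1 (pt [:: z0; 1]); z0; 1; u0]).
  by rewrite /bb hb.
have bb0 : bb ix0 = M (pt [:: z0; 1; u0]) by rewrite bbE /coords mxE.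
have bb1 : bb ix1 = M1 (pt [:: z0; 1]) by rewrite bbE /coords mxE.
have bbz : bb iz = z0 by rewrite bbE /coords mxE.
have bbx : bb (@Ordinal 5 3 isT) = 1 by rewrite bbE /coords mxE.
have bbu : bb iu = u0 by rewrite bbE /coords mxE.
have hF : hol F bb by apply: analytic_hol; exact: (analytic_P hsol hW).
have F0 : F bb = 0 by rewrite /F /rowf /bb coordsK.
have Fu0 : pd iu F bb = 0 := etrans (esym (partialE iu P b)) hPu.
have Fx0 : pd ix0 F bb = 0 := etrans (esym (partialE ix0 P b)) hPx0.
have Fx1 : pd ix1 F bb != 0.
  have e1 : pd ix1 F bb = P_x1 P b := esym (partialE ix1 P b).
  by rewrite e1.
have Fd : disc_form F bb = 0.
  by apply: etrans (esym (disc_formE P b)) _; rewrite hdisc subrr.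
have FJ : \det (fold_jac F bb) != 0.
  by rewrite -system_jacobianE hb; exact: regular_system hsys.
have bz : bb iz != 0 by rewrite bbz.
have [Z [G [[hZ Zb] hG dG dich zrho]]] := fold_resolved hF F0 Fu0 Fx0 Fx1 Fd FJ bz.
rewrite bbx in hZ Zb hG dG; rewrite bbz in Zb.
have [e [B [g [e0 ga gb gs g1]]]] := germ_expansion hG dG.
have [v0 v1 vrho vu] := base_values hsys.
have [cx0 cx1 crho cu] := base_continuity hsys.
(* Continuity at 1 keeps the given branch near the base point, where critical points of zero
   discriminant satisfy [z = Z x]. *)
have rhoZ : \forall x \near (1 : C R), rho x = Z x.
  have cX : (fun x => coords (pt [:: x0 x; x1 x; rho x; x; u x]) : 'I_5 -> C R) @ (1 : C R) --> nb bb.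
    apply: (@nb_cvgP R (C R) (nbhs (1 : C R)) (nbhs_filter (1 : C R)) _ bb
      (fun i x => coords (pt [:: x0 x; x1 x; rho x; x; u x]) i)).
    have cE i (f : C R -> C R) : (forall x, coords (pt [:: x0 x; x1 x; rho x; x; u x]) i = f x) ->
        f @ (1 : C R) --> bb i ->
        (fun x => coords (pt [:: x0 x; x1 x; rho x; x; u x]) i) @ (1 : C R) --> bb i.
      by move=> /funext ->.
    apply: ord5_ind.
    - apply: (cE _ x0) => [x|]; first by rewrite /coords mxE.
      by rewrite bb0 -v0; exact: cx0.
    - apply: (cE _ x1) => [x|]; first by rewrite /coords mxE.
      by rewrite bb1 -v1; exact: cx1.
    - apply: (cE _ rho) => [x|]; first by rewrite /coords mxE.
      by rewrite bbz -vrho; exact: crho.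
    - apply: (cE _ id) => [x|]; first by rewrite /coords mxE.
      by rewrite bbx; exact: cvg_id.
    - apply: (cE _ u) => [x|]; first by rewrite /coords mxE.
      by rewrite bbu -vu; exact: cu.
  apply: filterS2 (solves_system hsys) (near_cvg cX zrho) => x [s1 s2 s3 s4] hx.
  have e1 : F (coords (pt [:: x0 x; x1 x; rho x; x; u x])) = 0 by rewrite /F /rowf coordsK.
  have e2 := etrans (esym (partialE iu P _)) s2.
  have e3 := etrans (esym (partialE ix0 P _)) s3.
  have e4 : disc_form F (coords (pt [:: x0 x; x1 x; rho x; x; u x])) = 0.
    by apply: etrans (esym (disc_formE P _)) _; rewrite s4 subrr.
  by have := hx e1 e2 e3 e4; rewrite /coords !mxE.
clear hP hPu hPx0 hPx1 hdisc F0 Fu0 Fx0 Fx1 Fd FJ bz.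
have [r' r'0 rE] := rc_gt0P hr; subst r.
have bbs : [/\ bb ix0 = M (pt [:: z0; 1; u0]), bb ix1 = y 0%N, bb iz = z0,
    bb (@Ordinal 5 3 isT) = 1 & bb iu = u0] by rewrite bb1 hM1z0.
have [[By hBy] expM1 near_curve] := curve_limit hz0 r'0 hM1 hU bbs.
have crit := curve_critical hsol hU.
have slit_s (s : C R) : 0 < complex.Re s -> nm s < r' -> slit_disc z0 (rc r') (curve_param z0 s).
  exact: slit_curve.
have r'2 : 0 < r' / 2 by rewrite divr_gt0.
have r'h : r' / 2 < r' by rewrite ltr_pdivrMr // ltr_pMr // ltr1n.
have near_r : \forall s \near (0 : C R), nm s < r'.
  by apply: filterS (near0_nm r'2) => s hs; exact: le_lt_trans hs r'h.
(* The alternative at the fold as a property of points, so that it can be required around each point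
   of the kernel curve. *)
pose Q (v : 'I_5 -> C R) := F v = 0 -> pd iu F v = 0 -> pd ix0 F v = 0 ->
  forall s, s != 0 -> v iz = Z (v (@Ordinal 5 3 isT)) * (1 - s ^+ 2) ->
  disc_form F v != 0 /\
  (v ix1 = G (bp s (v (@Ordinal 5 3 isT))) \/ v ix1 = G (bp (- s) (v (@Ordinal 5 3 isT)))).
have nQ : nb bb Q by exact: dich.
clear dich.
have curve_dich s : 0 < complex.Re s -> nm s < r' ->
    Q (graph_point M M1 (curve_pos U (curve_param z0 s))) ->
    disc_form F (graph_point M M1 (curve_pos U (curve_param z0 s))) != 0 /\
    (M1 (pt [:: curve_param z0 s; 1]) = G (bp s 1) \/
     M1 (pt [:: curve_param z0 s; 1]) = G (bp (- s) 1)).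
  move=> h1 h2 hQ; have [_ c1 c2 c3] := crit _ (slit_s s h1 h2).
  have := hQ c1 c2 c3 s; rewrite graph_point1 graph_pointz graph_pointx.
  apply; last by rewrite Zb.
  exact: principal_sqrt_neq0 (sqrt_curve hz0 h1).
have one_e : nm (1 - 1 : C R) <= e by rewrite subrr nm0 ltW.
(* The expansion of [G] is controlled up to [e], the terms of the series of [y] up to [r' / 2]. *)
pose d := Num.min e (r' / 2).
have d0 : 0 < d by rewrite lt_min e0.
have de : d <= e by rewrite ge_min lexx.
have dr : d <= r' / 2 by rewrite ge_min lexx orbT.
have [sg yg] : exists sg : bool, forall n, y n = ((-1) ^+ sg) ^+ n * g n 1.
  apply: (@sign_dichotomy R y (g ^~ 1) (fun s => G (bp s 1)) d (Num.max By B) d0).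
  - move=> n; apply: le_trans (bound_radius (ltW d0) dr hBy n) _.
    by rewrite le_max lexx.
  - move=> n; apply: le_trans (bound_radius (ltW d0) de (fun n => gb n 1 one_e) n) _.
    by rewrite le_max lexx orbT.
  - by move=> s hs; apply: gs one_e _; exact: lt_le_trans hs de.
  - apply: filterS2 near_r (near_curve Q nQ) => s h1 h2 h3.
    exists (M1 (pt [:: curve_param z0 s; 1])); first exact: expM1.
    by have [] := curve_dich s h3 h1 (h2 h3).
have gsg s x : nm (x - 1) <= e -> nm s < e ->
    series (fun n => ((-1) ^+ sg) ^+ n * g n x * s ^+ n) @ \oo --> G (bp ((-1) ^+ sg * s) x).
  move=> h1 h2; rewrite series_signE; apply: gs h1 _.
  by rewrite nmM nmX nmN nm1 expr1n mul1r.
have ysg s : nm s < e -> series (fun n => y n * s ^+ n) @ \oo --> G (bp ((-1) ^+ sg * s) 1).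
  move=> hs; rewrite (_ : (fun n => _) = (fun n => ((-1) ^+ sg) ^+ n * g n 1 * s ^+ n)).
    exact: gsg.
  by apply/funext => n; rewrite yg.
have branches : \forall s \near (0 : C R), s != 0 ->
    G (bp ((-1) ^+ sg * s) 1) != G (bp (- ((-1) ^+ sg * s)) 1).
  have hB1 n : nm (y n) * d ^+ n <= By by exact: bound_radius (ltW d0) dr hBy n.
  have hB2 n : nm (((-1) ^+ true) ^+ n * y n) * d ^+ n <= By.
    by rewrite nmM nm_sign mul1r.
  (* The difference of the two branches at [x = 1] has coefficients [y n - (-1) ^+ n * y n]; at
     [n = 3] this is twice [y 3], so it is not identically zero. *)
  have [h|h] := power_series_isolated d0 (sub_bound (ltW d0) hB1 hB2).
    exfalso; move/eqP: (h 3%N); rewrite expr1 exprS sqrrN expr1n mulr1 mulN1r opprK.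
    by rewrite -mulr2n mulrn_eq0 /= (negPf hy3).
  have d2 : 0 < d / 2 by rewrite divr_gt0.
  apply: filterS2 h (near0_nm d2) => s h1 h2 s0.
  have se : nm s < e.
    by apply: le_lt_trans h2 (lt_le_trans _ de); rewrite ltr_pdivrMr // ltr_pMr // ltr1n.
  have e1 := ysg s se; have := ysg (- s); rewrite nmN => /(_ se) e2.
  rewrite (_ : (fun n => _) = (fun n => ((-1) ^+ true) ^+ n * y n * s ^+ n)) in e2; last first.
    by rewrite series_signE expr1; apply/funext => n; rewrite mulN1r.
  by have := h1 s0 _ (series_sub e1 e2); rewrite subr_eq0 mulrN.
(* One radius for all requirements near [s = 0], [x = 1]. The property [Q] is demanded around the
   curve point, because the points supplied by [kernel_local] may have [x] different from 1. *)
have [dl dl0 [dle dlr hdl]] : exists2 dl : R, 0 < dl & [/\ dl <= e, dl <= r' &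
    forall s x : C R, nm s < dl -> nm (x - 1) < dl ->
    [/\ rho x = Z x, hol G (bp s x) /\ hol (fun v : bool -> C R => Z (v true)) (bp s x), Z x != 0,
      0 < complex.Re s -> \forall v \near nb (graph_point M M1 (curve_pos U (curve_param z0 s))), Q v &
      s != 0 -> G (bp ((-1) ^+ sg * s) 1) != G (bp (- ((-1) ^+ sg * s)) 1)]].
  have ct := hol_cvg (@hol_coord R _ true (bp 0 1)).
  have cf := hol_cvg (@hol_coord R _ false (bp 0 1)).
  have Z1 : Z 1 != 0 by rewrite Zb.
  have n1 := near_cvg ct rhoZ.
  have n2 := near_cvg cf (near_curve _ (nb_near nQ)).
  have n3 := near_cvg cf branches.
  have n4 := hol_neq0 hZ Z1.
  have [d1 d10 hd1] := nbI n1 (nbI n2 (nbI n3 (nbI n4 (nbI (hol_nb hG) (hol_nb hZ))))).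
  exists (Num.min d1 (Num.min e r')); first by rewrite !lt_min d10 e0.
  split; [by rewrite !ge_min lexx orbT|by rewrite !ge_min lexx !orbT|].
  move=> s x; rewrite !lt_min => /andP [hs _] /andP [hx _].
  have hv i : nm (bp s x i - bp 0 1 i) <= d1 by case: i; rewrite /= ?subr0 ltW.
  by have [k1 [k2 [k3 [k4 [k5 k6]]]]] := hd1 _ hv; split.
clear rhoZ branches near_curve dG hG hZ.
exists (fun n x => ((-1) ^+ sg) ^+ n * g n x), (rc dl).
have sgdl s : nm s < dl -> nm ((-1) ^+ sg * s) < dl.
  by rewrite nmM nmX nmN nm1 expr1n mul1r.
split; first by rewrite -rc0 rc_lt.
split.
  move=> j; apply: hol_analytic1; apply: hol_mul (ga j); exact: hol_cst.
split; first by move=> j; rewrite yg.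
split.
  move=> x; rewrite lt_rc_nm => hx; rewrite g1 ?mulr0 //.
  exact: le_trans (ltW hx) dle.
split.
  move=> x s; rewrite !lt_rc_nm => hx hs; apply: cvgP (gsg s x _ _).
    exact: le_trans (ltW hx) dle.
  exact: lt_le_trans hs dle.
move=> E cE ED [zb Ezb].
(* The candidate for [M1] is written with [Z], whose analyticity is known and which equals [rho]
   near 1. *)
pose gE (p : 'rV[C R]_2) : C R :=
  G (bp ((-1) ^+ sg * psq (1 - p 0 (@Ordinal 2 0 isT) / Z (p 0 (@Ordinal 2 1 isT))))
        (p 0 (@Ordinal 2 1 isT))).
have Eslit z x : E (pt [:: z; x]) -> D (pt [:: z; x]) /\
    exists2 s, principal_sqrt (1 - z / Z x) s & nm s < dl /\ nm (x - 1) < dl.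
  move=> Ezx; have [Dp [z' [x' [/pt2_inj [ez ex] hx [s hs sdl]]]]] := ED _ Ezx.
  subst z' x'; rewrite lt_rc_nm in hx; rewrite lt_rc_nm in sdl.
  split; [exact: Dp|exists s => //].
  by have [<-] := hdl s x sdl hx.
have EP p : E p -> p = pt [:: p 0 (@Ordinal 2 0 isT); p 0 (@Ordinal 2 1 isT)].
  by move=> _; apply/rowP; apply: ord2_ind; rewrite !mxE.
pose S (w : 'I_2 -> C R) := psq (1 - w (@Ordinal 2 0 isT) / Z (w (@Ordinal 2 1 isT))).
have gES : rowf gE = (fun w => G (bp ((-1) ^+ sg * S w) (w (@Ordinal 2 1 isT)))).
  by apply/funext => w; rewrite /rowf /gE !mxE.
have hS z x s : principal_sqrt (1 - z / Z x) s -> nm s < dl -> nm (x - 1) < dl ->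
    let w := coords (pt [:: z; x]) in
    [/\ hol S w, forall tau : bool, hol (fun w' => G (bp ((-1) ^+ tau * S w') (w' (@Ordinal 2 1 isT)))) w, S w = s,
      (\forall w' \near nb w, principal_sqrt (1 - w' (@Ordinal 2 0 isT) / Z (w' (@Ordinal 2 1 isT))) (S w')) &
      (\forall w' \near nb w, Z (w' (@Ordinal 2 1 isT)) != 0)].
  move=> hs sdl xdl w.
  have w0 : w (@Ordinal 2 0 isT) = z by rewrite /w /coords mxE.
  have w1 : w (@Ordinal 2 1 isT) = x by rewrite /w /coords mxE.
  have [_ [hG hZ] Zx _ _] := hdl s x sdl xdl.
  have hZw : hol (fun w' : 'I_2 -> C R => Z (w' (@Ordinal 2 1 isT))) w.
    apply: (hol_comp (f := fun v : bool -> C R => Z (v true))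
      (g := fun i w' => bp s (w' (@Ordinal 2 1 isT)) i) _ _ hZ).
      by case; [exact: hol_coord|exact: hol_cst].
    by case => //=; rewrite w1.
  have Zw0 : Z (w (@Ordinal 2 1 isT)) != 0 by rewrite w1.
  pose T (_ : unit) (w' : 'I_2 -> C R) := 1 - w' (@Ordinal 2 0 isT) / Z (w' (@Ordinal 2 1 isT)).
  have hT i : hol (T i) w.
    apply: hol_sub; first exact: hol_cst.
    by apply: hol_mul; [exact: hol_coord|exact: hol_inv].
  have Tw i : T i w = 1 - z / Z x by rewrite /T w0 w1.
  have [hp np] := psq_local hs.
  have hSw : hol S w by exact: (hol_comp hT Tw hp).
  have Sw : S w = s by rewrite /S w0 w1; exact: psqE.
  split => //.
  - move=> tau; pose A (i : bool) (w' : 'I_2 -> C R) := bp ((-1) ^+ tau * S w') (w' (@Ordinal 2 1 isT)) i.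
    have hA i : hol (A i) w.
      by case: i; [exact: hol_coord|apply: hol_mul; [exact: hol_cst|exact: hSw]].
    have Aw i : A i w = bp ((-1) ^+ tau * s) x i by case: i; rewrite /A /= ?w1 ?Sw.
    have sd : nm ((-1) ^+ tau * s) < dl by rewrite nmM nmX nmN nm1 expr1n mul1r.
    have [_ [hG' _] _ _ _] := hdl _ x sd xdl.
    have AE w' : A ^~ w' = bp ((-1) ^+ tau * S w') (w' (@Ordinal 2 1 isT)) by apply/funext; case.
    have := hol_comp hA Aw hG'; apply: hol_eq; apply: nearW => w'; exact: (congr1 G (AE w')).
  - have cT : (fun w' => T ^~ w') @ nb w --> nb (fun _ : unit => 1 - z / Z x).
      have Twf : T ^~ w = (fun _ : unit => 1 - z / Z x) by apply/funext => i; exact: Tw.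
      by have := hol_cvg_nb hT; rewrite Twf.
    exact: (near_cvg cT np).
  - exact: hol_neq0 hZw Zw0.
(* Both functions are analytic along [E], so it suffices to compare germs at [(zb, 1)]; the kernel
   curve is needed only there. *)
have fg : forall p, E p -> M1 p = gE p.
  have [Db [sb hsb [sbd xbd]]] := Eslit zb 1 Ezb.
  apply: (connected_identity cE _ _ Ezb).
  - by move=> p /ED [Dp _]; apply: analytic_hol; exact: (analytic_M1 hsol).
  - move=> p Ep; have e1 := EP p Ep; have Ep' := Ep; rewrite e1 in Ep'.
    have [_ [s h1 [h2 h3]]] := Eslit _ _ Ep'.
    by rewrite e1; have [_ /(_ sg)] := hS _ _ _ h1 h2 h3; rewrite -gES.
  - have hz : curve_param z0 sb = zb.
      by rewrite Zb in hsb; rewrite [RHS](slit_point hz0 hsb).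
    have [_ Resb] := (principal_sqrtP _ _).1 hsb.
    have sbr : nm sb < r' := lt_le_trans sbd dlr.
    have [_ _ _ nQb brb] := hdl sb 1 sbd xbd.
    have nQ' := nQb Resb.
    have [dis _] := curve_dich sb Resb sbr (nb_self nQ').
    have [c0 _ _ c3] := crit _ (slit_s sb Resb sbr).
    have nK := kernel_local hsol (t := curve_pos U (curve_param z0 sb)) c0 c3 dis nQ'.
    have wE : (fun i : 'I_2 => if i == @Ordinal 2 0 isT
        then curve_pos U (curve_param z0 sb) (@Ordinal 3 0 isT)
        else curve_pos U (curve_param z0 sb) (@Ordinal 3 1 isT)) = coords (pt [:: zb; 1]).
      by rewrite -hz; apply/funext; apply: ord2_ind; rewrite /coords mxE.
    rewrite wE in nK.
    have [_ hGt Sw ps Zn] := hS zb 1 sb hsb sbd xbd.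
    have M1b : M1 (pt [:: zb; 1]) = G (bp ((-1) ^+ sg * sb) 1).
      by rewrite -hz; exact: Cvg_unique (expM1 sb Resb sbr) (ysg sb (lt_le_trans sbd dle)).
    (* The difference from the wrong branch. It is nonzero at [(zb, 1)], hence nearby, which rules
       that branch out of the alternative for [x] different from 1 as well. *)
    pose other (w : 'I_2 -> C R) := rowf M1 w - G (bp ((-1) ^+ (~~ sg) * S w) (w (@Ordinal 2 1 isT))).
    have hoth : hol other (coords (pt [:: zb; 1])).
      by apply: hol_sub; [apply: analytic_hol; exact: (analytic_M1 hsol)|exact: hGt].
    have sgN s : (-1) ^+ (~~ sg) * s = - ((-1) ^+ sg * s).
      by case: (sg); rewrite ?expr0 ?expr1 ?mulN1r ?mul1r ?opprK.
    have oth0 : other (coords (pt [:: zb; 1])) != 0.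
      rewrite /other Sw /rowf coordsK M1b sgN subr_eq0 /coords mxE.
      exact: brb (principal_sqrt_neq0 hsb).
    have nO := hol_neq0 hoth oth0.
    apply: filterS (nbI nK (nbI ps (nbI Zn nO))).
    move=> w [[v [Qv f0 fu fx [v1' vz vx]]] [psw [Zw nw]]].
    have eqz : v iz = Z (v (@Ordinal 5 3 isT)) * (1 - S w ^+ 2).
      by rewrite vz vx; exact: slit_point Zw psw.
    have [_ alt] := Qv f0 fu fx (S w) (principal_sqrt_neq0 psw) eqz.
    have no : rowf M1 w != G (bp (- ((-1) ^+ sg * S w)) (w (@Ordinal 2 1 isT))).
      by move: nw; rewrite /other sgN subr_eq0.
    rewrite gES; rewrite v1' vx in alt.
    have [[e1 e2]|[e1 e2]] := sign_cases sg (S w).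
      case: alt => alt; first by rewrite alt -e1.
      by move: no; rewrite -e2 -alt eqxx.
    case: alt => alt; last by rewrite alt e2.
    by move: no; rewrite -e1 -alt eqxx.
move=> z x Ezx s hs.
have [Dp [s' h1 [h2 h3]]] := Eslit z x Ezx.
have [rZ _ _ _ _] := hdl s' x h2 h3.
rewrite rZ in hs; rewrite (principal_sqrt_unique hs h1) (fg _ Ezx) /gE !mxE /= (psqE h1).
apply: gsg; first exact: le_trans (ltW h3) dle.
exact: lt_le_trans h2 dle.

Qed.
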